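(* For $z \in \mathbb{C}$ let $W_{j}(a,z)$ ($j=0,3$) be as below, and $\hat{N}_{W}(a,z)$ be the analytically continued complementary Nield-Kuznetsov function. Let $N_{W}(a,z)$ be the Nield-Kuznetsov function with $W$ extended to complex argument. Then \[ N_{W}(a,z)=c_{0}^{(0)}(a)W_{0}(a,z)+c_{0}^{(3)}(a)W_{3}(a,z)-\hat{N}_{W}(a,z), \] where \[ c_{0}^{(0)}(a)=\frac {\sqrt {\pi}2^{\frac{5}{4}+\frac{1}{2}ia}e^{ \frac{1}{2}\pi a+\frac{3}{4}\pi i}Y(a)}{\Gamma\left( \frac{1}{4}-\frac{1}{2}ia \right) }+2^{-\frac{5}{4}+\frac{1}{2}ia}e^{ \frac{1}{2}\pi a+\frac{1}{4}\pi i}\Gamma\left( \tfrac{1}{4}+\tfrac{1}{2}ia \right), \] $c_{0}^{(3)}(a)=\overline{c_{0}^{(0)}(a)}$, and $Y(a)= \Im\{ (1-2ia)^{-1}F(\tfrac{1}{2}, 1;\tfrac{5}{4}-\tfrac{1}{2}ia;\tfrac{1}{2})\}$ with $F$ the Gauss hypergeometric function.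
   Context: $a$ is real. $U(a,z)$ is the standard parabolic cylinder function (solution of $y''-(\tfrac14 z^2+a)y=0$ recessive as $z\to+\infty$). $W_{j}(a,z)=U\left((-1)^{j}ia,(-i)^{j}ze^{-\pi i/4}\right)$, $j=0,3$, solutions of $y''+(\tfrac14 z^2-a)y=0$. The Weber function is extended to complex $z$ by $W(a,z)=\sqrt{\tfrac{1}{2}k}\, e^{\pi a/4}\{ e^{i\rho}W_{0}(a,z)+e^{-i\rho }W_{3}(a,z)\}$, $k=\sqrt{1+e^{2\pi a}}-e^{\pi a}$, $\rho=\tfrac12\arg\Gamma(\tfrac12+ia)+\tfrac18\pi$. For real $x$, $N_{W}(a,x)=W(a,x) \int_{0}^x W(a,-t)dt-W(a,-x)\int_{0}^x W(a,t)dt$, extended to $x=z$ complex. The complementary function is $\hat{N}_{W}(a,z)=ie^{\pi a/2}[W_{3}(a,z)\int_{e^{\pi i/4}\infty}^z W_{0}(a,t)dt-W_{0}(a,z) \int_{e^{-\pi i/4}\infty}^z W_{3}(a,t)dt]$, which for real $z=x$ equals $W(a,x)\int_{x}^{\infty} W(a,-t)dt-W(a,-x) \int_{x}^{\infty} W(a,t)dt$. *)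

(* Defs.v *)
From Stdlib Require Import Reals Factorial.
From Coquelicot Require Import Coquelicot.
Open Scope R_scope.

Definition cexp (z : C) : C :=
  (exp (Re z) * cos (Im z), exp (Re z) * sin (Im z)).

Definition cpow_pos (b : R) (s : C) : C := cexp (s * RtoC (ln b))%C.

Fixpoint cpown (z : C) (n : nat) : C :=
  match n with O => RtoC 1 | S m => (z * cpown z m)%C end.

Definition climseq (u : nat -> C) : C :=
  (real (Lim_seq (fun n => Re (u n))), real (Lim_seq (fun n => Im (u n)))).

Fixpoint cpsum (u : nat -> C) (n : nat) : C :=
  match n with O => RtoC 0 | S m => (cpsum u m + u m)%C end.
Definition cseries (u : nat -> C) : C := climseq (cpsum u).

Fixpoint cpoch (s : C) (n : nat) : C :=
  match n with O => RtoC 1 | S m => (cpoch s m * (s + RtoC (INR m)))%C end.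

(* reciprocal Gamma function 1/Gamma(s) (entire), via Gauss/Euler limit
   1/Gamma(s) = lim s(s+1)...(s+n) / (n! n^s) *)
Definition rgamma (s : C) : C :=
  climseq (fun n => (cpoch s (S n) / (RtoC (INR (fact n)) * cpow_pos (INR n) s))%C).

Definition kummerM (a b z : C) : C :=
  cseries (fun n => (cpoch a n / (cpoch b n * RtoC (INR (fact n))) * cpown z n)%C).

Definition hyp2F1 (al be ga z : C) : C :=
  cseries (fun n => (cpoch al n * cpoch be n / (cpoch ga n * RtoC (INR (fact n)))
                      * cpown z n)%C).

(* Standard parabolic cylinder function U(a,z), complex a and z (DLMF 12.2.6,
   12.2.7, 12.4.1, 12.7.12, 12.7.13):
   U(a,z) = U(a,0) u1(a,z) + U'(a,0) u2(a,z). *)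
Definition PCU (a z : C) : C :=
  let z2 := (z * z)%C in
  let U0 := (RtoC (sqrt PI) * rgamma (RtoC (3/4) + a / RtoC 2)
               / cpow_pos 2 (a / RtoC 2 + RtoC (1/4)))%C in
  let U1 := (- (RtoC (sqrt PI) * rgamma (RtoC (1/4) + a / RtoC 2)
               / cpow_pos 2 (a / RtoC 2 - RtoC (1/4))))%C in
  let u1 := (cexp (- z2 / RtoC 4)
               * kummerM (a / RtoC 2 + RtoC (1/4)) (RtoC (1/2)) (z2 / RtoC 2))%C in
  let u2 := (z * cexp (- z2 / RtoC 4)
               * kummerM (a / RtoC 2 + RtoC (3/4)) (RtoC (3/2)) (z2 / RtoC 2))%C in
  (U0 * u1 + U1 * u2)%C.

Definition Wj (j : nat) (a : R) (z : C) : C :=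
  PCU (cpown (RtoC (-1)) j * Ci * RtoC a)%C
      (cpown (- Ci) j * z * cexp (RtoC (- (PI / 4)) * Ci))%C.

Definition kW (a : R) : R := sqrt (1 + exp (2 * PI * a)) - exp (PI * a).

(* ph Gamma(1/2 + i a), the branch that is 0 at a = 0 and continuous in a:
   imaginary part of the Euler-limit log Gamma, lim (a ln n - sum_{k=0}^n arg(1/2+k+ia)) *)
Definition phGammaHalf (a : R) : R :=
  real (Lim_seq (fun n => a * ln (INR n) - sum_f_R0 (fun k => atan (a / (INR k + /2))) n)).

Definition rhoW (a : R) : R := /2 * phGammaHalf a + PI / 8.

Definition Wc (a : R) (z : C) : C :=
  (RtoC (sqrt (/2 * kW a) * exp (PI * a / 4))
   * (cexp (RtoC (rhoW a) * Ci) * Wj 0 a z + cexp (RtoC (- rhoW a) * Ci) * Wj 3 a z))%C.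

Definition cRInt (g : R -> C) (lo hi : R) : C :=
  (RInt (fun s => Re (g s)) lo hi, RInt (fun s => Im (g s)) lo hi).

Definition seg_int (f : C -> C) (z1 z2 : C) : C :=
  cRInt (fun s => (f (z1 + RtoC s * (z2 - z1)) * (z2 - z1))%C) 0 1.

Definition ray_int (f : C -> C) (z : C) (th : R) : C :=
  let e := cexp (RtoC th * Ci) in
  (real (Lim (fun L => RInt (fun s => Re (f (z + RtoC s * e) * e)%C) 0 L) p_infty),
   real (Lim (fun L => RInt (fun s => Im (f (z + RtoC s * e) * e)%C) 0 L) p_infty)).

Definition NW (a : R) (z : C) : C :=
  (Wc a z * seg_int (fun t => Wc a (- t)%C) (RtoC 0) z
   - Wc a (- z)%C * seg_int (Wc a) (RtoC 0) z)%C.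

(* complementary function hat N_W(a,z); int_{e^{i th} oo}^z = - int_z^{e^{i th} oo} *)
Definition NhatW (a : R) (z : C) : C :=
  (Ci * RtoC (exp (PI * a / 2))
   * (Wj 3 a z * (- ray_int (Wj 0 a) z (PI / 4))
      - Wj 0 a z * (- ray_int (Wj 3 a) z (- (PI / 4)))))%C.

Definition Yfun (a : R) : R :=
  Im (/ (RtoC 1 - RtoC 2 * Ci * RtoC a)
      * hyp2F1 (RtoC (1/2)) (RtoC 1) (RtoC (5/4) - Ci * RtoC a / RtoC 2) (RtoC (1/2)))%C.

Definition c00 (a : R) : C :=
  (RtoC (sqrt PI) * cpow_pos 2 (RtoC (5/4) + Ci * RtoC a / RtoC 2)
     * cexp (RtoC (PI * a / 2) + RtoC (3 * PI / 4) * Ci) * RtoC (Yfun a)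
     * rgamma (RtoC (1/4) - Ci * RtoC a / RtoC 2)
   + cpow_pos 2 (RtoC (- (5/4)) + Ci * RtoC a / RtoC 2)
     * cexp (RtoC (PI * a / 2) + RtoC (PI / 4) * Ci)
     / rgamma (RtoC (1/4) + Ci * RtoC a / RtoC 2))%C.

Definition c03 (a : R) : C := Cconj (c00 a).

(* Main.v *)
(** Write U for the solution recessive along its ray, e(x) and o(x) for the even
    and odd solutions in the rotated variable x = z e^{-i pi/4}, so that
    W_0 = A e + B o and W_3 = A^* e + i B^* o with A = U(ia, 0), B = U'(ia, 0).
    Expanding W(a, z) and W(a, -z) in this basis, N_W becomes a constant multiple
    of W_0 \int_0^z W_3 - W_3 \int_0^z W_0, and the reflection formula together
    with the phase of Gamma(1/2 + ia) shows that the constant is i e^{pi a/2}.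
    Since W_0 and W_3 decay along their rays, the integrals in \hat N_W from
    infinity differ from those from 0 only by the numbers
    J = \int_0^oo U(-ia, s) ds and its conjugate, which yields
    c_0^{(0)} = e^{i pi/4} e^{pi a/2} J.

    Evaluating J: g(t, z) = e^{-bt} (cosh t)^{-1/2} e^{-z^2 tanh(t)/4} satisfies
    g_t = g_zz - (z^2/4 + b) g and g(0, .) = 1, so Green's identity gives
    J = - U'(b, 0) \int_0^oo e^{-bt} (cosh t)^{-1/2} dt. For b = -ia the imaginary
    part of this integral is 2 Y(a) (a first-order recurrence generates the
    hypergeometric series) and its real part is a Beta integral. *)

Require Import Defs.
From Stdlib Require Import Reals Factorial Lra Lia.
From Coquelicot Require Import Coquelicot.
Open Scope R_scope.

(** * Complex limits, curves and integrals *)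

(** Every series, product limit and ray integral in the statement is read off with [real], which
    returns a number even when nothing converges, so convergence has to be proved before any of them
    can be used. Gamma occurs only as the Gauss limit [rgamma]. It is tied to the integrals
    [moment], which also give the decay of U: up to sign and factorials they are the Taylor
    coefficients of int_0^oo t^(2p-1) e^{-t^2/2 - zt} dt, a function bounded for Re z >= 0. The
    Gauss limit, the reflection formula and the Beta integral at exponent 1/2 follow one pattern: a
    recurrence carries the unknown value to a large parameter, where the weight concentrates at a
    point and the complex parameter no longer matters. For the first two the concentration is
    measured by a second moment, through |u| <= d + u^2/d with d = 1/sqrt n. Rays are moved by
    Green's formula on a rectangle, which needs only real differentiation under the integral sign.
    The normalisation of W enters once: 2 rho carries the phase of Gamma(1/2 + ia), and k is the
    reciprocal of sqrt(1 + e^{2 pi a}) + e^{pi a}. *)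

Lemma C_eq (z w : C) : Re z = Re w -> Im z = Im w -> z = w.
Proof. destruct z, w; simpl; congruence. Qed.

Ltac csimp := apply C_eq; unfold cexp, Re, Im; simpl.

Lemma Cmod_le_abs (z : C) : Cmod z <= Rabs (Re z) + Rabs (Im z).
Proof.
  destruct z as [x y]; unfold Re, Im; simpl.
  replace (x, y) with (RtoC x + Ci * RtoC y)%C by (csimp; ring).
  eapply Rle_trans; [apply Cmod_triangle|].
  rewrite Cmod_mult, Cmod_Ci, !Cmod_R; lra.
Qed.

Lemma im_le_Cmod (z : C) : Rabs (Im z) <= Cmod z.
Proof. eapply Rle_trans; [|apply Rmax_Cmod]; apply Rmax_r. Qed.

Lemma Cmod_triangle_inv (z w : C) : Rabs (Cmod z - Cmod w) <= Cmod (z - w).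
Proof.
  apply Rabs_le; split.
  - pose proof (Cmod_triangle (w - z) z) as H.
    replace (w - z + z)%C with w in H by ring.
    replace (z - w)%C with (- (w - z))%C by ring. rewrite Cmod_opp; lra.
  - pose proof (Cmod_triangle (z - w) w) as H.
    replace (z - w + w)%C with z in H by ring. lra.
Qed.

Lemma Cmod_zero_eq (z w : C) : (forall eps, 0 < eps -> Cmod (z - w) < eps) -> z = w.
Proof.
  intros H. assert (Cmod (z - w) = 0) as E.
  { destruct (Rle_lt_or_eq_dec _ _ (Cmod_ge_0 (z - w))) as [h|h]; auto.
    specialize (H _ h); lra. }
  apply Cmod_eq_0 in E. replace z with (z - w + w)%C by ring. rewrite E; ring.
Qed.

Lemma cexp_add (z w : C) : cexp (z + w) = (cexp z * cexp w)%C.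
Proof.
  csimp; rewrite exp_plus, ?cos_plus, ?sin_plus; ring.
Qed.

Lemma cexp_RtoC (x : R) : cexp (RtoC x) = RtoC (exp x).
Proof. csimp; rewrite ?cos_0, ?sin_0; ring. Qed.

Lemma cexp_0 : cexp 0 = 1%C.
Proof. rewrite cexp_RtoC, exp_0; reflexivity. Qed.

Lemma Cmod_cexp (z : C) : Cmod (cexp z) = exp (Re z).
Proof.
  unfold cexp, Cmod; simpl fst; simpl snd.
  replace (_ + _) with (exp (Re z) * exp (Re z)).
  { apply sqrt_square; left; apply exp_pos. }
  pose proof (sin2_cos2 (Im z)) as H; unfold Rsqr in H.
  replace (_ + _) with (exp (Re z) * exp (Re z) * (sin (Im z) * sin (Im z) + cos (Im z) * cos (Im z))) by ring.
  rewrite H; ring.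
Qed.

Lemma cexp_neq_0 (z : C) : cexp z <> 0%C.
Proof. apply Cmod_gt_0; rewrite Cmod_cexp; apply exp_pos. Qed.

Lemma cexp_opp (z : C) : cexp (- z) = (/ cexp z)%C.
Proof.
  assert (cexp (- z) * cexp z = 1)%C as H.
  { rewrite <- cexp_add. replace (- z + z)%C with (RtoC 0) by ring. apply cexp_0. }
  rewrite <- (Cmult_1_l (/ cexp z)), <- H, <- Cmult_assoc, Cinv_r, Cmult_1_r; auto.
  apply cexp_neq_0.
Qed.

Lemma cexp_conj (z : C) : cexp (Cconj z) = Cconj (cexp z).
Proof. csimp; rewrite ?cos_neg, ?sin_neg; ring. Qed.

Lemma RtoC_conj (x : R) : Cconj (RtoC x) = RtoC x.
Proof. csimp; ring. Qed.

Lemma Ci_conj : Cconj Ci = (- Ci)%C.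
Proof. csimp; ring. Qed.

Lemma cexp_Ci (x : R) : cexp (RtoC x * Ci) = (cos x, sin x).
Proof.
  csimp; replace (x * 0 - 0 * 1) with 0 by ring; replace (x * 1 + 0 * 0) with x by ring;
  rewrite exp_0; ring.
Qed.

Lemma cexp_PI2 : cexp (RtoC (PI / 2) * Ci) = Ci.
Proof. rewrite cexp_Ci, cos_PI2, sin_PI2; reflexivity. Qed.

(** Convergence is measured by the modulus along an arbitrary filter, so that one set of rules
    serves sequences ([eventually]), improper integrals ([Rbar_locally p_infty]) and continuity
    ([locally]). *)
Definition climit {T} (F : (T -> Prop) -> Prop) (u : T -> C) (l : C) :=
  forall eps : R, 0 < eps -> F (fun x => Cmod (u x - l) < eps).

Lemma climit_const {T} (F : (T -> Prop) -> Prop) {FF : Filter F} (c : C) :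
  climit F (fun _ => c) c.
Proof.
  intros e He; apply filter_forall; intros _.
  replace (c - c)%C with (RtoC 0) by ring; rewrite Cmod_0; auto.
Qed.

Lemma climit_le {T} (F : (T -> Prop) -> Prop) {FF : Filter F} (u v : T -> C) (l m : C) (K : R) :
  F (fun x => Cmod (u x - l) <= K * Cmod (v x - m)) -> climit F v m -> climit F u l.
Proof.
  intros H Hv e He.
  assert (0 < e / (Rabs K + 1)) as Hd.
  { apply Rdiv_lt_0_compat; auto; pose proof (Rabs_pos K); lra. }
  generalize (filter_and _ _ H (Hv _ Hd)); apply filter_imp; intros x [H1 H2].
  pose proof (Rabs_pos K) as HK. pose proof (Cmod_ge_0 (v x - m)).
  eapply Rle_lt_trans; [apply H1|].
  apply Rle_lt_trans with ((Rabs K + 1) * Cmod (v x - m)).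
  - apply Rmult_le_compat_r; auto; pose proof (Rle_abs K); lra.
  - apply Rlt_le_trans with ((Rabs K + 1) * (e / (Rabs K + 1))).
    + apply Rmult_lt_compat_l; auto; lra.
    + right; field; lra.
Qed.

Lemma climit_ext_loc {T} (F : (T -> Prop) -> Prop) {FF : Filter F} (u v : T -> C) (l : C) :
  F (fun x => u x = v x) -> climit F u l -> climit F v l.
Proof.
  intros H Hu e He; generalize (filter_and _ _ H (Hu e He)); apply filter_imp.
  intros x [-> Hx]; auto.
Qed.

Lemma climit_ext {T} (F : (T -> Prop) -> Prop) {FF : Filter F} (u v : T -> C) (l : C) :
  (forall x, u x = v x) -> climit F u l -> climit F v l.
Proof. intros H; apply climit_ext_loc; auto. apply filter_forall; auto. Qed.

Lemma climit_plus {T} (F : (T -> Prop) -> Prop) {FF : Filter F} (u v : T -> C) (l m : C) :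
  climit F u l -> climit F v m -> climit F (fun x => u x + v x)%C (l + m)%C.
Proof.
  intros Hu Hv e He. assert (0 < e / 2) as H2 by lra.
  generalize (filter_and _ _ (Hu _ H2) (Hv _ H2)); apply filter_imp; intros x [H3 H4].
  replace (u x + v x - (l + m))%C with ((u x - l) + (v x - m))%C by ring.
  eapply Rle_lt_trans; [apply Cmod_triangle|lra].
Qed.

Lemma climit_mult {T} (F : (T -> Prop) -> Prop) {FF : Filter F} (u v : T -> C) (l m : C) :
  climit F u l -> climit F v m -> climit F (fun x => u x * v x)%C (l * m)%C.
Proof.
  intros Hu Hv e He.
  pose proof (Cmod_ge_0 l) as Hl; pose proof (Cmod_ge_0 m) as Hm.
  set (d := Rmin 1 (e / (1 + Cmod l + Cmod m))).
  assert (0 < d) as Hd. { apply Rmin_pos; [lra|apply Rdiv_lt_0_compat; lra]. }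
  generalize (filter_and _ _ (Hu _ Hd) (Hv _ Hd)); apply filter_imp; intros x [H3 H4].
  replace (u x * v x - l * m)%C with ((u x - l) * (v x - m) + ((u x - l) * m + l * (v x - m)))%C by ring.
  assert (d <= 1) as Hd1 by apply Rmin_l.
  assert (d * (1 + Cmod l + Cmod m) <= e) as Hd2.
  { apply Rle_trans with (e / (1 + Cmod l + Cmod m) * (1 + Cmod l + Cmod m)).
    - apply Rmult_le_compat_r; [lra|apply Rmin_r].
    - right; field; lra. }
  eapply Rle_lt_trans; [apply Cmod_triangle|].
  eapply Rle_lt_trans; [apply Rplus_le_compat_l, Cmod_triangle|].
  rewrite !Cmod_mult.
  pose proof (Cmod_ge_0 (u x - l)); pose proof (Cmod_ge_0 (v x - m)).
  assert (Cmod (u x - l) * Cmod (v x - m) <= Cmod (u x - l) * 1) by (apply Rmult_le_compat_l; lra).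
  assert (Cmod (u x - l) * Cmod m <= d * Cmod m) by (apply Rmult_le_compat_r; lra).
  assert (Cmod l * Cmod (v x - m) <= Cmod l * d) by (apply Rmult_le_compat_l; lra).
  nra.
Qed.

Lemma climit_scal {T} (F : (T -> Prop) -> Prop) {FF : Filter F} (c : C) (u : T -> C) (l : C) :
  climit F u l -> climit F (fun x => c * u x)%C (c * l)%C.
Proof. intros; apply climit_mult; auto; apply climit_const; auto. Qed.

Lemma climit_opp {T} (F : (T -> Prop) -> Prop) {FF : Filter F} (u : T -> C) (l : C) :
  climit F u l -> climit F (fun x => - u x)%C (- l)%C.
Proof.
  intros H; apply (climit_le F _ u _ l 1); auto; apply filter_forall; intros x.
  replace (- u x - - l)%C with (- (u x - l))%C by ring. rewrite Cmod_opp; lra.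
Qed.

Lemma climit_minus {T} (F : (T -> Prop) -> Prop) {FF : Filter F} (u v : T -> C) (l m : C) :
  climit F u l -> climit F v m -> climit F (fun x => u x - v x)%C (l - m)%C.
Proof. intros; apply climit_plus; auto; apply climit_opp; auto. Qed.

Lemma climit_conj {T} (F : (T -> Prop) -> Prop) {FF : Filter F} (u : T -> C) (l : C) :
  climit F u l -> climit F (fun x => Cconj (u x)) (Cconj l).
Proof.
  intros H; apply (climit_le F _ u _ l 1); auto; apply filter_forall; intros x.
  rewrite <- Cminus_conj, Cmod_conj; lra.
Qed.

Lemma climit_unique {T} (F : (T -> Prop) -> Prop) {FF : ProperFilter F} (u : T -> C) (l m : C) :
  climit F u l -> climit F u m -> l = m.
Proof.
  intros H1 H2; apply Cmod_zero_eq; intros e He.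
  assert (0 < e / 2) as H by lra.
  destruct (filter_ex _ (filter_and _ _ (H1 _ H) (H2 _ H))) as [x [H3 H4]].
  replace (l - m)%C with (- (u x - l) + (u x - m))%C by ring.
  eapply Rle_lt_trans; [apply Cmod_triangle|]. rewrite Cmod_opp; lra.
Qed.

Lemma climit_Cmod {T} (F : (T -> Prop) -> Prop) {FF : Filter F} (u : T -> C) (l : C) :
  climit F u l -> filterlim (fun x => Cmod (u x)) F (locally (Cmod l)).
Proof.
  intros H. apply filterlim_locally. intros e.
  generalize (H e (cond_pos e)); apply filter_imp; intros x Hx.
  unfold ball; simpl; unfold AbsRing_ball, abs, minus, plus, opp; simpl.
  eapply Rle_lt_trans; [|apply Hx]. apply Cmod_triangle_inv.
Qed.

Lemma climit_bound {T} (F : (T -> Prop) -> Prop) {FF : ProperFilter F} (u : T -> C) (l : C) (B : R) :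
  climit F u l -> F (fun x => Cmod (u x) <= B) -> Cmod l <= B.
Proof.
  intros H HB. apply Rnot_lt_le; intros Hlt.
  assert (0 < Cmod l - B) as Hp by lra.
  destruct (filter_ex _ (filter_and _ _ (H _ Hp) HB)) as [x [H3 H4]].
  pose proof (Cmod_triangle_inv (u x) l) as H5. apply Rabs_le_between in H5. lra.
Qed.

Lemma climit_Re {T} (F : (T -> Prop) -> Prop) {FF : Filter F} (u : T -> C) (l : C) :
  climit F u l -> filterlim (fun x => Re (u x)) F (locally (Re l)).
Proof.
  intros H. apply filterlim_locally. intros e.
  generalize (H e (cond_pos e)); apply filter_imp; intros x Hx.
  unfold ball; simpl; unfold AbsRing_ball, abs, minus, plus, opp; simpl.
  eapply Rle_lt_trans; [|apply Hx]. apply (re_le_Cmod (u x - l)).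
Qed.

Lemma climit_Im {T} (F : (T -> Prop) -> Prop) {FF : Filter F} (u : T -> C) (l : C) :
  climit F u l -> filterlim (fun x => Im (u x)) F (locally (Im l)).
Proof.
  intros H. apply filterlim_locally. intros e.
  generalize (H e (cond_pos e)); apply filter_imp; intros x Hx.
  unfold ball; simpl; unfold AbsRing_ball, abs, minus, plus, opp; simpl.
  eapply Rle_lt_trans; [|apply Hx]. apply (im_le_Cmod (u x - l)).
Qed.

Lemma climit_of_ReIm {T} (F : (T -> Prop) -> Prop) {FF : Filter F} (u : T -> C) (l : C) :
  filterlim (fun x => Re (u x)) F (locally (Re l)) ->
  filterlim (fun x => Im (u x)) F (locally (Im l)) -> climit F u l.
Proof.
  intros H1 H2 e He. assert (0 < e / 2) as He2 by lra.
  pose proof (proj1 (filterlim_locally _ _) H1 (mkposreal _ He2)) as H3.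
  pose proof (proj1 (filterlim_locally _ _) H2 (mkposreal _ He2)) as H4.
  generalize (filter_and _ _ H3 H4); apply filter_imp; intros x [Ha Hb].
  unfold ball in Ha, Hb; simpl in Ha, Hb; unfold AbsRing_ball, abs, minus, plus, opp in Ha, Hb; simpl in Ha, Hb.
  eapply Rle_lt_trans; [apply Cmod_le_abs|].
  unfold Re, Im in *; simpl in *; unfold Rminus in *; lra.
Qed.

Lemma climit_RtoC {T} (F : (T -> Prop) -> Prop) {FF : Filter F} (u : T -> R) (l : R) :
  filterlim u F (locally l) -> climit F (fun x => RtoC (u x)) (RtoC l).
Proof.
  intros H; apply climit_of_ReIm; simpl; auto. apply filterlim_const.
Qed.

Lemma climit_squeeze {T} (F : (T -> Prop) -> Prop) {FF : Filter F} (u : T -> C) (l : C) (e : T -> R) :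
  F (fun x => Cmod (u x - l) <= e x) -> filterlim e F (locally 0) -> climit F u l.
Proof.
  intros H He d Hd.
  pose proof (proj1 (filterlim_locally _ _) He (mkposreal _ Hd)) as H3.
  generalize (filter_and _ _ H H3); apply filter_imp; intros x [Ha Hb].
  unfold ball in Hb; simpl in Hb; unfold AbsRing_ball, abs, minus, plus, opp in Hb; simpl in Hb.
  apply Rabs_lt_between in Hb. lra.
Qed.

Lemma climit_comp {T S} (F : (T -> Prop) -> Prop) (pcf_series : (S -> Prop) -> Prop)
  (f : T -> S) (u : S -> C) (l : C) :
  filterlim f F pcf_series -> climit pcf_series u l -> climit F (fun x => u (f x)) l.
Proof. intros Hf Hu e He. apply (Hf _ (Hu e He)). Qed.

(** The only way a value is assigned to [climseq]: through a proof of convergence. *)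
Lemma climseq_eq (u : nat -> C) (l : C) : climit eventually u l -> climseq u = l.
Proof.
  intros H; unfold climseq.
  rewrite (is_lim_seq_unique _ (Re l)), (is_lim_seq_unique _ (Im l)).
  - destruct l; reflexivity.
  - apply (climit_Im _ _ _ H).
  - apply (climit_Re _ _ _ H).
Qed.

(** No convergence is assumed: [Lim_seq] commutes with negation, and [real] sends both infinities to
    0. *)
Lemma climseq_conj (u : nat -> C) : climseq (fun n => Cconj (u n)) = Cconj (climseq u).
Proof.
  unfold climseq, Cconj; simpl. f_equal.
  rewrite (Lim_seq_ext _ (fun n => - Im (u n))); [|reflexivity].
  rewrite Lim_seq_opp. destruct (Lim_seq _); simpl; ring.
Qed.

Lemma climseq_ext (u v : nat -> C) : (forall n, u n = v n) -> climseq u = climseq v.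
Proof.
  intros H; unfold climseq; f_equal; f_equal; apply Lim_seq_ext; intros n; rewrite H; auto.
Qed.

(** Lets limits of real quantities be computed with the complex algebra of [climit]. *)
Lemma filterlim_RtoC_inv {T} (F : (T -> Prop) -> Prop) {FF : Filter F} (u : T -> R) (l : R) :
  climit F (fun x => RtoC (u x)) (RtoC l) -> filterlim u F (locally l).
Proof. intros H. apply climit_Re in H; auto. Qed.

(** * Derivatives, continuity and integrals of complex-valued functions of a real variable *)

Definition cder (f : R -> C) (t : R) (l : C) :=
  is_derive (fun s => Re (f s)) t (Re l) /\ is_derive (fun s => Im (f s)) t (Im l).

Lemma cder_ext (f g : R -> C) (t : R) (l : C) :
  (forall s, f s = g s) -> cder f t l -> cder g t l.
Proof.
  intros H [H1 H2]; split; eapply is_derive_ext; eauto; intros s; simpl; rewrite H; auto.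
Qed.

Lemma cder_eq (f : R -> C) (t : R) (l m : C) : cder f t l -> l = m -> cder f t m.
Proof. intros H <-; auto. Qed.

Lemma cder_const (c : C) (t : R) : cder (fun _ => c) t 0.
Proof. split; apply (is_derive_const (V := R_NormedModule)). Qed.

Lemma cder_plus (f g : R -> C) (t : R) (l m : C) :
  cder f t l -> cder g t m -> cder (fun s => f s + g s)%C t (l + m)%C.
Proof. intros [H1 H2] [H3 H4]; split; apply (is_derive_plus (V := R_NormedModule)); auto. Qed.

Lemma cder_opp (f : R -> C) (t : R) (l : C) :
  cder f t l -> cder (fun s => - f s)%C t (- l)%C.
Proof. intros [H1 H2]; split; apply (is_derive_opp (V := R_NormedModule)); auto. Qed.

Lemma cder_minus (f g : R -> C) (t : R) (l m : C) :
  cder f t l -> cder g t m -> cder (fun s => f s - g s)%C t (l - m)%C.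
Proof. intros; apply cder_plus; auto; apply cder_opp; auto. Qed.

Lemma is_derive_Rmult (f g : R -> R) (t l m : R) :
  is_derive f t l -> is_derive g t m -> is_derive (fun s => f s * g s) t (l * g t + f t * m).
Proof. intros; apply (is_derive_mult (K := R_AbsRing) f g t l m); auto; intros; apply Rmult_comm. Qed.

Lemma is_derive_Rcomp (f g : R -> R) (t l m : R) :
  is_derive f (g t) l -> is_derive g t m -> is_derive (fun s => f (g s)) t (m * l).
Proof. intros; apply (is_derive_comp (V := R_NormedModule) f g t l m); auto. Qed.

Lemma is_derive_eq (f : R -> R) (t l m : R) : is_derive f t l -> l = m -> is_derive f t m.
Proof. intros H <-; auto. Qed.

Lemma cder_mult (f g : R -> C) (t : R) (l m : C) :
  cder f t l -> cder g t m -> cder (fun s => f s * g s)%C t (l * g t + f t * m)%C.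
Proof.
  intros [H1 H2] [H3 H4]; split.
  - eapply is_derive_eq; [apply (is_derive_minus (V := R_NormedModule) (fun s => Re (f s) * Re (g s)) (fun s => Im (f s) * Im (g s)));
      apply is_derive_Rmult; eauto|].
    unfold minus, plus, opp, Re, Im; simpl; ring.
  - eapply is_derive_eq; [apply (is_derive_plus (V := R_NormedModule) (fun s => Re (f s) * Im (g s)) (fun s => Im (f s) * Re (g s)));
      apply is_derive_Rmult; eauto|].
    unfold minus, plus, opp, Re, Im; simpl; ring.
Qed.

Lemma cder_scal (c : C) (f : R -> C) (t : R) (l : C) :
  cder f t l -> cder (fun s => c * f s)%C t (c * l)%C.
Proof.
  intros H; eapply cder_eq; [apply cder_mult; [apply cder_const|apply H]|]. cbv beta; ring.
Qed.

Lemma cder_RtoC (f : R -> R) (t l : R) : is_derive f t l -> cder (fun s => RtoC (f s)) t (RtoC l).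
Proof. intros H; split; simpl; auto. apply (is_derive_const (V := R_NormedModule)). Qed.

Lemma cder_id (t : R) : cder RtoC t 1.
Proof. apply (cder_RtoC (fun s => s)). apply (is_derive_id t). Qed.

Lemma cder_cexp (f : R -> C) (t : R) (l : C) :
  cder f t l -> cder (fun s => cexp (f s)) t (cexp (f t) * l)%C.
Proof.
  intros [H1 H2]; split; unfold cexp.
  - eapply is_derive_eq; [apply (is_derive_Rmult (fun s => exp (Re (f s))) (fun s => cos (Im (f s))));
      (eapply is_derive_Rcomp; [|eauto])|].
    + apply is_derive_exp.
    + apply is_derive_cos.
    + unfold Re, Im; simpl; ring.
  - eapply is_derive_eq; [apply (is_derive_Rmult (fun s => exp (Re (f s))) (fun s => sin (Im (f s))));
      (eapply is_derive_Rcomp; [|eauto])|].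
    + apply is_derive_exp.
    + apply is_derive_sin.
    + unfold Re, Im; simpl; ring.
Qed.

Definition ccont (f : R -> C) :=
  forall t, continuous (fun s => Re (f s)) t /\ continuous (fun s => Im (f s)) t.

Lemma cder_ccont (f g : R -> C) : (forall t, cder f t (g t)) -> ccont f.
Proof.
  intros H t; destruct (H t); split; apply (ex_derive_continuous (V := R_NormedModule)); eexists; eauto.
Qed.

Lemma ccont_ext (f g : R -> C) : (forall t, f t = g t) -> ccont f -> ccont g.
Proof.
  intros H Hf t; destruct (Hf t) as [H1 H2]; split.
  - eapply continuous_ext; [|apply H1]; intros s; simpl; rewrite H; auto.
  - eapply continuous_ext; [|apply H2]; intros s; simpl; rewrite H; auto.
Qed.

Lemma ccont_const (c : C) : ccont (fun _ => c).
Proof. intros t; split; apply continuous_const. Qed.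

Lemma ccont_RtoC (f : R -> R) : (forall t, continuous f t) -> ccont (fun s => RtoC (f s)).
Proof. intros H t; split; simpl; auto. apply continuous_const. Qed.

Lemma ccont_plus (f g : R -> C) : ccont f -> ccont g -> ccont (fun s => f s + g s)%C.
Proof.
  intros Hf Hg t; destruct (Hf t), (Hg t); split; apply (continuous_plus (V := R_NormedModule)); auto.
Qed.

Lemma ccont_opp (f : R -> C) : ccont f -> ccont (fun s => - f s)%C.
Proof. intros Hf t; destruct (Hf t); split; apply (continuous_opp (V := R_NormedModule)); auto. Qed.

Lemma ccont_minus (f g : R -> C) : ccont f -> ccont g -> ccont (fun s => f s - g s)%C.
Proof. intros; apply ccont_plus; auto; apply ccont_opp; auto. Qed.

Lemma ccont_mult (f g : R -> C) : ccont f -> ccont g -> ccont (fun s => f s * g s)%C.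
Proof.
  intros Hf Hg t; destruct (Hf t), (Hg t); split.
  - apply (continuous_minus (V := R_NormedModule) (fun s => Re (f s) * Re (g s)) (fun s => Im (f s) * Im (g s)));
    apply (continuous_mult (K := R_AbsRing)); auto.
  - apply (continuous_plus (V := R_NormedModule) (fun s => Re (f s) * Im (g s)) (fun s => Im (f s) * Re (g s)));
    apply (continuous_mult (K := R_AbsRing)); auto.
Qed.

Lemma ccont_cexp (f : R -> C) : ccont f -> ccont (fun s => cexp (f s)).
Proof.
  intros Hf t; destruct (Hf t); split.
  - apply (continuous_mult (K := R_AbsRing) (fun s => exp (Re (f s))) (fun s => cos (Im (f s)))).
    + apply (continuous_comp (fun s => Re (f s)) exp); auto.
      apply (ex_derive_continuous (V := R_NormedModule)); auto_derive; auto.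
    + apply (continuous_comp (fun s => Im (f s)) cos); auto.
      apply (ex_derive_continuous (V := R_NormedModule)); auto_derive; auto.
  - apply (continuous_mult (K := R_AbsRing) (fun s => exp (Re (f s))) (fun s => sin (Im (f s)))).
    + apply (continuous_comp (fun s => Re (f s)) exp); auto.
      apply (ex_derive_continuous (V := R_NormedModule)); auto_derive; auto.
    + apply (continuous_comp (fun s => Im (f s)) sin); auto.
      apply (ex_derive_continuous (V := R_NormedModule)); auto_derive; auto.
Qed.

Lemma ccont_ex_RInt (f : R -> C) (a b : R) : ccont f ->
  ex_RInt (fun s => Re (f s)) a b /\ ex_RInt (fun s => Im (f s)) a b.
Proof.
  intros H; split; apply (ex_RInt_continuous (V := R_CompleteNormedModule)); intros t _; apply (H t).
Qed.

Lemma cRInt_ext (f g : R -> C) (a b : R) : (forall t, f t = g t) -> cRInt f a b = cRInt g a b.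
Proof. intros H; unfold cRInt; f_equal; apply RInt_ext; intros; rewrite H; auto. Qed.

Lemma cRInt_FTC (F f : R -> C) (a b : R) : (forall t, cder F t (f t)) -> ccont f ->
  cRInt f a b = (F b - F a)%C.
Proof.
  intros HF Hf; unfold cRInt.
  apply C_eq; unfold Re at 1, Im at 1; simpl; apply is_RInt_unique.
  - apply (is_RInt_derive (V := R_CompleteNormedModule) (fun s => Re (F s))); intros t _; destruct (HF t), (Hf t); auto.
  - apply (is_RInt_derive (V := R_CompleteNormedModule) (fun s => Im (F s))); intros t _; destruct (HF t), (Hf t); auto.
Qed.

Lemma cRInt_plus (f g : R -> C) (a b : R) : ccont f -> ccont g ->
  cRInt (fun s => f s + g s)%C a b = (cRInt f a b + cRInt g a b)%C.
Proof.
  intros Hf Hg; destruct (ccont_ex_RInt f a b Hf), (ccont_ex_RInt g a b Hg).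
  unfold cRInt; csimp; apply (RInt_plus (V := R_CompleteNormedModule)); auto.
Qed.

Lemma cRInt_scal (c : C) (f : R -> C) (a b : R) : ccont f ->
  cRInt (fun s => c * f s)%C a b = (c * cRInt f a b)%C.
Proof.
  intros Hf; destruct (ccont_ex_RInt f a b Hf) as [H1 H2].
  unfold cRInt; csimp; apply is_RInt_unique.
  - apply (is_RInt_minus (V := R_NormedModule) (fun s => Re c * Re (f s)) (fun s => Im c * Im (f s)));
    apply (is_RInt_scal (V := R_NormedModule)); apply (RInt_correct (V := R_CompleteNormedModule)); auto.
  - apply (is_RInt_plus (V := R_NormedModule) (fun s => Re c * Im (f s)) (fun s => Im c * Re (f s)));
    apply (is_RInt_scal (V := R_NormedModule)); apply (RInt_correct (V := R_CompleteNormedModule)); auto.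
Qed.

Lemma cRInt_opp (f : R -> C) (a b : R) : ccont f ->
  cRInt (fun s => - f s)%C a b = (- cRInt f a b)%C.
Proof.
  intros Hf. rewrite (cRInt_ext _ (fun s => (- (1)) * f s)%C) by (intros; ring).
  rewrite cRInt_scal; auto; ring.
Qed.

Lemma cRInt_minus (f g : R -> C) (a b : R) : ccont f -> ccont g ->
  cRInt (fun s => f s - g s)%C a b = (cRInt f a b - cRInt g a b)%C.
Proof.
  intros; rewrite (cRInt_plus f (fun s => - g s)%C), cRInt_opp; auto. apply ccont_opp; auto.
Qed.

Lemma cRInt_Chasles (f : R -> C) (a b c : R) : ccont f ->
  cRInt f a c = (cRInt f a b + cRInt f b c)%C.
Proof.
  intros Hf; destruct (ccont_ex_RInt f a b Hf), (ccont_ex_RInt f b c Hf).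
  unfold cRInt; csimp; symmetry; apply (RInt_Chasles (V := R_CompleteNormedModule)); auto.
Qed.

Lemma cRInt_conj (f : R -> C) (a b : R) : ccont f ->
  cRInt (fun s => Cconj (f s)) a b = Cconj (cRInt f a b).
Proof.
  intros Hf; destruct (ccont_ex_RInt f a b Hf).
  unfold cRInt; csimp; auto. apply (RInt_opp (V := R_CompleteNormedModule)); auto.
Qed.

Lemma cRInt_RtoC (f : R -> R) (a b : R) : cRInt (fun s => RtoC (f s)) a b = RtoC (RInt f a b).
Proof.
  unfold cRInt; csimp; auto.
  rewrite (RInt_const (V := R_CompleteNormedModule)). unfold scal; simpl; unfold mult; simpl; ring.
Qed.

Lemma RInt_pos (g : R -> R) (a b : R) : a <= b -> ex_RInt g a b ->
  (forall x, a <= x <= b -> 0 <= g x) -> 0 <= RInt g a b.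
Proof.
  intros Hab Eg Hg. apply RInt_ge_0; auto. intros; apply Hg; lra.
Qed.

(** Bounding the two components separately would lose a constant. Multiplying by the conjugate of
    the integral I turns |I|^2 into the real integral of Re (conj I * f), which is at most |I| times
    the integral of [g]. *)
Lemma cRInt_bound (f : R -> C) (g : R -> R) (a b : R) : a <= b -> ccont f ->
  (forall x, a <= x <= b -> Cmod (f x) <= g x) -> ex_RInt g a b ->
  Cmod (cRInt f a b) <= RInt g a b.
Proof.
  intros Hab Hf Hg Eg.
  assert (0 <= RInt g a b) as Hpos.
  { apply RInt_pos; auto. intros x Hx; eapply Rle_trans; [apply Cmod_ge_0|apply Hg; auto]. }
  set (I := cRInt f a b).
  destruct (Rle_lt_or_eq_dec _ _ (Cmod_ge_0 I)) as [h|h]; [|rewrite <- h; auto].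
  apply Rmult_le_reg_l with (Cmod I); auto.
  replace (Cmod I * Cmod I) with (Re (Cconj I * I)).
  2:{ pose proof (Cmod2_conj I) as E. rewrite Cmult_comm, <- E, re_RtoC. ring. }
  unfold I at 2. rewrite <- cRInt_scal; auto.
  unfold cRInt at 1; unfold Re at 1; simpl fst.
  rewrite <- (RInt_scal (V := R_CompleteNormedModule)); auto.
  apply RInt_le; auto.
  - apply (ccont_ex_RInt (fun s => Cconj I * f s)%C); apply ccont_mult; auto; apply ccont_const.
  - apply (ex_RInt_scal (V := R_NormedModule)); auto.
  - intros x Hx. change (Re (Cconj I * f x)%C <= Cmod I * g x). eapply Rle_trans; [apply Rle_abs|].
    eapply Rle_trans; [apply re_le_Cmod|].
    rewrite Cmod_mult, Cmod_conj.
    apply Rmult_le_compat_l; [apply Cmod_ge_0|apply Hg; lra].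
Qed.

Lemma cRInt_bound_const (f : R -> C) (M : R) (a b : R) : a <= b -> ccont f ->
  (forall x, a <= x <= b -> Cmod (f x) <= M) -> Cmod (cRInt f a b) <= (b - a) * M.
Proof.
  intros. replace ((b - a) * M) with (RInt (fun _ => M) a b).
  - apply cRInt_bound; auto. apply ex_RInt_const.
  - rewrite (RInt_const (V := R_CompleteNormedModule)). reflexivity.
Qed.

(** * Existence of improper integrals *)

Lemma mono_limit (F : R -> R) (B : R) : (forall x y, 0 <= x <= y -> F x <= F y) ->
  (forall x, 0 <= x -> F x <= B) ->
  exists l, filterlim F (Rbar_locally p_infty) (locally l).
Proof.
  intros Hm HB.
  destruct (completeness (fun y => exists x, 0 <= x /\ y = F x)) as [l [Hl1 Hl2]].
  - exists B; intros y [x [Hx ->]]; auto.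
  - exists (F 0), 0; split; auto; lra.
  - exists l. apply filterlim_locally; intros e.
    assert (exists x, 0 <= x /\ l - e < F x) as [x [Hx Hlx]].
    { apply Classical_Prop.NNPP; intros Hn.
      assert (l <= l - e); [|pose proof (cond_pos e); lra].
      apply Hl2; intros y [x [Hx ->]]. apply Rnot_lt_le; intros H; apply Hn; eauto. }
    exists x; intros y Hy.
    unfold ball; simpl; unfold AbsRing_ball, abs, minus, plus, opp; simpl.
    apply Rabs_lt_between. pose proof (Hm x y ltac:(lra)).
    assert (F y <= l) by (apply Hl1; exists y; split; auto; lra). pose proof (cond_pos e); lra.
Qed.

Lemma RInt_exp_decay (K c T : R) : c <> 0 ->
  RInt (fun t => K * exp (- (c * t))) 0 T = K / c * (1 - exp (- (c * T))).
Proof.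
  intros Hc. apply is_RInt_unique.
  evar_last; [apply (is_RInt_derive (V := R_CompleteNormedModule) (fun t => - (K / c) * exp (- (c * t))))|].
  - intros x _. auto_derive; auto. field; auto.
  - intros x _. apply (ex_derive_continuous (V := R_NormedModule)). auto_derive; auto.
  - unfold minus, plus, opp; simpl. rewrite Rmult_0_r, Ropp_0, exp_0. ring.
Qed.

(** With [k] the exponential majorant, both [k] and [g + k] are nonnegative, so their integrals
    increase and stay bounded; the integral of [g] is the difference of two convergent ones. *)
Lemma ex_improper_real (g : R -> R) (K c : R) : 0 < c -> (forall t, continuous g t) ->
  (forall t, 0 <= t -> Rabs (g t) <= K * exp (- (c * t))) ->
  exists l, filterlim (fun T => RInt g 0 T) (Rbar_locally p_infty) (locally l).
Proof.
  intros Hc Hg Hb.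
  set (k := fun t => K * exp (- (c * t))).
  assert (forall t, continuous k t) as Hk.
  { intros t; apply (ex_derive_continuous (V := R_NormedModule)). unfold k; auto_derive; auto. }
  assert (forall h : R -> R, (forall t, continuous h t) -> forall a b, ex_RInt h a b) as Ex.
  { intros h Hh a b; apply (ex_RInt_continuous (V := R_CompleteNormedModule)); auto. }
  assert (0 <= K) as HK.
  { pose proof (Hb 0 ltac:(lra)) as H; rewrite Rmult_0_r, Ropp_0, exp_0 in H.
    pose proof (Rabs_pos (g 0)); lra. }
  assert (forall T, 0 <= T -> RInt k 0 T <= K / c) as Bk.
  { intros T _; unfold k; rewrite RInt_exp_decay by lra.
    pose proof (exp_pos (- (c * T))). assert (0 <= K / c) by (apply Rdiv_le_0_compat; auto).
    nra. }
  assert (forall h : R -> R, (forall t, continuous h t) -> (forall t, 0 <= t -> 0 <= h t) ->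
    forall x y, 0 <= x <= y -> RInt h 0 x <= RInt h 0 y) as Mono.
  { intros h Hh Hp x y Hxy.
    rewrite <- (RInt_Chasles (V := R_CompleteNormedModule) h 0 x y) by auto.
    unfold plus; simpl. assert (0 <= RInt h x y); [|lra].
    apply RInt_pos; auto; try lra. intros; apply Hp; lra. }
  destruct (mono_limit (fun T => RInt k 0 T) (K / c)) as [l1 Hl1]; auto.
  { apply Mono; auto. intros t Ht; unfold k; pose proof (exp_pos (- (c * t))); nra. }
  assert (forall T, RInt (fun t => g t + k t) 0 T = RInt g 0 T + RInt k 0 T) as Pl.
  { intros T; apply (RInt_plus (V := R_CompleteNormedModule)); auto. }
  destruct (mono_limit (fun T => RInt (fun t => g t + k t) 0 T) (2 * (K / c))) as [l2 Hl2]; auto.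
  { apply Mono.
    - intros t; apply (continuous_plus (V := R_NormedModule)); auto.
    - intros t Ht; pose proof (Hb t Ht) as H; apply Rabs_le_between in H; unfold k; lra. }
  { intros T HT; rewrite Pl. assert (RInt g 0 T <= RInt k 0 T).
    { apply RInt_le; auto. intros t Ht; pose proof (Hb t ltac:(lra)) as H; apply Rabs_le_between in H; unfold k; lra. }
    pose proof (Bk T HT); lra. }
  exists (l2 - l1). apply filterlim_RtoC_inv; [apply Rbar_locally_filter|].
  replace (RtoC (l2 - l1)) with (RtoC l2 - RtoC l1)%C by (csimp; ring).
  pose proof (Rbar_locally_filter p_infty) as FF.
  eapply (climit_ext _ (fun T => Cminus (RtoC (RInt (fun t => g t + k t) 0 T)) (RtoC (RInt k 0 T)))%R).
  { intros T; rewrite Pl; csimp; ring. }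
  apply climit_minus; try apply FF; apply climit_RtoC; try apply FF; auto.
Qed.

Definition is_improper (f : R -> C) (l : C) := climit (Rbar_locally p_infty) (fun T => cRInt f 0 T) l.

Lemma ex_improper (f : R -> C) (K c : R) : 0 < c -> ccont f ->
  (forall t, 0 <= t -> Cmod (f t) <= K * exp (- (c * t))) -> exists l, is_improper f l.
Proof.
  intros Hc Hf Hb.
  destruct (ex_improper_real (fun t => Re (f t)) K c) as [l1 H1]; auto.
  { intros t; destruct (Hf t); auto. }
  { intros t Ht; eapply Rle_trans; [apply re_le_Cmod|auto]. }
  destruct (ex_improper_real (fun t => Im (f t)) K c) as [l2 H2]; auto.
  { intros t; destruct (Hf t); auto. }
  { intros t Ht; eapply Rle_trans; [apply im_le_Cmod|auto]. }
  exists (l1, l2); apply climit_of_ReIm; auto; apply Rbar_locally_filter.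
Qed.

(** * Entire power series *)

Lemma Re_cpsum (u : nat -> C) (n : nat) : Re (cpsum u (S n)) = sum_n (fun k => Re (u k)) n.
Proof.
  induction n.
  - rewrite sum_O. simpl; unfold Re; simpl; ring.
  - rewrite sum_Sn, <- IHn. unfold plus; simpl; unfold Re; simpl; ring.
Qed.

Lemma Im_cpsum (u : nat -> C) (n : nat) : Im (cpsum u (S n)) = sum_n (fun k => Im (u k)) n.
Proof.
  induction n.
  - rewrite sum_O. simpl; unfold Im; simpl; ring.
  - rewrite sum_Sn, <- IHn. unfold plus; simpl; unfold Im; simpl; ring.
Qed.

Lemma climit_incr (u : nat -> C) (l : C) :
  climit eventually (fun n => u (S n)) l -> climit eventually u l.
Proof.
  intros H e He; destruct (H e He) as [N HN]; exists (S N); intros n Hn.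
  destruct n; [lia|]. apply HN; lia.
Qed.

Lemma cpsum_cv (u : nat -> C) (b : nat -> R) : (forall n, Cmod (u n) <= b n) -> ex_series b ->
  climit eventually (cpsum u) (cseries u).
Proof.
  intros Hb Hs.
  assert (exists l, climit eventually (cpsum u) l) as [l Hl].
  { destruct (ex_series_le (V := R_CompleteNormedModule) (fun n => Re (u n)) b) as [l1 H1]; auto.
    { intros n; eapply Rle_trans; [apply re_le_Cmod|auto]. }
    destruct (ex_series_le (V := R_CompleteNormedModule) (fun n => Im (u n)) b) as [l2 H2]; auto.
    { intros n; eapply Rle_trans; [apply im_le_Cmod|auto]. }
    exists (l1, l2). apply climit_incr. apply climit_of_ReIm.
    - apply eventually_filter.
    - eapply filterlim_ext; [intros n; symmetry; apply Re_cpsum|apply H1].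
    - eapply filterlim_ext; [intros n; symmetry; apply Im_cpsum|apply H2]. }
  unfold cseries. rewrite (climseq_eq _ _ Hl); auto.
Qed.

Lemma cseries_eq (u : nat -> C) (l : C) : climit eventually (cpsum u) l -> cseries u = l.
Proof. apply climseq_eq. Qed.

Lemma Series_nonneg (b : nat -> R) : (forall n, 0 <= b n) -> ex_series b -> 0 <= Series b.
Proof.
  intros Hb Hs. rewrite <- (Rmult_0_l (Series (fun _ => 1))), <- Series_scal_l.
  apply Series_le; auto. intros n; rewrite Rmult_0_l; auto; split; auto; lra.
Qed.

Lemma cpsum_bound (u : nat -> C) (b : nat -> R) (n : nat) : (forall n, Cmod (u n) <= b n) ->
  ex_series b -> Cmod (cpsum u n) <= Series b.
Proof.
  intros Hb Hs.
  assert (forall k, 0 <= b k) as Hp by (intros k; eapply Rle_trans; [apply Cmod_ge_0|auto]).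
  destruct n.
  - simpl. rewrite Cmod_0. apply Series_nonneg; auto.
  - apply Rle_trans with (sum_n b n).
    + induction n.
      * rewrite sum_O. simpl. rewrite Cplus_0_l; auto.
      * rewrite sum_Sn. change (cpsum u (S (S n))) with (cpsum u (S n) + u (S n))%C.
        eapply Rle_trans; [apply Cmod_triangle|]. unfold plus; simpl.
        apply Rplus_le_compat; [apply IHn|apply Hb].
    + rewrite (Series_incr_n b (S n)); auto; [|lia].
      simpl pred. rewrite <- sum_n_Reals.
      assert (0 <= Series (fun k => b (S n + k)%nat)); [|lra].
      apply Series_nonneg; auto. apply (ex_series_incr_n (V := R_NormedModule) b (S n)); auto.
Qed.

Lemma cseries_bound (u : nat -> C) (b : nat -> R) : (forall n, Cmod (u n) <= b n) ->
  ex_series b -> Cmod (cseries u) <= Series b.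
Proof.
  intros Hb Hs. eapply (climit_bound eventually); [apply (cpsum_cv u b); auto|].
  apply filter_forall; intros n; apply cpsum_bound; auto.
Qed.

Lemma cpsum_S (u : nat -> C) (n : nat) : cpsum u (S n) = (cpsum u n + u n)%C.
Proof. reflexivity. Qed.

Lemma cpsum_ext (u v : nat -> C) (n : nat) : (forall k, u k = v k) -> cpsum u n = cpsum v n.
Proof. intros H; induction n; simpl; auto. rewrite IHn, H; auto. Qed.

Lemma cpsum_plus (u v : nat -> C) (n : nat) :
  cpsum (fun k => u k + v k)%C n = (cpsum u n + cpsum v n)%C.
Proof. induction n; simpl; [ring|]. rewrite IHn; ring. Qed.

Lemma cpsum_scal (c : C) (u : nat -> C) (n : nat) :
  cpsum (fun k => c * u k)%C n = (c * cpsum u n)%C.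
Proof. induction n; simpl; [ring|]. rewrite IHn; ring. Qed.

Lemma Cmod_cpown (z : C) (n : nat) : Cmod (cpown z n) = Cmod z ^ n.
Proof. induction n; simpl; [apply Cmod_1|]. rewrite Cmod_mult, IHn; auto. Qed.

(** Infinite radius of convergence, phrased as boundedness of the terms at every radius: this form
    passes easily through recurrences and term-by-term differentiation. *)
Definition entire (c : nat -> C) := forall r, 0 < r -> exists M, forall n, Cmod (c n) * r ^ n <= M.

Definition power_series (c : nat -> C) (z : C) : C := cseries (fun n => c n * cpown z n)%C.

Definition deriv_coeff (c : nat -> C) (n : nat) : C := (RtoC (INR (S n)) * c (S n))%C.

Lemma ex_series_half (M : R) : ex_series (fun n => M * (/ 2) ^ n).
Proof.
  apply (ex_series_scal (V := R_NormedModule) M (fun n => (/ 2) ^ n)).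
  apply ex_series_geom. rewrite Rabs_right; lra.
Qed.

(** Boundedness of the terms at radius 2r becomes a geometric majorant at radius r. *)
Lemma pow_half_split (x r : R) (n : nat) : x * r ^ n = x * (2 * r) ^ n * (/ 2) ^ n.
Proof.
  rewrite Rmult_assoc, <- Rpow_mult_distr. do 2 f_equal. field.
Qed.

Lemma power_series_cv (c : nat -> C) (z : C) : entire c ->
  climit eventually (cpsum (fun n => c n * cpown z n)%C) (power_series c z).
Proof.
  intros Hc. destruct (Hc (2 * (Cmod z + 1))) as [M HM].
  { pose proof (Cmod_ge_0 z); lra. }
  apply (cpsum_cv _ (fun n => M * (/ 2) ^ n)); [|apply ex_series_half].
  intros n. rewrite Cmod_mult, Cmod_cpown.
  apply Rle_trans with (Cmod (c n) * (Cmod z + 1) ^ n).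
  - apply Rmult_le_compat_l; [apply Cmod_ge_0|]. apply pow_incr; pose proof (Cmod_ge_0 z); lra.
  - rewrite pow_half_split. apply Rmult_le_compat_r; auto. apply pow_le; lra.
Qed.

Lemma power_series_plus (c d : nat -> C) (z : C) : entire c -> entire d ->
  power_series (fun n => c n + d n)%C z = (power_series c z + power_series d z)%C.
Proof.
  intros Hc Hd. apply cseries_eq.
  apply (climit_ext _ (fun n => cpsum (fun n => c n * cpown z n) n + cpsum (fun n => d n * cpown z n) n)%C).
  { intros n; rewrite <- cpsum_plus; apply cpsum_ext; intros; ring. }
  apply climit_plus; try apply eventually_filter; apply power_series_cv; auto.
Qed.

Lemma power_series_scal (a : C) (c : nat -> C) (z : C) : entire c ->
  power_series (fun n => a * c n)%C z = (a * power_series c z)%C.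
Proof.
  intros Hc. apply cseries_eq.
  apply (climit_ext _ (fun n => a * cpsum (fun n => c n * cpown z n) n)%C).
  { intros n; rewrite <- cpsum_scal; apply cpsum_ext; intros; ring. }
  apply climit_scal; try apply eventually_filter; apply power_series_cv; auto.
Qed.

Lemma power_series_ext (c d : nat -> C) (z : C) : (forall n, c n = d n) -> power_series c z = power_series d z.
Proof.
  intros H; apply climseq_ext; intros n; apply cpsum_ext; intros k; rewrite H; auto.
Qed.

Definition shift_coeff (c : nat -> C) (n : nat) : C := match n with O => RtoC 0 | S m => c m end.

Lemma power_series_shift_coeff (c : nat -> C) (z : C) : entire c -> power_series (shift_coeff c) z = (z * power_series c z)%C.
Proof.
  intros Hc. apply cseries_eq, climit_incr.
  apply (climit_ext _ (fun n => z * cpsum (fun n => c n * cpown z n) n)%C).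
  { intros n; induction n; [simpl; ring|].
    change (cpsum (fun k => shift_coeff c k * cpown z k)%C (S (S n))) with
      (cpsum (fun k => shift_coeff c k * cpown z k) (S n) + c n * (z * cpown z n))%C.
    rewrite <- IHn. simpl. ring. }
  apply climit_scal; try apply eventually_filter; apply power_series_cv; auto.
Qed.

Lemma power_series_0 (c : nat -> C) : power_series c 0 = c O.
Proof.
  apply cseries_eq, climit_incr.
  apply (climit_ext _ (fun _ => c O)).
  { intros n; induction n; [simpl; ring|].
    change (cpsum (fun k => c k * cpown 0 k)%C (S (S n))) with
      (cpsum (fun k => c k * cpown 0 k) (S n) + c (S n) * (0 * cpown 0 n))%C.
    rewrite <- IHn. ring. }
  apply climit_const, eventually_filter.
Qed.

Lemma INR_le_pow2 (n : nat) : INR n <= 2 ^ n.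
Proof.
  induction n; [simpl; lra|]. rewrite S_INR. simpl.
  assert (1 <= 2 ^ n) by (apply pow_R1_Rle; lra). lra.
Qed.

Lemma entire_deriv_coeff (c : nat -> C) : entire c -> entire (deriv_coeff c).
Proof.
  intros Hc r Hr. destruct (Hc (2 * r)) as [M HM]; [lra|].
  exists (M / r). intros n. unfold deriv_coeff. rewrite Cmod_mult, Cmod_R, Rabs_right by (apply Rle_ge, pos_INR).
  apply Rmult_le_reg_r with r; auto. replace (M / r * r) with M by (field; lra).
  eapply Rle_trans; [|apply (HM (S n))].
  replace (INR (S n) * Cmod (c (S n)) * r ^ n * r) with (INR (S n) * (Cmod (c (S n)) * r ^ S n)) by (simpl; ring).
  rewrite Rpow_mult_distr.
  replace (Cmod (c (S n)) * (2 ^ S n * r ^ S n)) with (2 ^ S n * (Cmod (c (S n)) * r ^ S n)) by ring.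
  apply Rmult_le_compat_r; [|apply INR_le_pow2].
  apply Rmult_le_pos; [apply Cmod_ge_0|apply pow_le; lra].
Qed.

(** Induction on n: if e_n is the remainder, then e_(n+1) = (z + h) e_n + n z^(n-1) h^2. *)
Lemma pow_taylor2 (z h : C) (r : R) (n : nat) : 1 <= r -> Cmod z <= r -> Cmod (z + h) <= r ->
  Cmod (cpown (z + h) n - cpown z n - RtoC (INR n) * cpown z (pred n) * h)
  <= INR n ^ 2 * r ^ n * Cmod h ^ 2.
Proof.
  intros Hr Hz Hzh. induction n.
  - simpl. replace (1 - 1 - 0 * 1 * h)%C with (RtoC 0) by ring. rewrite Cmod_0; lra.
  - set (e := (cpown (z + h) n - cpown z n - RtoC (INR n) * cpown z (pred n) * h)%C) in *.
    replace (cpown (z + h) (S n) - cpown z (S n) - RtoC (INR (S n)) * cpown z (pred (S n)) * h)%C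
      with ((z + h) * e + RtoC (INR n) * (cpown z (pred n) * (h * h)))%C.
    2:{ rewrite S_INR, RtoC_plus. unfold e. destruct n; [simpl; ring|]. cbn [pred cpown]; ring. }
    eapply Rle_trans; [apply Cmod_triangle|].
    rewrite !Cmod_mult, Cmod_cpown, Cmod_R, (Rabs_right (INR n)) by (apply Rle_ge, pos_INR).
    assert (Cmod (z + h) * Cmod e <= r * (INR n ^ 2 * r ^ n * Cmod h ^ 2)) as H1.
    { apply Rmult_le_compat; auto; apply Cmod_ge_0. }
    assert (INR n * (Cmod z ^ pred n * (Cmod h * Cmod h)) <= INR n * (r ^ S n * (Cmod h * Cmod h))) as H2.
    { apply Rmult_le_compat_l; [apply pos_INR|]. apply Rmult_le_compat_r.
      - apply Rmult_le_pos; apply Cmod_ge_0.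
      - apply Rle_trans with (r ^ pred n); [apply pow_incr; split; auto; apply Cmod_ge_0|].
        apply Rle_pow; auto; lia. }
    eapply Rle_trans; [apply Rplus_le_compat; [apply H1|apply H2]|].
    rewrite S_INR.
    replace (r * (INR n ^ 2 * r ^ n * Cmod h ^ 2) + INR n * (r ^ S n * (Cmod h * Cmod h)))
      with ((INR n ^ 2 + INR n) * (r ^ S n * Cmod h ^ 2)) by (simpl; ring).
    rewrite Rmult_assoc. apply Rmult_le_compat_r.
    + apply Rmult_le_pos; apply pow_le; [lra|apply Cmod_ge_0].
    + pose proof (pos_INR n); nra.
Qed.

(** A quadratic remainder, uniform for |h| <= 1, gives both differentiability and continuity of the
    sum without any appeal to uniform convergence. *)
Lemma power_series_quad (c : nat -> C) (z : C) : entire c -> exists K, forall h, Cmod h <= 1 ->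
  Cmod (power_series c (z + h) - power_series c z - power_series (deriv_coeff c) z * h) <= K * Cmod h ^ 2.
Proof.
  intros Hc. set (r := Cmod z + 1). assert (1 <= r) as Hr by (unfold r; pose proof (Cmod_ge_0 z); lra).
  (* n^2 <= 4^n absorbs the factor of [pow_taylor2], and a further factor 2 pays for the geometric
     majorant, hence 8 = 2 * 4. *)
  destruct (Hc (8 * r)) as [M HM]; [lra|].
  exists (Series (fun n => M * (/ 2) ^ n)). intros h Hh.
  set (u := fun n => (c n * (cpown (z + h) n - cpown z n - RtoC (INR n) * cpown z (pred n) * h))%C).
  set (b := fun n => (M * (/ 2) ^ n) * Cmod h ^ 2).
  assert (ex_series b) as mehler_time.
  { unfold b. apply (ex_series_ext (fun n => Cmod h ^ 2 * (M * (/ 2) ^ n))); [intros n; apply Rmult_comm|].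
    apply (ex_series_scal (V := R_NormedModule)), ex_series_half. }
  assert (forall n, Cmod (u n) <= b n) as Hu.
  { intros n; unfold u, b. rewrite Cmod_mult.
    eapply Rle_trans; [apply Rmult_le_compat_l; [apply Cmod_ge_0|apply (pow_taylor2 z h r); auto]|].
    - unfold r; lra.
    - eapply Rle_trans; [apply Cmod_triangle|unfold r; lra].
    - rewrite <- !Rmult_assoc. apply Rmult_le_compat_r; [apply pow_le, Cmod_ge_0|].
      apply Rle_trans with (Cmod (c n) * (8 * r) ^ n * (/ 2) ^ n).
      + replace (8 * r) with (2 * (4 * r)) by ring. rewrite <- pow_half_split.
        rewrite Rpow_mult_distr, Rmult_assoc. apply Rmult_le_compat_l; [apply Cmod_ge_0|].
        apply Rmult_le_compat_r; [apply pow_le; lra|].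
        replace (4 ^ n) with ((2 ^ n) ^ 2) by (rewrite <- pow_mult, Nat.mul_comm, pow_mult; f_equal; ring).
        apply pow_incr; split; [apply pos_INR|apply INR_le_pow2].
      + apply Rmult_le_compat_r; auto. apply pow_le; lra. }
  replace (power_series c (z + h) - power_series c z - power_series (deriv_coeff c) z * h)%C with (cseries u).
  - replace (Series _ * _) with (Series b); [apply cseries_bound; auto|].
    unfold b. rewrite Series_scal_r; auto.
  - apply cseries_eq, climit_incr.
    (* [deriv_coeff] shifts the index by one, so n of its terms match n + 1 terms of the original
       series. *)
    apply (climit_ext _ (fun n => cpsum (fun n => c n * cpown (z + h) n) (S n)
       - cpsum (fun n => c n * cpown z n) (S n) - cpsum (fun n => deriv_coeff c n * cpown z n) n * h)%C).
    { intros n. induction n; [unfold u; simpl; ring|].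
      rewrite (cpsum_S u (S n)), <- IHn, !cpsum_S. unfold u, deriv_coeff. simpl pred. ring. }
    pose proof (eventually_filter) as FF.
    apply climit_minus; try apply FF; [apply climit_minus; try apply FF|].
    + apply (climit_comp _ eventually S); [apply eventually_subseq_loc; exists O; intros; lia|apply power_series_cv; auto].
    + apply (climit_comp _ eventually S); [apply eventually_subseq_loc; exists O; intros; lia|apply power_series_cv; auto].
    + apply climit_mult; try apply FF; [apply power_series_cv, entire_deriv_coeff; auto|apply climit_const; apply FF].
Qed.

Lemma quad_is_derive (f : R -> R) (t l K d : R) : 0 < d ->
  (forall h, Rabs h < d -> Rabs (f (t + h) - f t - l * h) <= K * h ^ 2) -> is_derive f t l.
Proof.
  intros Hd H. apply is_derive_Reals. intros e He.
  assert (0 < e / (Rabs K + 1)) as Hk. { apply Rdiv_lt_0_compat; auto. pose proof (Rabs_pos K); lra. }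
  exists (mkposreal _ (Rmin_pos _ _ Hd Hk)). intros h Hh0 Hh. simpl in Hh.
  pose proof (Rmin_l d (e / (Rabs K + 1))); pose proof (Rmin_r d (e / (Rabs K + 1))).
  specialize (H h ltac:(lra)).
  replace ((f (t + h) - f t) / h - l) with ((f (t + h) - f t - l * h) / h) by (field; auto).
  unfold Rdiv. rewrite Rabs_mult, Rabs_inv.
  assert (0 < Rabs h) as Hp by (apply Rabs_pos_lt; auto).
  apply Rmult_lt_reg_r with (Rabs h); auto. rewrite Rmult_assoc, Rinv_l, Rmult_1_r by lra.
  eapply Rle_lt_trans; [apply H|].
  rewrite <- (pow2_abs h).
  apply Rle_lt_trans with ((Rabs K + 1) * Rabs h * Rabs h).
  - replace (K * Rabs h ^ 2) with (K * Rabs h * Rabs h) by ring.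
    repeat (apply Rmult_le_compat_r; [lra|]). pose proof (Rle_abs K); lra.
  - apply Rmult_lt_compat_r; auto.
    apply Rlt_le_trans with ((Rabs K + 1) * (e / (Rabs K + 1))).
    + apply Rmult_lt_compat_l; [pose proof (Rabs_pos K); lra|lra].
    + right; field. pose proof (Rabs_pos K); lra.
Qed.

Lemma cder_power_series (c : nat -> C) (w d : C) (t : R) : entire c ->
  cder (fun s => power_series c (w + RtoC s * d)) t (power_series (deriv_coeff c) (w + RtoC t * d) * d)%C.
Proof.
  intros Hc. destruct (power_series_quad c (w + RtoC t * d) Hc) as [K HK].
  assert (forall h, Rabs h < / (Cmod d + 1) ->
    Cmod (power_series c (w + RtoC (t + h) * d) - power_series c (w + RtoC t * d) - power_series (deriv_coeff c) (w + RtoC t * d) * d * RtoC h)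
    <= K * Cmod d ^ 2 * h ^ 2) as H.
  { intros h Hh. pose proof (Cmod_ge_0 d) as Hd.
    replace (w + RtoC (t + h) * d)%C with (w + RtoC t * d + RtoC h * d)%C by (rewrite RtoC_plus; ring).
    specialize (HK (RtoC h * d)%C). rewrite Cmod_mult, Cmod_R in HK.
    replace (K * Cmod d ^ 2 * h ^ 2) with (K * (Rabs h * Cmod d) ^ 2).
    2:{ rewrite Rpow_mult_distr, pow2_abs; ring. }
    replace (power_series (deriv_coeff c) (w + RtoC t * d) * d * RtoC h)%C with (power_series (deriv_coeff c) (w + RtoC t * d) * (RtoC h * d))%C by ring.
    apply HK.
    apply Rle_trans with (/ (Cmod d + 1) * (Cmod d + 1)); [|right; field; lra].
    apply Rmult_le_compat; try lra. apply Rabs_pos. }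
  assert (0 < / (Cmod d + 1)) as Hp by (apply Rinv_0_lt_compat; pose proof (Cmod_ge_0 d); lra).
  split; eapply quad_is_derive; eauto; intros h Hh; (eapply Rle_trans; [|apply (H h Hh)]).
  - eapply Rle_trans; [|apply re_le_Cmod]. right; f_equal.
    unfold Re; simpl; ring.
  - eapply Rle_trans; [|apply im_le_Cmod]. right; f_equal.
    unfold Im; simpl; ring.
Qed.

Definition ccts (g : C -> C) := forall z e, 0 < e -> exists d, 0 < d /\
  forall w, Cmod (w - z) < d -> Cmod (g w - g z) < e.

Lemma climit_ccts {T} (F : (T -> Prop) -> Prop) {FF : Filter F} (g : C -> C) (u : T -> C) (l : C) :
  ccts g -> climit F u l -> climit F (fun x => g (u x)) (g l).
Proof.
  intros Hg Hu e He. destruct (Hg l e He) as [d [Hd H]].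
  generalize (Hu d Hd); apply filter_imp; auto.
Qed.

Lemma ccts_power_series (c : nat -> C) : entire c -> ccts (power_series c).
Proof.
  intros Hc z e He. destruct (power_series_quad c z Hc) as [K HK].
  set (B := Rabs K + Cmod (power_series (deriv_coeff c) z) + 1).
  pose proof (Rabs_pos K). pose proof (Cmod_ge_0 (power_series (deriv_coeff c) z)).
  assert (0 < B) as HB by (unfold B; lra).
  exists (Rmin 1 (e / B)). split; [apply Rmin_pos; [lra|apply Rdiv_lt_0_compat; auto]|].
  intros w Hw. set (h := (w - z)%C) in *. replace w with (z + h)%C by (unfold h; ring).
  pose proof (Rmin_l 1 (e / B)); pose proof (Rmin_r 1 (e / B)). pose proof (Cmod_ge_0 h) as Hh.
  replace (power_series c (z + h) - power_series c z)%C with (power_series c (z + h) - power_series c z - power_series (deriv_coeff c) z * h + power_series (deriv_coeff c) z * h)%C by ring.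
  eapply Rle_lt_trans; [apply Cmod_triangle|]. rewrite Cmod_mult.
  apply Rle_lt_trans with (B * Cmod h).
  - specialize (HK h ltac:(lra)). unfold B. pose proof (Rle_abs K).
    assert (K * Cmod h ^ 2 <= Rabs K * Cmod h).
    { apply Rle_trans with (Rabs K * Cmod h ^ 2); [apply Rmult_le_compat_r; auto; apply pow_le; auto|].
      apply Rmult_le_compat_l; auto. simpl. nra. }
    lra.
  - apply Rlt_le_trans with (B * (e / B)); [apply Rmult_lt_compat_l; lra|right; field; lra].
Qed.

Lemma cexp_sub_1 (h : C) : Cmod (cexp h - 1) <= Cmod h * exp (Cmod h).
Proof.
  assert (forall t, cder (fun s => cexp (RtoC s * h)) t (cexp (RtoC t * h) * h)%C) as D.
  { intros t. apply cder_cexp. eapply cder_eq; [apply cder_mult; [apply cder_id|apply cder_const]|]. cbv beta; ring. }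
  assert (ccont (fun t => cexp (RtoC t * h) * h)%C) as Cc.
  { apply ccont_mult; [|apply ccont_const]. apply (cder_ccont _ _ D). }
  pose proof (cRInt_FTC _ _ 0 1 D Cc) as E. cbv beta in E.
  replace (RtoC 1 * h)%C with h in E by ring.
  replace (RtoC 0 * h)%C with (RtoC 0) in E by ring. rewrite cexp_0 in E.
  rewrite <- E.
  replace (Cmod h * exp (Cmod h)) with ((1 - 0) * (Cmod h * exp (Cmod h))) by ring.
  apply cRInt_bound_const; auto; [lra|].
  intros x Hx. rewrite Cmod_mult, Cmod_cexp, Rmult_comm. apply Rmult_le_compat_l; [apply Cmod_ge_0|].

  assert (Re (RtoC x * h) <= Cmod h) as [h1|h1].
  { rewrite re_scal_l. pose proof (re_le_Cmod h) as H; apply Rabs_le_between in H.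
    pose proof (Cmod_ge_0 h). nra. }
  - left; apply exp_increasing; auto.
  - rewrite h1; lra.
Qed.

Lemma ccts_cexp : ccts cexp.
Proof.
  intros z e He. set (B := exp (Re z) * exp 1).
  assert (0 < B) as HB by (apply Rmult_lt_0_compat; apply exp_pos).
  exists (Rmin 1 (e / B)). split; [apply Rmin_pos; [lra|apply Rdiv_lt_0_compat; auto]|].
  intros w Hw. set (h := (w - z)%C) in *. replace w with (z + h)%C by (unfold h; ring).
  pose proof (Rmin_l 1 (e / B)); pose proof (Rmin_r 1 (e / B)). pose proof (Cmod_ge_0 h) as Hh.
  rewrite cexp_add. replace (cexp z * cexp h - cexp z)%C with (cexp z * (cexp h - 1))%C by ring.
  rewrite Cmod_mult, Cmod_cexp.
  apply Rle_lt_trans with (B * Cmod h).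
  - unfold B. rewrite Rmult_assoc. apply Rmult_le_compat_l; [left; apply exp_pos|].
    eapply Rle_trans; [apply cexp_sub_1|]. rewrite Rmult_comm. apply Rmult_le_compat_r; auto.
    destruct (Rle_lt_or_eq_dec (Cmod h) 1 ltac:(lra)) as [h1|h1].
    + left; apply exp_increasing; auto.
    + rewrite h1; lra.
  - apply Rlt_le_trans with (B * (e / B)); [apply Rmult_lt_compat_l; lra|right; field; lra].
Qed.

(** Once n exceeds |K| r^2, the step from n to n + 2 no longer increases |c_n| r^n, so the whole
    sequence is bounded by its first terms. *)
Lemma entire_two_step (c : nat -> C) (K : R) :
  (forall n, Cmod (c (S (S n))) <= K / INR (S n) * Cmod (c n)) -> entire c.
Proof.
  intros H r Hr.
  destruct (INR_unbounded (Rabs K * r ^ 2)) as [N HN].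
  assert (forall n, (N <= n)%nat -> Cmod (c (S (S n))) * r ^ (S (S n)) <= Cmod (c n) * r ^ n) as Hs.
  { intros n Hn.
    assert (0 < INR (S n)) as Hp by (apply lt_0_INR; lia).
    assert (INR N <= INR (S n)) as HNn by (apply le_INR; lia).
    assert (0 <= Cmod (c n) * r ^ n) as Hq by (apply Rmult_le_pos; [apply Cmod_ge_0|apply pow_le; lra]).
    apply Rle_trans with (K / INR (S n) * Cmod (c n) * r ^ S (S n)).
    - apply Rmult_le_compat_r; auto. apply pow_le; lra.
    - replace (K / INR (S n) * Cmod (c n) * r ^ S (S n)) with (K * r ^ 2 / INR (S n) * (Cmod (c n) * r ^ n)) by (cbn [pow]; field; lra).
      rewrite <- (Rmult_1_l (Cmod (c n) * r ^ n)) at 2. apply Rmult_le_compat_r; auto.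
      apply Rmult_le_reg_r with (INR (S n)); auto.
      replace (K * r ^ 2 / INR (S n) * INR (S n)) with (K * r ^ 2) by (field; lra).
      assert (K * r ^ 2 <= Rabs K * r ^ 2).
      { apply Rmult_le_compat_r; [apply pow_le; lra|apply Rle_abs]. }
      lra. }
  assert (forall m, exists M, forall n, (n <= m)%nat -> Cmod (c n) * r ^ n <= M) as Hf.
  { induction m as [|m [M HM]].
    - exists (Cmod (c O) * r ^ 0). intros n Hn; replace n with O by lia; lra.
    - exists (Rmax M (Cmod (c (S m)) * r ^ S m)). intros n Hn.
      destruct (Nat.eq_dec n (S m)) as [->|h]; [apply Rmax_r|].
      eapply Rle_trans; [apply HM; lia|apply Rmax_l]. }
  (* The bound covers [N] and [S N], one starting index for each parity of the two-step descent. *)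
  destruct (Hf (S N)) as [M HM]. exists M.
  intros n. induction n as [n IH] using (well_founded_induction Wf_nat.lt_wf).
  destruct (Nat.le_gt_cases n (S N)) as [h|h]; [apply HM; auto|].
  destruct n as [|[|n]]; try lia.
  eapply Rle_trans; [apply Hs; lia|]. apply IH; lia.
Qed.

(** * Solutions of the parabolic cylinder equation *)

Lemma RtoC_neq_0 (x : R) : x <> 0 -> RtoC x <> 0%C.
Proof. intros H E; apply H; injection E; auto. Qed.

(** Two consecutive coefficients are carried along because the recurrence reaches two steps back. *)
Fixpoint pcf_coeff_pair (p A B : C) (n : nat) : C * C :=
  match n with
  | O => (A, B)
  | S m => (snd (pcf_coeff_pair p A B m),
      ((RtoC (INR m) + 2 * p) / RtoC (INR (S m) * INR (S (S m))) * fst (pcf_coeff_pair p A B m))%C)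
  end.

Definition pcf_coeff (p A B : C) (n : nat) : C := fst (pcf_coeff_pair p A B n).

Lemma pcf_coeff_0 (p A B : C) : pcf_coeff p A B 0 = A.
Proof. reflexivity. Qed.

Lemma pcf_coeff_1 (p A B : C) : pcf_coeff p A B 1 = B.
Proof. reflexivity. Qed.

Lemma pcf_coeff_SS (p A B : C) (n : nat) : pcf_coeff p A B (S (S n)) =
  ((RtoC (INR n) + 2 * p) / RtoC (INR (S n) * INR (S (S n))) * pcf_coeff p A B n)%C.
Proof. reflexivity. Qed.

Lemma two_step_ind (P : nat -> Prop) : P O -> P 1%nat -> (forall n, P n -> P (S (S n))) -> forall n, P n.
Proof.
  intros H0 H1 HS n. assert (P n /\ P (S n)) as [h _]; auto.
  induction n as [|n [h1 h2]]; auto.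
Qed.

(** Linear combinations, the derived series and the moment formula are all recognised as members of
    the family through this uniqueness. *)
Lemma pcf_coeff_eq (p A B : C) (c : nat -> C) : c O = A -> c 1%nat = B ->
  (forall n, c (S (S n)) = (RtoC (INR n) + 2 * p) / RtoC (INR (S n) * INR (S (S n))) * c n)%C ->
  forall n, c n = pcf_coeff p A B n.
Proof.
  intros H0 H1 HS. apply two_step_ind; auto. intros n IH. rewrite HS, pcf_coeff_SS, IH; auto.
Qed.

Lemma INR_S_pos (n : nat) : 0 < INR (S n).
Proof. apply lt_0_INR; lia. Qed.

Lemma entire_pcf_coeff (p A B : C) : entire (pcf_coeff p A B).
Proof.
  apply (entire_two_step _ (1 + 2 * Cmod p)). intros n. rewrite pcf_coeff_SS, Cmod_mult.
  apply Rmult_le_compat_r; [apply Cmod_ge_0|].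
  pose proof (INR_S_pos n) as H1; pose proof (INR_S_pos (S n)) as H2.
  pose proof (pos_INR n) as H0. pose proof (Cmod_ge_0 p) as Hp.
  rewrite Cmod_div by (apply RtoC_neq_0; nra). rewrite Cmod_R, Rabs_right by nra.
  apply Rle_trans with ((INR n + 2 * Cmod p) / (INR (S n) * INR (S (S n)))).
  - apply Rmult_le_compat_r; [left; apply Rinv_0_lt_compat; nra|].
    eapply Rle_trans; [apply Cmod_triangle|]. rewrite Cmod_mult, !Cmod_R, !Rabs_right; lra.
  - apply Rmult_le_reg_r with (INR (S n) * INR (S (S n))); [nra|].
    replace ((INR n + 2 * Cmod p) / (INR (S n) * INR (S (S n))) * (INR (S n) * INR (S (S n))))
      with (INR n + 2 * Cmod p) by (field; lra).
    replace ((1 + 2 * Cmod p) / INR (S n) * (INR (S n) * INR (S (S n))))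
      with ((1 + 2 * Cmod p) * INR (S (S n))) by (field; lra).
    rewrite !S_INR. nra.
Qed.

(* z |-> pcf_series p A B z solves G'' = z G' + 2 p G with G 0 = A, G' 0 = B; hence
   pcf b A B below solves y'' = (z^2/4 + b) y with y 0 = A, y' 0 = B. *)
Definition pcf_series (p A B z : C) : C := power_series (pcf_coeff p A B) z.

Lemma pcf_series_0 (p A B : C) : pcf_series p A B 0 = A.
Proof. unfold pcf_series; rewrite power_series_0; reflexivity. Qed.

Lemma pcf_series_lin (p A B z : C) : pcf_series p A B z = (A * pcf_series p 1 0 z + B * pcf_series p 0 1 z)%C.
Proof.
  unfold pcf_series. rewrite <- !power_series_scal, <- power_series_plus; try apply entire_pcf_coeff.
  - apply power_series_ext. intros n; symmetry.
    apply (pcf_coeff_eq p A B (fun n => A * pcf_coeff p 1 0 n + B * pcf_coeff p 0 1 n)%C).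
    + rewrite !pcf_coeff_0; ring.
    + rewrite !pcf_coeff_1; ring.
    + intros m; rewrite !pcf_coeff_SS; ring.
  - intros r Hr. destruct (entire_pcf_coeff p 1 0 r Hr) as [M HM]. exists (Cmod A * M). intros n.
    rewrite Cmod_mult, Rmult_assoc. apply Rmult_le_compat_l; auto; apply Cmod_ge_0.
  - intros r Hr. destruct (entire_pcf_coeff p 0 1 r Hr) as [M HM]. exists (Cmod B * M). intros n.
    rewrite Cmod_mult, Rmult_assoc. apply Rmult_le_compat_l; auto; apply Cmod_ge_0.
Qed.

(** Differentiating G'' = z G' + 2 p G gives the same equation for G' with p + 1/2 in place of p, so
    derivatives stay inside the family. *)
Lemma deriv_coeff_pcf_coeff (p A B : C) (n : nat) :
  deriv_coeff (pcf_coeff p A B) n = pcf_coeff (p + RtoC (1/2)) B (2 * p * A) n.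
Proof.
  apply (pcf_coeff_eq (p + RtoC (1/2)) B (2 * p * A)%C (deriv_coeff (pcf_coeff p A B))).
  - unfold deriv_coeff. rewrite pcf_coeff_1. simpl INR. ring.
  - unfold deriv_coeff. rewrite pcf_coeff_SS, pcf_coeff_0. simpl INR.
    replace (RtoC (1 * (1 + 1))) with (RtoC 2) by (f_equal; ring).
    replace (RtoC (1 + 1)) with (RtoC 2) by (f_equal; ring). field.
  - intros m. unfold deriv_coeff. rewrite (pcf_coeff_SS p A B (S m)).
    pose proof (INR_S_pos m) as H1; pose proof (INR_S_pos (S m)) as H2; pose proof (INR_S_pos (S (S m))) as H3.
    apply Rgt_not_eq in H1; apply Rgt_not_eq in H2; apply Rgt_not_eq in H3.
    rewrite !RtoC_mult. replace (RtoC (INR m)) with (RtoC (INR (S m)) - 1)%C by (rewrite S_INR, RtoC_plus; ring).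
    replace (RtoC (1/2)) with (/ 2)%C by (rewrite <- RtoC_inv by lra; f_equal; field).
    field. repeat split; apply RtoC_neq_0; auto.
Qed.

Lemma cder_pcf_series (p A B w d : C) (t : R) :
  cder (fun s => pcf_series p A B (w + RtoC s * d)) t (pcf_series (p + RtoC (1/2)) B (2 * p * A) (w + RtoC t * d) * d)%C.
Proof.
  unfold pcf_series. rewrite <- (power_series_ext _ _ _ (deriv_coeff_pcf_coeff p A B)). apply cder_power_series, entire_pcf_coeff.
Qed.

(** The left side is the second derivative, obtained by applying [deriv_coeff_pcf_coeff] twice; the
    coefficients of z G' are n c_n. *)
Lemma pcf_series_ode (p A B z : C) :
  pcf_series (p + RtoC (1/2) + RtoC (1/2)) (2 * p * A) (2 * (p + RtoC (1/2)) * B) z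
  = (z * pcf_series (p + RtoC (1/2)) B (2 * p * A) z + 2 * p * pcf_series p A B z)%C.
Proof.
  unfold pcf_series. rewrite <- power_series_shift_coeff, <- power_series_scal by apply entire_pcf_coeff.
  assert (forall n, shift_coeff (pcf_coeff (p + RtoC (1/2)) B (2 * p * A)) n = RtoC (INR n) * pcf_coeff p A B n)%C as E.
  { intros [|n]; simpl shift_coeff; [simpl; ring|]. rewrite <- deriv_coeff_pcf_coeff. reflexivity. }
  rewrite <- power_series_plus.
  - apply power_series_ext. intros n. rewrite E, <- deriv_coeff_pcf_coeff. unfold deriv_coeff. rewrite <- deriv_coeff_pcf_coeff. unfold deriv_coeff.
    rewrite pcf_coeff_SS.
    pose proof (INR_S_pos n) as H1; pose proof (INR_S_pos (S n)) as H2.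
    apply Rgt_not_eq in H1; apply Rgt_not_eq in H2. rewrite RtoC_mult.
    field. split; apply RtoC_neq_0; auto.
  - intros r Hr. destruct (entire_pcf_coeff (p + RtoC (1/2)) B (2 * p * A) r Hr) as [M HM].
    exists (M * r). intros [|n].
    + simpl. rewrite Cmod_0, Rmult_0_l. apply Rmult_le_pos; [|lra].
      eapply Rle_trans; [|apply (HM O)]. apply Rmult_le_pos; [apply Cmod_ge_0|simpl; lra].
    + simpl. replace (Cmod (pcf_coeff (p + RtoC (1/2)) B (2 * p * A) n) * (r * r ^ n)) with
      ((Cmod (pcf_coeff (p + RtoC (1/2)) B (2 * p * A) n) * r ^ n) * r) by ring.
      apply Rmult_le_compat_r; auto; lra.
  - intros r Hr. destruct (entire_pcf_coeff p A B r Hr) as [M HM]. exists (Cmod (2 * p) * M). intros n.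
    rewrite (Cmod_mult (2 * p)), Rmult_assoc. apply Rmult_le_compat_l; auto; apply Cmod_ge_0.
Qed.

Definition gaussian (z : C) : C := cexp (- (z * z) / RtoC 4).

Definition pcf (b A B z : C) : C := (gaussian z * pcf_series (b / RtoC 2 + RtoC (1/4)) A B z)%C.

Definition dpcf (b A B z : C) : C :=
  (gaussian z * (pcf_series (b / RtoC 2 + RtoC (1/4) + RtoC (1/2)) B (2 * (b / RtoC 2 + RtoC (1/4)) * A) z
    - z / RtoC 2 * pcf_series (b / RtoC 2 + RtoC (1/4)) A B z))%C.

Lemma cder_affine (w d : C) (t : R) : cder (fun s => w + RtoC s * d)%C t d.
Proof.
  eapply cder_eq; [apply cder_plus; [apply cder_const|apply cder_mult; [apply cder_id|apply cder_const]]|].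
  cbv beta; ring.
Qed.

Lemma cder_gaussian (w d : C) (t : R) : cder (fun s => gaussian (w + RtoC s * d)) t
  (gaussian (w + RtoC t * d) * (- (w + RtoC t * d) / RtoC 2) * d)%C.
Proof.
  unfold gaussian. eapply cder_eq; [apply cder_cexp, cder_mult;
    [apply cder_opp, cder_mult; apply cder_affine|apply cder_const]|].
  cbv beta. replace (RtoC 4) with (2 * 2)%C by (rewrite <- RtoC_mult; f_equal; ring). field.
Qed.

Lemma cder_pcf (b A B w d : C) (t : R) :
  cder (fun s => pcf b A B (w + RtoC s * d)) t (dpcf b A B (w + RtoC t * d) * d)%C.
Proof.
  unfold pcf. eapply cder_eq; [apply cder_mult; [apply cder_gaussian|apply cder_pcf_series]|].
  unfold dpcf. cbv beta. field.
Qed.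

Lemma cder_dpcf (b A B w d : C) (t : R) :
  cder (fun s => dpcf b A B (w + RtoC s * d)) t
   (((w + RtoC t * d) * (w + RtoC t * d) / RtoC 4 + b) * pcf b A B (w + RtoC t * d) * d)%C.
Proof.
  unfold dpcf. eapply cder_eq; [apply cder_mult; [apply cder_gaussian|apply cder_minus;
    [apply cder_pcf_series|apply cder_mult; [apply cder_mult; [apply cder_affine|apply cder_const]|apply cder_pcf_series]]]|].
  cbv beta. unfold pcf. rewrite pcf_series_ode. set (z := (w + RtoC t * d)%C).
  set (p := (b / RtoC 2 + RtoC (1/4))%C).
  replace b with (2 * p - / 2)%C.
  2:{ unfold p. replace (RtoC (1/4)) with (/ (2 * 2))%C.
      2:{ rewrite <- RtoC_mult, <- RtoC_inv by lra. f_equal; field. } field. }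
  replace (RtoC 4) with (2 * 2)%C by (rewrite <- RtoC_mult; f_equal; ring). field.
Qed.

Lemma gaussian_0 : gaussian 0 = 1%C.
Proof.
  unfold gaussian. replace (- (0 * 0) / RtoC 4)%C with (RtoC 0); [apply cexp_0|].
  unfold Cdiv; ring.
Qed.

Lemma pcf_0 (b A B : C) : pcf b A B 0 = A.
Proof. unfold pcf; rewrite gaussian_0, pcf_series_0; ring. Qed.

Lemma dpcf_0 (b A B : C) : dpcf b A B 0 = B.
Proof. unfold dpcf; rewrite gaussian_0, !pcf_series_0. unfold Cdiv; ring. Qed.

Lemma pcf_lin (b A B z : C) : pcf b A B z = (A * pcf b 1 0 z + B * pcf b 0 1 z)%C.
Proof. unfold pcf. rewrite pcf_series_lin; ring. Qed.

(* Gronwall for |y|^2 + |y'|^2. *)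
Lemma ode_unique (y dy q : R -> C) (K : R) :
  (forall t, cder y t (dy t)) -> (forall t, cder dy t (q t * y t)%C) ->
  (forall t, 0 <= t <= 1 -> Cmod (q t) <= K) -> y 0 = 0%C -> dy 0 = 0%C -> y 1 = 0%C.
Proof.
  intros Hy Hdy Hq H0 H1.
  set (E := fun t => Re (y t) * Re (y t) + Im (y t) * Im (y t) + (Re (dy t) * Re (dy t) + Im (dy t) * Im (dy t))).
  set (dE := fun t => 2 * (Re (Cconj (y t) * dy t)%C + Re (Cconj (dy t) * (q t * y t))%C)).
  assert (forall t, is_derive E t (dE t)) as DE.
  { intros t. destruct (Hy t) as [a1 a2]; destruct (Hdy t) as [a3 a4]. unfold E.
    eapply is_derive_eq; [apply (is_derive_plus (V := R_NormedModule)); apply (is_derive_plus (V := R_NormedModule));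
      apply is_derive_Rmult; eauto|].
    unfold dE, plus, Cconj, Re, Im; simpl; ring. }
  assert (forall t, E t = Cmod (y t) ^ 2 + Cmod (dy t) ^ 2) as EE.
  { intros t; unfold E; rewrite !Cmod2_alt; ring. }
  assert (forall t, 0 <= t <= 1 -> dE t <= (1 + K) * E t) as Hle.
  { intros t Ht. rewrite EE. unfold dE. pose proof (Hq t Ht) as HK.
    assert (Re (Cconj (y t) * dy t)%C <= Cmod (y t) * Cmod (dy t)) as h1.
    { eapply Rle_trans; [apply Rle_abs|]. eapply Rle_trans; [apply re_le_Cmod|].
      rewrite Cmod_mult, Cmod_conj; lra. }
    assert (Re (Cconj (dy t) * (q t * y t))%C <= K * (Cmod (y t) * Cmod (dy t))) as h2.
    { eapply Rle_trans; [apply Rle_abs|]. eapply Rle_trans; [apply re_le_Cmod|].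
      rewrite !Cmod_mult, Cmod_conj.
      replace (Cmod (dy t) * (Cmod (q t) * Cmod (y t))) with (Cmod (q t) * (Cmod (y t) * Cmod (dy t))) by ring.
      apply Rmult_le_compat_r; auto. apply Rmult_le_pos; apply Cmod_ge_0. }
    pose proof (Cmod_ge_0 (q t)).
    pose proof (pow2_ge_0 (Cmod (y t) - Cmod (dy t))). nra. }
  destruct (MVT_gen (fun t => E t * exp (- ((1 + K) * t))) 0 1
    (fun t => (dE t - (1 + K) * E t) * exp (- ((1 + K) * t)))) as [c [Hc Ec]].
  - intros x _. eapply is_derive_eq; [apply is_derive_Rmult; [apply DE|]|].
    + auto_derive; auto.
    + cbv beta; ring.
  - intros x _. apply continuity_pt_filterlim.
    apply (continuous_mult (K := R_AbsRing) E (fun t => exp (- ((1 + K) * t)))).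
    + apply (ex_derive_continuous (V := R_NormedModule)). eexists; apply DE.
    + apply (ex_derive_continuous (V := R_NormedModule)). auto_derive; auto.
  - rewrite Rmin_left, Rmax_right in Hc by lra.
    assert (E 0 = 0) as E0. { rewrite EE, H0, H1, Cmod_0; ring. }
    rewrite E0 in Ec.
    assert (E 1 * exp (- ((1 + K) * 1)) <= 0) as Hn.
    { pose proof (Hle c Hc). pose proof (exp_pos (- ((1 + K) * c))). nra. }
    assert (E 1 <= 0). { pose proof (exp_pos (- ((1 + K) * 1))). nra. }
    rewrite EE in H. apply Cmod_eq_0.
    pose proof (Cmod_ge_0 (y 1)). pose proof (pow2_ge_0 (Cmod (dy 1))). nra.
Qed.

(** If y solves the equation with parameter -b, then y(i z) solves it with b and has derivative i B
    at 0. Uniqueness is applied to the difference along the segment from 0 to [z]. This is what puts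
    W_3 in the same even and odd basis as W_0. *)
Lemma pcf_rot (b A B z : C) : pcf (- b) A B (Ci * z) = pcf b A (Ci * B) z.
Proof.
  set (y := fun s => (pcf (- b) A B (0 + RtoC s * (Ci * z)) - pcf b A (Ci * B) (0 + RtoC s * z))%C).
  set (dy := fun s => (dpcf (- b) A B (0 + RtoC s * (Ci * z)) * (Ci * z) - dpcf b A (Ci * B) (0 + RtoC s * z) * z)%C).
  set (q := fun s => (z * z * (RtoC s * RtoC s * (z * z) / RtoC 4 + b))%C).
  assert (Ci * Ci = - (1))%C as Hi by (csimp; ring).
  assert (y 1 = 0%C) as H.
  { apply (ode_unique y dy q (Cmod (z * z) * (Cmod (z * z / RtoC 4) + Cmod b))).
    - intros t; unfold y, dy; apply cder_minus; apply cder_pcf.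
    - intros t; unfold y, dy. eapply cder_eq; [apply cder_minus; (apply cder_mult; [apply cder_dpcf|apply cder_const])|].
      cbv beta. unfold q. set (X := pcf (- b) A B _). set (Y := pcf b A (Ci * B) _).
      replace ((0 + RtoC t * (Ci * z)) * (0 + RtoC t * (Ci * z)) / RtoC 4 + - b)%C with
        (- (RtoC t * RtoC t * (z * z) / RtoC 4 + b))%C.
      2:{ replace ((0 + RtoC t * (Ci * z)) * (0 + RtoC t * (Ci * z)))%C with (- (RtoC t * RtoC t * (z * z)))%C;
          [unfold Cdiv; ring|]. transitivity ((Ci * Ci) * (RtoC t * RtoC t * (z * z)))%C; [rewrite Hi; ring|ring]. }
      replace ((0 + RtoC t * z) * (0 + RtoC t * z))%C with (RtoC t * RtoC t * (z * z))%C by ring.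
      set (Q := (RtoC t * RtoC t * (z * z) / RtoC 4 + b)%C).
      transitivity (- (Ci * Ci) * (Q * X * z * z) - Q * Y * z * z)%C; [ring|rewrite Hi; ring].
    - intros t Ht. unfold q. rewrite Cmod_mult. apply Rmult_le_compat_l; [apply Cmod_ge_0|].
      eapply Rle_trans; [apply Cmod_triangle|]. apply Rplus_le_compat_r.
      replace (RtoC t * RtoC t * (z * z) / RtoC 4)%C with (RtoC (t * t) * (z * z / RtoC 4))%C
        by (rewrite RtoC_mult; unfold Cdiv; ring).
      rewrite (Cmod_mult (RtoC (t * t))), Cmod_R, Rabs_right by nra.
      rewrite <- (Rmult_1_l (Cmod (z * z / RtoC 4))) at 2. apply Rmult_le_compat_r; [apply Cmod_ge_0|nra].
    - unfold y. replace (0 + RtoC 0 * (Ci * z))%C with (RtoC 0) by ring.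
      replace (0 + RtoC 0 * z)%C with (RtoC 0) by ring. rewrite !pcf_0; ring.
    - unfold dy. replace (0 + RtoC 0 * (Ci * z))%C with (RtoC 0) by ring.
      replace (0 + RtoC 0 * z)%C with (RtoC 0) by ring. rewrite !dpcf_0; ring. }
  unfold y in H. replace (0 + RtoC 1 * (Ci * z))%C with (Ci * z)%C in H by ring.
  replace (0 + RtoC 1 * z)%C with z in H by ring.
  replace (pcf (- b) A B (Ci * z)) with (pcf (- b) A B (Ci * z) - pcf b A (Ci * B) z + pcf b A (Ci * B) z)%C by ring.
  rewrite H; ring.
Qed.

(** * Kummer's series and the identification of U *)

Lemma cpsum_even_odd (u : nat -> C) (n : nat) : cpsum u (2 * n) =
  (cpsum (fun k => u (2 * k)%nat) n + cpsum (fun k => u (S (2 * k))) n)%C.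
Proof.
  induction n; [simpl; ring|]. replace (2 * S n)%nat with (S (S (2 * n))) by lia.
  rewrite !cpsum_S, IHn. replace (n + (n + 0))%nat with (2 * n)%nat by lia. ring.
Qed.

Lemma climit_double (u : nat -> C) (l : C) : climit eventually u l ->
  climit eventually (fun n => u (2 * n)%nat) l.
Proof.
  intros H. apply (climit_comp _ eventually (fun n => 2 * n)%nat); auto.
  apply eventually_subseq_loc. exists O; intros; lia.
Qed.

Lemma cpsum_0 (u : nat -> C) (n : nat) : (forall k, u k = 0%C) -> cpsum u n = 0%C.
Proof. intros H; induction n; simpl; auto. rewrite IHn, H; ring. Qed.

Lemma poch_pos_neq_0 (x : R) (n : nat) : 0 < x -> cpoch (RtoC x) n <> 0%C.
Proof.
  intros Hx; induction n; simpl; [apply RtoC_neq_0; lra|].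
  apply Cmult_neq_0; auto. rewrite <- RtoC_plus. apply RtoC_neq_0. pose proof (pos_INR n); lra.
Qed.

Definition kummer_term (a : C) (be : R) (x : C) (n : nat) : C :=
  (cpoch a n / (cpoch (RtoC be) n * RtoC (INR (fact n))) * cpown x n)%C.

Lemma kummer_term_S (a : C) (be : R) (x : C) (n : nat) : 0 < be ->
  kummer_term a be x (S n) = ((a + RtoC (INR n)) / (RtoC (be + INR n) * RtoC (INR (S n))) * x * kummer_term a be x n)%C.
Proof.
  intros Hb; unfold kummer_term. rewrite fact_simpl, mult_INR, RtoC_mult. cbn [cpoch cpown].
  assert (RtoC be + RtoC (INR n) <> 0)%C as h1.
  { rewrite <- RtoC_plus. apply RtoC_neq_0; pose proof (pos_INR n); lra. }
  assert (RtoC (INR (fact n)) <> 0%C) as h2 by apply RtoC_neq_0, not_0_INR, fact_neq_0.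
  assert (RtoC (INR (S n)) <> 0%C) as h3 by (apply RtoC_neq_0, not_0_INR; lia).
  pose proof (poch_pos_neq_0 be n Hb) as h4.
  rewrite RtoC_plus. field. repeat split; auto.
Qed.

Lemma RtoC_half : RtoC (1/2) = (/ RtoC 2)%C.
Proof. rewrite <- RtoC_inv by lra; f_equal; field. Qed.

Lemma INR_2k (k : nat) : RtoC (INR (2 * k)) = (RtoC 2 * RtoC (INR k))%C.
Proof. rewrite mult_INR, RtoC_mult; simpl INR. do 2 f_equal; ring. Qed.

Lemma INR_Sk (k : nat) : RtoC (INR (S k)) = (RtoC (INR k) + 1)%C.
Proof. rewrite S_INR, RtoC_plus; auto. Qed.

Lemma INR_lin_neq_0 (a b : R) (k : nat) : 0 <= a -> 0 < b -> (RtoC a * RtoC (INR k) + RtoC b)%C <> 0%C.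
Proof.
  intros Ha Hb. rewrite <- RtoC_mult, <- RtoC_plus. apply RtoC_neq_0. pose proof (pos_INR k). nra.
Qed.

(** With B = 0 the odd coefficients vanish, so n terms of Kummer's series in z^2/2 are exactly 2n
    terms of the power series in z. *)
Lemma kummer_even (p z : C) : kummerM p (RtoC (1/2)) (z * z / RtoC 2) = pcf_series p 1 0 z.
Proof.
  apply cseries_eq.
  apply (climit_ext _ (fun n => cpsum (fun k => pcf_coeff p 1 0 k * cpown z k)%C (2 * n))).
  2:{ apply (climit_double (cpsum _)). apply power_series_cv, entire_pcf_coeff. }
  intros n. rewrite cpsum_even_odd. rewrite (cpsum_0 (fun k => _ (S (2 * k)) * _)%C).
  2:{ intros k. replace (pcf_coeff p 1 0 (S (2 * k))) with (RtoC 0); [ring|]. induction k; auto.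
      replace (S (2 * S k)) with (S (S (S (2 * k)))) by lia. rewrite pcf_coeff_SS, <- IHk; ring. }
  rewrite Cplus_0_r. apply cpsum_ext. intros k.
  change (pcf_coeff p 1 0 (2 * k) * cpown z (2 * k) = kummer_term p (1/2) (z * z / RtoC 2) k)%C.
  induction k.
  - unfold kummer_term; simpl. rewrite pcf_coeff_0. field.
  - rewrite kummer_term_S, <- IHk by lra. replace (2 * S k)%nat with (S (S (2 * k))) by lia.
    rewrite pcf_coeff_SS. cbn [cpown]. rewrite RtoC_mult, !INR_Sk, INR_2k, RtoC_plus, RtoC_half.
    pose proof (INR_lin_neq_0 2 1 k ltac:(lra) ltac:(lra)) as h1.
    pose proof (INR_lin_neq_0 2 2 k ltac:(lra) ltac:(lra)) as h2.
    pose proof (INR_lin_neq_0 1 1 k ltac:(lra) ltac:(lra)) as h3.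
    rewrite Cmult_1_l in h3.
    replace (RtoC 2 * RtoC (INR k) + 1 + 1)%C with (RtoC 2 * (RtoC (INR k) + 1))%C
      by (replace (RtoC 2) with (1 + 1)%C by (rewrite <- RtoC_plus; f_equal; ring); ring).
    replace (/ RtoC 2 + RtoC (INR k))%C with ((RtoC 2 * RtoC (INR k) + 1) / RtoC 2)%C
      by (field; apply RtoC_neq_0; lra).
    assert (RtoC 2 <> 0%C) as h4 by (apply RtoC_neq_0; lra).
    field. repeat split; auto.
Qed.

Lemma kummer_odd (p z : C) :
  (z * kummerM (p + RtoC (1/2)) (RtoC (3/2)) (z * z / RtoC 2))%C = pcf_series p 0 1 z.
Proof.
  (* The comparison of the two series divides by [z]. *)
  destruct (Ceq_dec z 0) as [->|Hz].
  { rewrite pcf_series_0; ring. }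
  assert (kummerM (p + RtoC (1/2)) (RtoC (3/2)) (z * z / RtoC 2) = / z * pcf_series p 0 1 z)%C as ->; [|field; auto].
  apply cseries_eq.
  apply (climit_ext _ (fun n => / z * cpsum (fun k => pcf_coeff p 0 1 k * cpown z k) (2 * n))%C).
  2:{ apply climit_scal; [apply eventually_filter|]. apply (climit_double (cpsum _)). apply power_series_cv, entire_pcf_coeff. }
  intros n. rewrite cpsum_even_odd. rewrite (cpsum_0 (fun k => _ (2 * k)%nat * _)%C).
  2:{ intros k. replace (pcf_coeff p 0 1 (2 * k)) with (RtoC 0); [ring|]. induction k; auto.
      replace (2 * S k)%nat with (S (S (2 * k))) by lia. rewrite pcf_coeff_SS, <- IHk; ring. }
  rewrite Cplus_0_l, <- cpsum_scal. apply cpsum_ext. intros k.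
  change (/ z * (pcf_coeff p 0 1 (S (2 * k)) * cpown z (S (2 * k))) = kummer_term (p + RtoC (1/2)) (3/2) (z * z / RtoC 2) k)%C.
  induction k.
  - unfold kummer_term; simpl. rewrite pcf_coeff_1. field. auto.
  - rewrite kummer_term_S, <- IHk by lra. replace (2 * S k)%nat with (S (S (2 * k))) by lia.
    rewrite pcf_coeff_SS. cbn [cpown]. rewrite RtoC_mult, !INR_Sk, INR_2k, RtoC_plus, RtoC_half.
    pose proof (INR_lin_neq_0 2 1 k ltac:(lra) ltac:(lra)) as h1.
    pose proof (INR_lin_neq_0 2 3 k ltac:(lra) ltac:(lra)) as h2.
    pose proof (INR_lin_neq_0 1 1 k ltac:(lra) ltac:(lra)) as h3.
    rewrite Cmult_1_l in h3.
    assert (RtoC 2 <> 0%C) as h4 by (apply RtoC_neq_0; lra).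
    replace (RtoC 3) with (RtoC 2 + 1)%C in h2 by (rewrite <- RtoC_plus; f_equal; ring).
    replace (RtoC 2 * RtoC (INR k) + 1 + 1)%C with (RtoC 2 * (RtoC (INR k) + 1))%C
      by (replace (RtoC 2) with (1 + 1)%C by (rewrite <- RtoC_plus; f_equal; ring); ring).
    replace (RtoC (3/2) + RtoC (INR k))%C with ((RtoC 2 * RtoC (INR k) + (RtoC 2 + 1)) / RtoC 2)%C.
    2:{ replace (RtoC (3/2)) with (1 + / RtoC 2)%C.
        - field; auto.
        - rewrite <- RtoC_inv, <- RtoC_plus by lra; f_equal; field. }
    replace (RtoC 2 * (RtoC (INR k) + 1) + 1)%C with (RtoC 2 * RtoC (INR k) + (RtoC 2 + 1))%C by ring.
    field. repeat split; auto.
    replace (RtoC 3) with (RtoC 2 + 1)%C by (rewrite <- RtoC_plus; f_equal; ring); auto.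
Qed.

Definition U_at_0 (b : C) : C :=
  (RtoC (sqrt PI) * rgamma (RtoC (3/4) + b / RtoC 2) / cpow_pos 2 (b / RtoC 2 + RtoC (1/4)))%C.

Definition dU_at_0 (b : C) : C :=
  (- (RtoC (sqrt PI) * rgamma (RtoC (1/4) + b / RtoC 2) / cpow_pos 2 (b / RtoC 2 - RtoC (1/4))))%C.

(** From here on U is the solution with prescribed values at 0, and Kummer's function is no longer
    needed. *)
Lemma PCU_pcf (b z : C) : PCU b z = pcf b (U_at_0 b) (dU_at_0 b) z.
Proof.
  rewrite pcf_lin. unfold pcf. rewrite <- kummer_even, <- kummer_odd.
  unfold PCU. fold (gaussian z). fold (U_at_0 b). fold (dU_at_0 b).
  replace (b / RtoC 2 + RtoC (3/4))%C with (b / RtoC 2 + RtoC (1/4) + RtoC (1/2))%C; [ring|].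
  rewrite <- Cplus_assoc, <- RtoC_plus. do 2 f_equal. field.
Qed.

Lemma ccts_comp (f g : C -> C) : ccts f -> ccts g -> ccts (fun z => f (g z)).
Proof.
  intros Hf Hg z e He. destruct (Hf (g z) e He) as [d [Hd H]].
  destruct (Hg z d Hd) as [d' [Hd' H']]. exists d'; split; auto.
Qed.

Lemma ccts_climit (f : C -> C) : ccts f <-> forall z, climit (locally z) f (f z).
Proof.
  split.
  - intros H z. apply (climit_ccts (locally z) f (fun w => w)); auto. intros e He.
    assert (0 < e / 2) as He2 by lra. exists (mkposreal _ He2). intros w [Hw1 Hw2].
    unfold ball in Hw1, Hw2; simpl in Hw1, Hw2; unfold AbsRing_ball, abs, minus, plus, opp in Hw1, Hw2; simpl in Hw1, Hw2.
    eapply Rle_lt_trans; [apply Cmod_le_abs|]. unfold Re, Im; simpl. unfold Rminus in *. lra.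
  - intros H z e He. destruct (H z e He) as [d Hd]. exists d; split; [apply cond_pos|].
    intros w Hw. apply Hd. split; unfold ball; simpl; unfold AbsRing_ball, abs, minus, plus, opp; simpl;
    (eapply Rle_lt_trans; [|apply Hw]).
    + apply (re_le_Cmod (w - z)).
    + apply (im_le_Cmod (w - z)).
Qed.

Lemma ccts_id : ccts (fun z => z).
Proof. intros z e He; exists e; auto. Qed.

Lemma ccts_const (c : C) : ccts (fun z => c).
Proof. apply ccts_climit; intros z; apply climit_const; apply locally_filter. Qed.

Lemma ccts_plus (f g : C -> C) : ccts f -> ccts g -> ccts (fun z => f z + g z)%C.
Proof.
  rewrite !ccts_climit; intros Hf Hg z. apply climit_plus; auto. apply locally_filter.
Qed.

Lemma ccts_mult (f g : C -> C) : ccts f -> ccts g -> ccts (fun z => f z * g z)%C.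
Proof.
  rewrite !ccts_climit; intros Hf Hg z. apply climit_mult; auto. apply locally_filter.
Qed.

Lemma ccts_opp (f : C -> C) : ccts f -> ccts (fun z => - f z)%C.
Proof.
  rewrite !ccts_climit; intros Hf z. apply climit_opp; auto. apply locally_filter.
Qed.

Lemma ccts_pcf_series (p A B : C) : ccts (pcf_series p A B).
Proof. apply ccts_power_series, entire_pcf_coeff. Qed.

Lemma ccts_gaussian : ccts gaussian.
Proof.
  apply (ccts_comp cexp); [apply ccts_cexp|].
  apply ccts_mult; [|apply ccts_const]. apply ccts_opp, ccts_mult; apply ccts_id.
Qed.

Lemma ccts_pcf (b A B : C) : ccts (pcf b A B).
Proof. apply ccts_mult; [apply ccts_gaussian|apply ccts_pcf_series]. Qed.

Lemma ccts_dpcf (b A B : C) : ccts (dpcf b A B).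
Proof.
  apply ccts_mult; [apply ccts_gaussian|]. apply ccts_plus; [apply ccts_pcf_series|]. apply ccts_opp.
  apply ccts_mult; [|apply ccts_pcf_series]. apply ccts_mult; [apply ccts_id|apply ccts_const].
Qed.

Lemma ccont_ccts (f : C -> C) (g : R -> C) : ccts f -> ccont g -> ccont (fun t => f (g t)).
Proof.
  intros Hf Hg t. pose proof (Hg t) as [h1 h2].
  assert (climit (locally t) (fun s => f (g s)) (f (g t))) as H.
  { apply climit_ccts; auto; [apply locally_filter|]. apply climit_of_ReIm; auto. apply locally_filter. }
  split; [apply (climit_Re _ _ _ H)|apply (climit_Im _ _ _ H)].
Qed.

(** * Green's formula and integrals along rays *)

Definition cont2 (f : R -> R -> C) := forall s t,
  climit (locally (s, t)) (fun p => f (fst p) (snd p)) (f s t).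

Lemma cont2_const (c : C) : cont2 (fun _ _ => c).
Proof. intros s t; apply climit_const, locally_filter. Qed.

Lemma cont2_plus (f g : R -> R -> C) : cont2 f -> cont2 g -> cont2 (fun s t => f s t + g s t)%C.
Proof. intros Hf Hg s t; apply climit_plus; try apply locally_filter; [apply Hf|apply Hg]. Qed.

Lemma cont2_mult (f g : R -> R -> C) : cont2 f -> cont2 g -> cont2 (fun s t => f s t * g s t)%C.
Proof. intros Hf Hg s t; apply climit_mult; try apply locally_filter; [apply Hf|apply Hg]. Qed.

Lemma cont2_opp (f : R -> R -> C) : cont2 f -> cont2 (fun s t => - f s t)%C.
Proof. intros Hf s t; apply climit_opp; try apply locally_filter; apply Hf. Qed.

Lemma cont2_minus (f g : R -> R -> C) : cont2 f -> cont2 g -> cont2 (fun s t => f s t - g s t)%C.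
Proof. intros; apply cont2_plus; auto; apply cont2_opp; auto. Qed.

Lemma cont2_ccts (g : C -> C) (f : R -> R -> C) : ccts g -> cont2 f -> cont2 (fun s t => g (f s t)).
Proof.
  intros Hg Hf s t; apply (climit_ccts _ g (fun p => f (fst p) (snd p))); auto; apply Hf.
Qed.

Lemma ccont_climit (f : R -> C) (t : R) : ccont f -> climit (locally t) f (f t).
Proof.
  intros H; destruct (H t); apply climit_of_ReIm; auto; apply locally_filter.
Qed.

Lemma climit_ccont (f : R -> C) : (forall t, climit (locally t) f (f t)) -> ccont f.
Proof.
  intros H t; split; [apply (climit_Re _ _ _ (H t))|apply (climit_Im _ _ _ (H t))].
Qed.

Lemma cont2_fst (f : R -> C) : ccont f -> cont2 (fun s _ => f s).
Proof.
  intros H s t. apply (climit_comp _ (locally s) fst).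
  - apply (continuous_fst (U := R_UniformSpace) (V := R_UniformSpace) s t).
  - apply ccont_climit; auto.
Qed.

Lemma cont2_snd (f : R -> C) : ccont f -> cont2 (fun _ t => f t).
Proof.
  intros H s t. apply (climit_comp _ (locally t) snd).
  - apply (continuous_snd (U := R_UniformSpace) (V := R_UniformSpace) s t).
  - apply ccont_climit; auto.
Qed.

Lemma cont2_ccont_l (f : R -> R -> C) (t : R) : cont2 f -> ccont (fun s => f s t).
Proof.
  intros H. apply climit_ccont; intros s.
  apply (climit_comp _ (locally (s, t)) (fun s => (s, t)) (fun p => f (fst p) (snd p))); auto.
  apply (continuous_comp_2 (U := R_UniformSpace) (fun s => s) (fun _ => t) (fun a b => (a, b)) s).
  - apply continuous_id.
  - apply continuous_const.
  - apply (continuous_ext (fun p => p)); [intros []; auto|apply continuous_id].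
Qed.

Lemma cont2_ccont_r (f : R -> R -> C) (s : R) : cont2 f -> ccont (fun t => f s t).
Proof.
  intros H. apply climit_ccont; intros t.
  apply (climit_comp _ (locally (s, t)) (fun t => (s, t)) (fun p => f (fst p) (snd p))); auto.
  apply (continuous_comp_2 (U := R_UniformSpace) (fun _ => s) (fun t => t) (fun a b => (a, b)) t).
  - apply continuous_const.
  - apply continuous_id.
  - apply (continuous_ext (fun p => p)); [intros []; auto|apply continuous_id].
Qed.

(** [D] is the common value of dP/dt and dQ/dz, so P dz + Q dt is closed. Differentiating the
    integral of P over [0, S] under the integral sign gives Q(t, S) - Q(t, 0), which is then
    integrated in t. *)
Lemma green_real (P Q D : R -> R -> R) (S T : R) :
  (forall t z, is_derive (fun u => P u z) t (D t z)) ->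
  (forall t z, is_derive (fun y => Q t y) z (D t z)) ->
  (forall t z, continuity_2d_pt D t z) ->
  (forall t z, continuous (fun y => P t y) z) ->
  (forall t z, continuous (fun y => D t y) z) ->
  (forall t z, continuous (fun u => Q u z) t) ->
  RInt (fun z => P T z) 0 S - RInt (fun z => P 0 z) 0 S = RInt (fun t => Q t S - Q t 0) 0 T.
Proof.
  intros HP HQ HD CP CD CQ.
  assert (forall t, is_derive (fun u => RInt (fun z => P u z) 0 S) t (Q t S - Q t 0)) as DI.
  { intros t.
    replace (Q t S - Q t 0) with (RInt (fun z => Derive (fun u => P u z) t) 0 S).
    - apply (is_derive_RInt_param P).
      + apply filter_forall; intros u z _. eexists; apply HP.
      + intros z _. apply continuity_2d_pt_ext with D; auto.
        intros; symmetry; apply is_derive_unique, HP.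
      + apply filter_forall; intros u. apply (ex_RInt_continuous (V := R_CompleteNormedModule)); auto.
    - rewrite (RInt_ext _ (fun z => D t z)) by (intros; apply is_derive_unique, HP).
      apply is_RInt_unique.
      apply (is_RInt_derive (V := R_CompleteNormedModule) (fun y => Q t y)); intros; auto. }
  symmetry; apply is_RInt_unique.
  apply (is_RInt_derive (V := R_CompleteNormedModule) (fun u => RInt (fun z => P u z) 0 S)); intros; auto.
  apply (continuous_minus (V := R_NormedModule)); auto.
Qed.

Lemma cont2_Re (f : R -> R -> C) : cont2 f -> forall s t, continuity_2d_pt (fun u v => Re (f u v)) s t.
Proof. intros H s t; apply continuity_2d_pt_filterlim. apply (climit_Re _ _ _ (H s t)). Qed.

Lemma cont2_Im (f : R -> R -> C) : cont2 f -> forall s t, continuity_2d_pt (fun u v => Im (f u v)) s t.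
Proof. intros H s t; apply continuity_2d_pt_filterlim. apply (climit_Im _ _ _ (H s t)). Qed.

Lemma green (P Q D : R -> R -> C) (S T : R) :
  (forall t z, cder (fun u => P u z) t (D t z)) ->
  (forall t z, cder (fun y => Q t y) z (D t z)) ->
  cont2 P -> cont2 Q -> cont2 D ->
  (cRInt (fun z => P T z) 0 S - cRInt (fun z => P 0 z) 0 S)%C = cRInt (fun t => Q t S - Q t 0)%C 0 T.
Proof.
  intros HP HQ CP CQ CD. unfold cRInt. csimp.
  - apply (green_real (fun t z => Re (P t z)) (fun t z => Re (Q t z)) (fun t z => Re (D t z))); intros.
    + apply HP.
    + apply HQ.
    + apply cont2_Re; auto.
    + destruct (cont2_ccont_r P t CP z); auto.
    + destruct (cont2_ccont_r D t CD z); auto.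
    + destruct (cont2_ccont_l Q z CQ t); auto.
  - apply (green_real (fun t z => Im (P t z)) (fun t z => Im (Q t z)) (fun t z => Im (D t z))); intros.
    + apply HP.
    + apply HQ.
    + apply cont2_Im; auto.
    + destruct (cont2_ccont_r P t CP z); auto.
    + destruct (cont2_ccont_r D t CD z); auto.
    + destruct (cont2_ccont_l Q z CQ t); auto.
Qed.

(** e^{S/2} is the cube of e^{S/6}, which exceeds S/6; 216 is 6^3. *)
Lemma sqr_exp_bound (S : R) : 0 < S -> S ^ 2 * exp (- (S / 2)) <= 216 / S.
Proof.
  intros HS. pose proof (exp_ineq1 (S / 6) ltac:(lra)) as H.
  rewrite exp_Ropp.
  replace (exp (S / 2)) with (exp (S / 6) ^ 3).
  2:{ simpl. rewrite Rmult_1_r, <- !exp_plus. f_equal; field. }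
  assert ((S / 6) ^ 3 <= exp (S / 6) ^ 3) as H2 by (apply pow_incr; lra).
  assert (0 < (S / 6) ^ 3) as H3 by (apply pow_lt; lra).
  apply Rle_trans with (S ^ 2 * / (S / 6) ^ 3).
  - apply Rmult_le_compat_l; [apply pow_le; lra|]. apply Rinv_le_contravar; auto.
  - right; field; lra.
Qed.

Lemma filterlim_squeeze0 {T} (F : (T -> Prop) -> Prop) {FF : Filter F} (u v : T -> R) :
  F (fun x => 0 <= u x <= v x) -> filterlim v F (locally 0) -> filterlim u F (locally 0).
Proof.
  intros H Hv. apply filterlim_locally; intros e.
  generalize (filter_and _ _ H (proj1 (filterlim_locally _ _) Hv e)); apply filter_imp.
  intros x [[h1 h2] h3]. unfold ball in *; simpl in *; unfold AbsRing_ball, abs, minus, plus, opp in *; simpl in *.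
  apply Rabs_lt_between in h3. apply Rabs_lt_between; lra.
Qed.

Lemma lim_inv_infty (c : R) : filterlim (fun S => c / S) (Rbar_locally p_infty) (locally 0).
Proof.
  apply (is_lim_ext (fun S => c * / S) _ p_infty 0); [reflexivity|].
  replace (Finite 0) with (Rbar_mult c 0) by (simpl; f_equal; ring).
  apply is_lim_scal_l. apply (is_lim_inv (fun S => S) p_infty p_infty); [apply is_lim_id|discriminate].
Qed.

Lemma lim_sqr_exp (c : R) : 0 <= c ->
  filterlim (fun S => c * (S ^ 2 * exp (- (S / 2)))) (Rbar_locally p_infty) (locally 0).
Proof.
  intros Hc. apply (filterlim_squeeze0 _ _ (fun S => c * 216 / S)); [|apply lim_inv_infty].
  exists 0; intros S HS. split.
  - apply Rmult_le_pos; auto. apply Rmult_le_pos; [apply pow_le; lra|left; apply exp_pos].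
  - unfold Rdiv; rewrite Rmult_assoc. apply Rmult_le_compat_l; auto. apply (sqr_exp_bound S); auto.
Qed.

Lemma exp_le (x y : R) : x <= y -> exp x <= exp y.
Proof. intros [h|h]; [left; apply exp_increasing; auto|rewrite h; lra]. Qed.

Lemma Cmod_gaussian (z : C) : Cmod (gaussian z) = exp (- ((Re z ^ 2 - Im z ^ 2) / 4)).
Proof.
  unfold gaussian. rewrite Cmod_cexp. f_equal.
  replace (- (z * z) / RtoC 4)%C with (RtoC (/4) * (- (z * z)))%C.
  2:{ unfold Cdiv. rewrite RtoC_inv by lra. ring. }
  rewrite re_scal_l. unfold Re, Im; simpl; field.
Qed.

(** For the series factor of [pcf] this is the working form of recessiveness: the Gaussian factor
    then dominates on the positive axis and far out on each of its translates. *)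
Definition bounded_rhp (f : C -> C) (K : R) := forall z, 0 <= Re z -> Cmod (f z) <= K.

(** Green's formula for the map (t, s) -> t x + s compares the ray from 0, the ray from [x], the
    segment from 0 to [x] and a far segment near L; the far segment vanishes by Gaussian decay. *)
Lemma ray_shift_coeff (b A B x J : C) (K : R) :
  bounded_rhp (pcf_series (b / RtoC 2 + RtoC (1/4)) A B) K -> is_improper (fun s => pcf b A B (RtoC s)) J ->
  is_improper (fun s => pcf b A B (x + RtoC s)%C) (J - cRInt (fun t => pcf b A B (RtoC t * x) * x)%C 0 1)%C.
Proof.
  intros HK HJ.
  assert (0 <= K) as HK0.
  { eapply Rle_trans; [apply Cmod_ge_0|apply (HK 0)]. simpl; lra. }
  assert (forall z, cont2 (fun t s => RtoC t * z + RtoC s)%C) as CA.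
  { intros z. apply cont2_plus; [apply cont2_mult; [apply (cont2_fst RtoC)|apply cont2_const]|apply (cont2_snd RtoC)];
    apply (cder_ccont _ _ cder_id). }
  assert (cont2 (fun t s => pcf b A B (RtoC t * x + RtoC s))) as CP by (apply cont2_ccts; auto; apply ccts_pcf).
  assert (cont2 (fun t s => pcf b A B (RtoC t * x + RtoC s) * x)%C) as CQ.
  { apply (cont2_mult (fun t s => pcf b A B (RtoC t * x + RtoC s))); auto; apply cont2_const. }
  assert (forall L, cRInt (fun s => pcf b A B (x + RtoC s)%C) 0 L =
    cRInt (fun s => pcf b A B (RtoC s)) 0 L + cRInt (fun t => pcf b A B (RtoC t * x + RtoC L) * x)%C 0 1
      - cRInt (fun t => pcf b A B (RtoC t * x) * x)%C 0 1)%C as E.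
  { intros L.
    pose proof (green (fun t s => pcf b A B (RtoC t * x + RtoC s)) (fun t s => pcf b A B (RtoC t * x + RtoC s) * x)%C
      (fun t s => dpcf b A B (RtoC t * x + RtoC s) * x)%C L 1) as H.
    rewrite (cRInt_ext (fun z => pcf b A B (RtoC 1 * x + RtoC z)%C) (fun z => pcf b A B (x + RtoC z)%C)) in H by (intros; f_equal; ring).
    rewrite (cRInt_ext (fun z => pcf b A B (RtoC 0 * x + RtoC z)%C) (fun z => pcf b A B (RtoC z))) in H by (intros; f_equal; ring).
    rewrite cRInt_minus in H by apply (cont2_ccont_l _ _ CQ).
    rewrite (cRInt_ext (fun t => pcf b A B (RtoC t * x + RtoC 0) * x)%C (fun t => pcf b A B (RtoC t * x) * x)%C) in H
        by (intros; rewrite Cplus_0_r; reflexivity).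
    replace (cRInt (fun s => pcf b A B (x + RtoC s)%C) 0 L) with
        (cRInt (fun s => pcf b A B (x + RtoC s)%C) 0 L - cRInt (fun s => pcf b A B (RtoC s)) 0 L
          + cRInt (fun s => pcf b A B (RtoC s)) 0 L)%C by ring.
    rewrite H; auto; [ring| | |].
    - intros t s. eapply cder_ext; [|eapply cder_eq; [apply (cder_pcf b A B (RtoC s) x t)|]].
      + intros u; cbv beta. f_equal; ring.
      + f_equal; f_equal; ring.
    - intros t s. eapply cder_ext; [|eapply cder_eq;
        [apply (cder_mult _ _ _ _ _ (cder_pcf b A B (RtoC t * x) 1 s) (cder_const x s))|]].
      + intros u; cbv beta. rewrite Cmult_1_r; reflexivity.
      + cbv beta. rewrite !Cmult_1_r. ring.
    - apply (cont2_mult (fun t s => dpcf b A B (RtoC t * x + RtoC s))); [|apply cont2_const].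
      apply cont2_ccts; auto; apply ccts_dpcf. }
  pose proof (Rbar_locally_filter p_infty) as FF.
  unfold is_improper.
  eapply (climit_ext _ (fun L => cRInt (fun s => pcf b A B (RtoC s)) 0 L + cRInt (fun t => pcf b A B (RtoC t * x + RtoC L) * x)%C 0 1
      - cRInt (fun t => pcf b A B (RtoC t * x) * x)%C 0 1)%C); [intros L; symmetry; apply E|].
  apply climit_minus; try apply FF; [|apply climit_const; apply FF].
  replace J with (J + 0)%C by ring. apply climit_plus; try apply FF; auto.
  set (m := Cmod x). pose proof (Cmod_ge_0 x) as Hm. fold m in Hm.
  apply (climit_squeeze _ _ _ (fun L => (K * m * exp (1 + 2 * m * m)) * (L ^ 2 * exp (- (L / 2))))).
  2:{ apply lim_sqr_exp. apply Rmult_le_pos; [apply Rmult_le_pos; auto|left; apply exp_pos]. }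
  exists (1 + 2 * m). intros L HL.
  replace (cRInt _ 0 1 - 0)%C with (cRInt (fun t => pcf b A B (RtoC t * x + RtoC L) * x)%C 0 1) by ring.
  replace ((K * m * exp (1 + 2 * m * m)) * (L ^ 2 * exp (- (L / 2)))) with
    ((1 - 0) * ((K * m * exp (1 + 2 * m * m)) * (L ^ 2 * exp (- (L / 2))))) by ring.
  apply cRInt_bound_const; [lra|apply (cont2_ccont_l _ _ CQ)|].
  intros t Ht. unfold pcf. rewrite !Cmod_mult, Cmod_gaussian. fold m.
  set (w := (RtoC t * x + RtoC L)%C).
  assert (Re w = t * Re x + L) as Ew by (unfold w; rewrite re_plus, re_scal_l, re_RtoC; ring).
  assert (Im w = t * Im x) as Ew2 by (unfold w, Im; simpl; ring).
  pose proof (re_le_Cmod x) as h1. pose proof (im_le_Cmod x) as h2. fold m in h1, h2.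
  apply Rabs_le_between in h1. apply Rabs_le_between in h2.
  assert (- m <= t * Re x <= m) as h3 by (split; nra).
  assert (- m <= t * Im x <= m) as h4 by (split; nra).
  (* The exponent is at most -(L^2 - 2 L m)/4. Completing the square bounds it by -L/2 + (m +
     1)^2/4, and (m + 1)^2/4 <= 1 + 2 m^2. The factor L^2 >= 1 only fits the bound to
     [lim_sqr_exp]. *)
  assert (exp (- ((Re w ^ 2 - Im w ^ 2) / 4)) <= exp (1 + 2 * m * m) * (L ^ 2 * exp (- (L / 2)))) as h5.
  { apply Rle_trans with (exp (1 + 2 * m * m) * (1 * exp (- (L / 2)))).
    - rewrite Rmult_1_l, <- exp_plus. apply exp_le. rewrite Ew, Ew2.
      set (u := t * Re x) in *. set (v := t * Im x) in *.
      assert (v ^ 2 <= m * m) by nra.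
      assert ((L - m) ^ 2 <= (u + L) ^ 2) by (apply pow_incr; lra).
      assert (L - m >= 0) by lra. nra.
    - apply Rmult_le_compat_l; [left; apply exp_pos|].
      apply Rmult_le_compat_r; [left; apply exp_pos|]. nra. }
  assert (Cmod (pcf_series (b / RtoC 2 + RtoC (1/4)) A B w) <= K) as h6 by (apply HK; rewrite Ew; lra).
  pose proof (exp_pos (- ((Re w ^ 2 - Im w ^ 2) / 4))) as h7.
  pose proof (Cmod_ge_0 (pcf_series (b / RtoC 2 + RtoC (1/4)) A B w)) as h8.
  replace (K * m * exp (1 + 2 * m * m) * (L ^ 2 * exp (- (L / 2)))) with
    ((exp (1 + 2 * m * m) * (L ^ 2 * exp (- (L / 2)))) * K * m) by ring.
  apply Rmult_le_compat_r; auto. apply Rmult_le_compat; auto; lra.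
Qed.

(** * Hyperbolic functions *)

Definition th (t : R) := sinh t / cosh t.
(** The negative power (cosh t)^(-s) for a real exponent. *)
Definition cosh_npow (s t : R) := exp (- (s * ln (cosh t))).

Lemma cosh_pos (t : R) : 0 < cosh t.
Proof. unfold cosh. pose proof (exp_pos t); pose proof (exp_pos (- t)); lra. Qed.

Lemma cosh_sinh (t : R) : cosh t * cosh t - sinh t * sinh t = 1.
Proof.
  unfold cosh, sinh. assert (exp t * exp (- t) = 1) as H by (rewrite <- exp_plus, Rplus_opp_r, exp_0; auto). nra.
Qed.

Lemma is_derive_cosh (t : R) : is_derive cosh t (sinh t).
Proof. apply is_derive_Reals, derivable_pt_lim_cosh. Qed.

Lemma is_derive_sinh (t : R) : is_derive sinh t (cosh t).
Proof. apply is_derive_Reals, derivable_pt_lim_sinh. Qed.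

Lemma is_derive_th (t : R) : is_derive th t (1 - th t ^ 2).
Proof.
  unfold th. pose proof (cosh_pos t).
  eapply is_derive_eq; [apply is_derive_div; [apply is_derive_sinh|apply is_derive_cosh|lra]|].
  unfold Rdiv. field. lra.
Qed.

Lemma is_derive_cosh_npow (s t : R) : is_derive (cosh_npow s) t (- (s * th t) * cosh_npow s t).
Proof.
  unfold cosh_npow, th. pose proof (cosh_pos t).
  eapply is_derive_eq; [apply is_derive_Rcomp; [apply is_derive_exp|]|].
  - apply (is_derive_opp (V := R_NormedModule)), is_derive_Rmult; [apply (is_derive_const (V := R_NormedModule))|].
    apply is_derive_Rcomp; [apply is_derive_ln; auto|apply is_derive_cosh].
  - unfold opp, zero; simpl. field. lra.
Qed.

Lemma cosh_ge_1 (t : R) : 1 <= cosh t.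
Proof.
  pose proof (cosh_sinh t). pose proof (cosh_pos t). pose proof (pow2_ge_0 (sinh t)). nra.
Qed.

Lemma cosh_npow_le_exp (s t : R) : 0 <= s -> 0 <= t -> cosh_npow s t <= exp (s * ln 2) * exp (- (s * t)).
Proof.
  intros Hs Ht. unfold cosh_npow. rewrite <- exp_plus. apply exp_le.
  assert (t - ln 2 <= ln (cosh t)); [|nra].
  rewrite <- (ln_exp t) at 1. rewrite <- ln_div; try lra; [|apply exp_pos].
  apply ln_le; [pose proof (exp_pos t); lra|]. unfold cosh. pose proof (exp_pos (- t)). lra.
Qed.

Lemma cosh_npow_le_1 (s t : R) : 0 <= s -> cosh_npow s t <= 1.
Proof.
  intros Hs. unfold cosh_npow. rewrite <- exp_0. apply exp_le.
  assert (0 <= ln (cosh t)); [|nra]. rewrite <- ln_1. apply ln_le; [lra|apply cosh_ge_1].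
Qed.

(** * The Mehler kernel and the integral of a recessive solution *)

(* mehler_time b t * mehler_space t z is g(t, z) = e^{-bt} (cosh t)^{-1/2} e^{-z^2 tanh(t)/4}, the
   semigroup generated by d^2/dz^2 - z^2/4 - b applied to the constant 1: g_t = g_zz - (z^2/4 + b) g.
   Hence the form U g dz + (U g_z - U' g) dt is closed whenever U'' = (z^2/4 + b) U. *)
Definition mehler_time (b : C) (t : R) : C := (cexp (- b * RtoC t) * RtoC (cosh_npow (1/2) t))%C.

Lemma cder_mehler_time (b : C) (t : R) : cder (mehler_time b) t (mehler_time b t * (- b - RtoC (th t) / RtoC 2))%C.
Proof.
  unfold mehler_time. eapply cder_eq; [apply cder_mult; [apply cder_cexp, cder_mult; [apply cder_const|apply cder_id]|
    apply cder_RtoC, is_derive_cosh_npow]|].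
  cbv beta. rewrite RtoC_mult, RtoC_opp, RtoC_mult, RtoC_half. unfold Cdiv. ring.
Qed.

Lemma Cmod_mehler_time (b : C) (t : R) : Re b = 0 -> Cmod (mehler_time b t) = cosh_npow (1/2) t.
Proof.
  intros Hb. unfold mehler_time. rewrite Cmod_mult, Cmod_cexp, Cmod_R, Rabs_right by (left; apply exp_pos).
  replace (Re (- b * RtoC t)) with 0; [rewrite exp_0; ring|].
  rewrite re_scal_r, re_opp, Hb; ring.
Qed.

Definition mehler_space (t z : R) : C := cexp (RtoC (z * z) * RtoC (- (th t / 4))).

Lemma Cmod_mehler_space (t z : R) : 0 <= t -> Cmod (mehler_space t z) <= 1.
Proof.
  intros Ht. unfold mehler_space. rewrite Cmod_cexp, <- RtoC_mult, re_RtoC, <- exp_0. apply exp_le.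
  assert (0 <= th t); [|nra]. unfold th. apply Rdiv_le_0_compat; [|apply cosh_pos].
  unfold sinh. assert (exp (- t) <= exp t) by (apply exp_le; lra). lra.
Qed.

Lemma th_bound (t : R) : Rabs (th t) <= 1.
Proof.
  unfold th. pose proof (cosh_pos t). unfold Rdiv. rewrite Rabs_mult, (Rabs_right (/ cosh t)).
  2:{ apply Rle_ge; left; apply Rinv_0_lt_compat; auto. }
  apply Rmult_le_reg_r with (cosh t); auto. rewrite Rmult_assoc, Rinv_l, Rmult_1_r, Rmult_1_l by lra.
  unfold sinh, cosh. pose proof (exp_pos t); pose proof (exp_pos (- t)). apply Rabs_le; lra.
Qed.

Lemma cder_mehler_space_t (t z : R) : cder (fun u => mehler_space u z) t (mehler_space t z * (RtoC (z * z) * RtoC (- ((1 - th t ^ 2) / 4))))%C.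
Proof.
  unfold mehler_space. eapply cder_eq; [apply cder_cexp, cder_scal, cder_RtoC|].
  - apply (is_derive_opp (V := R_NormedModule)). apply (is_derive_Rmult th (fun _ => / 4)).
    + apply is_derive_th.
    + apply (is_derive_const (V := R_NormedModule)).
  - cbv beta. f_equal. f_equal. f_equal. unfold opp, zero; simpl. field.
Qed.

Lemma cder_mehler_space_z (t z : R) : cder (fun y => mehler_space t y) z (mehler_space t z * RtoC (- (z * th t / 2)))%C.
Proof.
  unfold mehler_space. eapply cder_eq; [apply cder_cexp, cder_mult; [apply cder_RtoC|apply cder_const]|].
  - apply (is_derive_Rmult (fun y => y) (fun y => y)); apply (is_derive_id z).
  - cbv beta. f_equal. unfold one; simpl. rewrite Cmult_0_r, Cplus_0_r, <- RtoC_mult. f_equal. field.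
Qed.

Lemma ccont_th : ccont (fun t => RtoC (th t)).
Proof. apply (cder_ccont _ (fun t => RtoC (1 - th t ^ 2))). intros t; apply cder_RtoC, is_derive_th. Qed.

Lemma ccont_RtoC_id : ccont RtoC.
Proof. apply (cder_ccont _ _ cder_id). Qed.

Lemma ccont_mehler_time (b : C) : ccont (mehler_time b).
Proof. apply (cder_ccont _ _ (cder_mehler_time b)). Qed.

Lemma cont2_mehler_space : cont2 mehler_space.
Proof.
  unfold mehler_space. apply cont2_ccts; [apply ccts_cexp|]. apply cont2_mult.
  - apply (cont2_snd (fun z => RtoC (z * z))). apply (ccont_ext (fun z => RtoC z * RtoC z)%C).
    + intros; rewrite RtoC_mult; auto.
    + apply ccont_mult; apply ccont_RtoC_id.
  - apply (cont2_fst (fun t => RtoC (- (th t / 4)))). apply (ccont_ext (fun t => RtoC (th t) * RtoC (- / 4))%C).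
    + intros; rewrite <- RtoC_mult; f_equal; field.
    + apply ccont_mult; [apply ccont_th|apply ccont_const].
Qed.

Lemma ccont_pcf_R (b A B : C) : ccont (fun z => pcf b A B (RtoC z)).
Proof. apply ccont_ccts; [apply ccts_pcf|apply ccont_RtoC_id]. Qed.

Lemma ccont_dpcf_R (b A B : C) : ccont (fun z => dpcf b A B (RtoC z)).
Proof. apply ccont_ccts; [apply ccts_dpcf|apply ccont_RtoC_id]. Qed.

Lemma cder_pcf_R (b A B : C) (z : R) : cder (fun y => pcf b A B (RtoC y)) z (dpcf b A B (RtoC z)).
Proof.
  eapply cder_ext; [|eapply cder_eq; [apply (cder_pcf b A B 0 1 z)|]].
  - intros s; cbv beta; f_equal; ring.
  - rewrite Cmult_1_r. f_equal; ring.
Qed.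

Lemma cder_dpcf_R (b A B : C) (z : R) :
  cder (fun y => dpcf b A B (RtoC y)) z ((RtoC z * RtoC z / RtoC 4 + b) * pcf b A B (RtoC z))%C.
Proof.
  eapply cder_ext; [|eapply cder_eq; [apply (cder_dpcf b A B 0 1 z)|]].
  - intros s; cbv beta; f_equal; ring.
  - rewrite !Cmult_1_r, !Cplus_0_l. reflexivity.
Qed.

Lemma exp_sqr_bound (S : R) : exp (- (S ^ 2 / 4)) <= exp 1 * exp (- S).
Proof. rewrite <- exp_plus. apply exp_le. pose proof (pow2_ge_0 (S / 2 - 1)). nra. Qed.

Lemma pcf_bound (b A B : C) (K s : R) : bounded_rhp (pcf_series (b / RtoC 2 + RtoC (1/4)) A B) K -> 0 <= s ->
  Cmod (pcf b A B (RtoC s)) <= K * exp (- (s ^ 2 / 4)).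
Proof.
  intros HK Hs. unfold pcf. rewrite Cmod_mult, Cmod_gaussian. simpl Re; simpl Im.
  replace ((s ^ 2 - 0 ^ 2) / 4) with (s ^ 2 / 4) by field.
  rewrite Rmult_comm. apply Rmult_le_compat_r; [left; apply exp_pos|]. apply HK; simpl; auto.
Qed.

Lemma dpcf_bound (b A B : C) (K K' s : R) : bounded_rhp (pcf_series (b / RtoC 2 + RtoC (1/4)) A B) K ->
  bounded_rhp (pcf_series (b / RtoC 2 + RtoC (1/4) + RtoC (1/2)) B (2 * (b / RtoC 2 + RtoC (1/4)) * A)) K' ->
  0 <= s -> Cmod (dpcf b A B (RtoC s)) <= (K' + K * (s / 2)) * exp (- (s ^ 2 / 4)).
Proof.
  intros HK HK' Hs. unfold dpcf. rewrite Cmod_mult, Cmod_gaussian. simpl Re; simpl Im.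
  replace ((s ^ 2 - 0 ^ 2) / 4) with (s ^ 2 / 4) by field.
  rewrite Rmult_comm. apply Rmult_le_compat_r; [left; apply exp_pos|].
  eapply Rle_trans; [apply Cmod_triangle|]. rewrite Cmod_opp, Cmod_mult.
  apply Rplus_le_compat; [apply HK'; simpl; auto|].
  rewrite <- RtoC_div, Cmod_R, Rabs_right, Rmult_comm by lra.
  apply Rmult_le_compat_r; [lra|]. apply HK; simpl; auto.
Qed.

(** The dz component of the closed form; [mehler_Q] is its dt component. [mehler_D] is U g_t, which
    equals both mixed derivatives because (U g_z - U' g)_z = U (g_zz - (z^2/4 + b) g). *)
Definition mehler_P (b A B : C) (t z : R) : C := (pcf b A B (RtoC z) * (mehler_time b t * mehler_space t z))%C.
Definition mehler_Q (b A B : C) (t z : R) : C :=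
  (mehler_time b t * mehler_space t z * (pcf b A B (RtoC z) * RtoC (- (z * th t / 2)) - dpcf b A B (RtoC z)))%C.
Definition mehler_D (b A B : C) (t z : R) : C :=
  (pcf b A B (RtoC z) * (mehler_time b t * mehler_space t z) *
    (- b - RtoC (th t) / RtoC 2 - RtoC (z * z) * RtoC ((1 - th t ^ 2) / 4)))%C.

Lemma cont2_Rmult (f g : R -> R -> R) : cont2 (fun s t => RtoC (f s t)) -> cont2 (fun s t => RtoC (g s t)) ->
  cont2 (fun s t => RtoC (f s t * g s t)).
Proof.
  intros Hf Hg s t. eapply (climit_ext _ (fun p => RtoC (f (fst p) (snd p)) * RtoC (g (fst p) (snd p)))%C).
  - intros; rewrite RtoC_mult; auto.
  - rewrite RtoC_mult. apply (cont2_mult (fun s t => RtoC (f s t)) (fun s t => RtoC (g s t))); auto.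
Qed.

Lemma green_PQ (b A B : C) (S T : R) :
  (cRInt (fun z => mehler_P b A B T z) 0 S - cRInt (fun z => mehler_P b A B 0 z) 0 S)%C
   = cRInt (fun t => mehler_Q b A B t S - mehler_Q b A B t 0)%C 0 T.
Proof.
  assert (cont2 (fun t z => mehler_time b t * mehler_space t z)%C) as C1.
  { apply cont2_mult; [apply (cont2_fst (mehler_time b)), ccont_mehler_time|apply cont2_mehler_space]. }
  assert (cont2 (fun t z => pcf b A B (RtoC z))) as C2 by (apply (cont2_snd (fun z => pcf b A B (RtoC z))), ccont_pcf_R).
  assert (cont2 (fun t z => dpcf b A B (RtoC z))) as C3 by (apply (cont2_snd (fun z => dpcf b A B (RtoC z))), ccont_dpcf_R).
  assert (cont2 (fun t z => RtoC (th t))) as C4 by (apply (cont2_fst (fun t => RtoC (th t))), ccont_th).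
  assert (cont2 (fun t z => RtoC z)) as C5 by (apply (cont2_snd RtoC), ccont_RtoC_id).
  assert (cont2 (mehler_P b A B)) as CP by (apply cont2_mult; auto).
  apply (green _ _ (mehler_D b A B)); auto.
  - intros t z. unfold mehler_P, mehler_D. eapply cder_eq; [apply cder_scal, cder_mult; [apply cder_mehler_time|apply cder_mehler_space_t]|].
    rewrite RtoC_opp. ring.
  - intros t z. unfold mehler_Q, mehler_D.
    eapply cder_eq; [apply cder_mult; [apply cder_scal, cder_mehler_space_z|apply cder_minus;
      [apply cder_mult; [apply cder_pcf_R|apply cder_RtoC]|apply cder_dpcf_R]]|].
    + instantiate (1 := - (th t / 2)). eapply is_derive_ext; [|eapply is_derive_eq; [apply is_derive_Rmult;
       [apply (is_derive_id z)|apply (is_derive_const (V := R_NormedModule) (- (th t / 2)))]|]].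
      * intros s; simpl; field.
      * unfold one, zero; simpl; ring.
    + replace (RtoC (- (th t / 2))) with (- (RtoC (th t) / RtoC 2))%C by (rewrite RtoC_opp, RtoC_div by lra; ring).
      replace (RtoC (- (z * th t / 2))) with (- (RtoC z * RtoC (th t) / RtoC 2))%C by (rewrite RtoC_opp, RtoC_div, RtoC_mult by lra; ring).
      replace (RtoC ((1 - th t ^ 2) / 4)) with ((1 - RtoC (th t) * RtoC (th t)) / (RtoC 2 * RtoC 2))%C.
      2:{ rewrite <- !RtoC_mult, <- RtoC_minus, <- RtoC_div by lra. f_equal; field. }
      rewrite (RtoC_mult z z). replace (RtoC 4) with (RtoC 2 * RtoC 2)%C by (rewrite <- RtoC_mult; f_equal; ring).
      field.
  - apply cont2_mult; auto. apply cont2_minus; auto. apply cont2_mult; auto.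
    intros s t. eapply (climit_ext _ (fun p => RtoC (snd p) * (RtoC (th (fst p)) * RtoC (- / 2)))%C).
    + intros [u v]; cbn [fst snd]; rewrite <- !RtoC_mult; f_equal; field.
    + replace (RtoC (- (t * th s / 2))) with (RtoC t * (RtoC (th s) * RtoC (- / 2)))%C by (rewrite <- !RtoC_mult; f_equal; field).
      apply (cont2_mult (fun _ t => RtoC t) (fun s t => RtoC (th s) * RtoC (- / 2))%C); auto.
      apply (cont2_mult (fun s t => RtoC (th s))); auto. apply cont2_const.
  - apply cont2_mult; auto. apply cont2_minus; [apply cont2_minus; [apply cont2_const|]|].
    + apply (cont2_mult (fun s t => RtoC (th s))); auto. apply cont2_const.
    + apply (cont2_mult (fun s t => RtoC (t * t)) (fun s t => RtoC ((1 - th s ^ 2) / 4))).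
      * apply (cont2_Rmult (fun _ t => t) (fun _ t => t)); auto.
      * intros s t. eapply (climit_ext _ (fun p => (1 - RtoC (th (fst p)) * RtoC (th (fst p))) * RtoC (/ 4))%C).
        -- intros [u v]; cbn [fst snd]; rewrite <- RtoC_mult, <- RtoC_minus, <- RtoC_mult; f_equal; field.
        -- replace (RtoC ((1 - th s ^ 2) / 4)) with ((1 - RtoC (th s) * RtoC (th s)) * RtoC (/ 4))%C
             by (rewrite <- RtoC_mult, <- RtoC_minus, <- RtoC_mult; f_equal; field).
           assert (cont2 (fun s _ => 1 - RtoC (th s) * RtoC (th s))%C) as C6.
           { apply (cont2_minus (fun _ _ => RtoC 1) (fun s _ => RtoC (th s) * RtoC (th s))%C); [apply cont2_const|].
             apply (cont2_mult (fun s t => RtoC (th s))); auto. }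
           apply (cont2_mult _ _ C6 (cont2_const (RtoC (/ 4)))).
Qed.

(** Green's identity on a growing rectangle. The side t = 0 carries the integral of the solution,
    since g(0, .) = 1; the side z = 0 carries -B times the integral of [mehler_time], since z = 0
    kills g_z; the two far sides vanish in the limit. Re b = 0 makes |e^{-bt}| equal to 1. *)
Lemma J_value (b A B K0 : C) (K K' : R) : Re b = 0 ->
  bounded_rhp (pcf_series (b / RtoC 2 + RtoC (1/4)) A B) K ->
  bounded_rhp (pcf_series (b / RtoC 2 + RtoC (1/4) + RtoC (1/2)) B (2 * (b / RtoC 2 + RtoC (1/4)) * A)) K' ->
  is_improper (mehler_time b) K0 -> is_improper (fun s => pcf b A B (RtoC s)) (- B * K0)%C.
Proof.
  intros Hb HK HK' HK0.
  assert (0 <= K) as HKp by (eapply Rle_trans; [apply Cmod_ge_0|apply (HK 0); simpl; lra]).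
  assert (0 <= K') as HKp' by (eapply Rle_trans; [apply Cmod_ge_0|apply (HK' 0); simpl; lra]).
  pose proof (Rbar_locally_filter p_infty) as FF.
  assert (forall t z, mehler_space t z = cexp (RtoC (- (z * z * th t / 4)))) as EE2.
  { intros; unfold mehler_space; rewrite <- RtoC_mult; do 2 f_equal; field. }
  assert (forall z, mehler_space 0 z = 1%C) as E20.
  { intros z; rewrite EE2. replace (th 0) with 0 by (unfold th; rewrite sinh_0; field; apply Rgt_not_eq, cosh_pos).
    replace (- (z * z * 0 / 4)) with 0 by field. apply cexp_0. }
  assert (forall t, mehler_space t 0 = 1%C) as E2z.
  { intros z; rewrite EE2. replace (- (0 * 0 * th z / 4)) with 0 by field. apply cexp_0. }
  assert (mehler_time b 0 = 1%C) as E10.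
  { unfold mehler_time, cosh_npow. rewrite cosh_0, ln_1, Rmult_0_r, Ropp_0, exp_0, Cmult_0_r, cexp_0. ring. }
  assert (forall t, mehler_Q b A B t 0 = - B * mehler_time b t)%C as Q0.
  { intros t; unfold mehler_Q. rewrite E2z, pcf_0, dpcf_0. replace (- (0 * th t / 2)) with 0 by field. ring. }
  assert (forall t, 0 <= t -> cosh_npow (1/2) t <= 1) as Hch1 by (intros; apply cosh_npow_le_1; lra).
  assert (forall S, ccont (fun t => mehler_Q b A B t S)) as CQ.
  { intros S. unfold mehler_Q. apply ccont_mult; [apply ccont_mult; [apply ccont_mehler_time|apply (cont2_ccont_l _ S cont2_mehler_space)]|].
    apply ccont_minus; [|apply ccont_const]. apply ccont_mult; [apply ccont_const|].
    apply (ccont_ext (fun t => RtoC (- (S / 2)) * RtoC (th t))%C); [intros; rewrite <- RtoC_mult; f_equal; field|].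
    apply ccont_mult; [apply ccont_const|apply ccont_th]. }
  assert (forall S T, cRInt (fun z => pcf b A B (RtoC z)) 0 S =
    cRInt (fun z => mehler_P b A B T z) 0 S - cRInt (fun t => mehler_Q b A B t S) 0 T + (- B) * cRInt (mehler_time b) 0 T)%C as Id.
  { intros S T. pose proof (green_PQ b A B S T) as H.
    rewrite cRInt_minus in H; auto.
    rewrite (cRInt_ext (fun t => mehler_Q b A B t 0) _ 0 T Q0), cRInt_scal in H by apply ccont_mehler_time.
    rewrite (cRInt_ext (fun z => mehler_P b A B 0 z) (fun z => pcf b A B (RtoC z))) in H.
    2:{ intros z; unfold mehler_P. rewrite E20, E10; ring. }
    set (X := cRInt (fun z => mehler_P b A B T z) 0 S) in *.
    replace (cRInt (fun z => pcf b A B (RtoC z)) 0 S) with (X - (X - cRInt (fun z => pcf b A B (RtoC z)) 0 S))%C by ring.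
    rewrite H; ring. }
  unfold is_improper.
  (* The rectangle is taken to be the square [0, S] x [0, S], so a single limit suffices. *)
  eapply (climit_ext _ (fun S => cRInt (fun z => mehler_P b A B S z) 0 S - cRInt (fun t => mehler_Q b A B t S) 0 S + (- B) * cRInt (mehler_time b) 0 S)%C).
  { intros S; symmetry; apply Id. }
  replace (- B * K0)%C with (0 - 0 + - B * K0)%C by ring.
  apply climit_plus; try apply FF; [apply climit_minus; try apply FF|apply climit_scal; [apply FF|apply HK0]].
  (* Side t = S: here (cosh S)^(-1/2) supplies the decay e^{-S/2}, and the solution is merely
     bounded. *)
  - apply (climit_squeeze _ _ _ (fun S => K * exp (1/2 * ln 2) * (S ^ 2 * exp (- (S / 2))))).
    2:{ apply lim_sqr_exp. apply Rmult_le_pos; auto; left; apply exp_pos. }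
    exists 1; intros S HS.
    replace (cRInt (fun z => mehler_P b A B S z) 0 S - 0)%C with (cRInt (fun z => mehler_P b A B S z) 0 S) by ring.
    apply Rle_trans with ((S - 0) * (K * (exp (1/2 * ln 2) * exp (- (1/2 * S))))).
    + apply cRInt_bound_const; [lra| |].
      * unfold mehler_P. apply ccont_mult; [apply ccont_pcf_R|]. apply ccont_mult; [apply ccont_const|].
        apply (cont2_ccont_r _ S cont2_mehler_space).
      * intros z Hz. unfold mehler_P. rewrite !Cmod_mult, Cmod_mehler_time; auto.
        apply Rmult_le_compat; try apply Cmod_ge_0.
        -- apply Rmult_le_pos; [left; apply exp_pos|apply Cmod_ge_0].
        -- eapply Rle_trans; [apply (pcf_bound _ _ _ K); auto; lra|].
           rewrite <- (Rmult_1_r K) at 2. apply Rmult_le_compat_l; auto.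
           rewrite <- exp_0. apply exp_le. pose proof (pow2_ge_0 z); lra.
        -- rewrite <- (Rmult_1_r (exp (1/2 * ln 2) * _)). apply Rmult_le_compat; try apply Cmod_ge_0.
           ++ left; apply exp_pos.
           ++ apply cosh_npow_le_exp; lra.
           ++ apply Cmod_mehler_space; lra.
    + replace (1 / 2 * S) with (S / 2) by field.
      set (e := exp (- (S / 2))). assert (0 < e) by apply exp_pos.
      set (e' := exp (1/2 * ln 2)). assert (0 < e') by apply exp_pos.
      assert (0 <= K * e' * e) by (apply Rmult_le_pos; [apply Rmult_le_pos; lra|lra]).
      replace ((S - 0) * (K * (e' * e))) with (K * e' * e * S) by ring.
      replace (K * e' * (S ^ 2 * e)) with (K * e' * e * (S * S)) by ring.
      apply Rmult_le_compat_l; auto; nra.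
  (* Side z = S: here the solution and its derivative decay like a Gaussian, while g is at most 1 in
     modulus. *)
  - apply (climit_squeeze _ _ _ (fun S => (K * exp 1 + (K' + K) * exp 1) * (S ^ 2 * exp (- (S / 2))))).
    2:{ apply lim_sqr_exp. pose proof (exp_pos 1). nra. }
    exists 1; intros S HS.
    replace (cRInt (fun t => mehler_Q b A B t S) 0 S - 0)%C with (cRInt (fun t => mehler_Q b A B t S) 0 S) by ring.
    apply Rle_trans with ((S - 0) * ((K * S + (K' + K) * S) * (exp 1 * exp (- S)))).
    + apply cRInt_bound_const; [lra|auto|].
      intros t Ht. unfold mehler_Q. rewrite !Cmod_mult, Cmod_mehler_time by auto.
      set (X := (pcf b A B (RtoC S) * RtoC (- (S * th t / 2)) - dpcf b A B (RtoC S))%C).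
      apply Rle_trans with (1 * Cmod X).
      * apply Rmult_le_compat_r; [apply Cmod_ge_0|].
        apply Rle_trans with (1 * 1); [|lra]. apply Rmult_le_compat; try apply Cmod_ge_0; [left; apply exp_pos|apply Hch1; lra|apply Cmod_mehler_space; lra].
      * rewrite Rmult_1_l. unfold X. eapply Rle_trans; [apply Cmod_triangle|].
        rewrite Cmod_opp, Cmod_mult, Cmod_R, Rabs_Ropp.
        assert (Rabs (S * th t / 2) <= S) as h1.
        { unfold Rdiv. rewrite !Rabs_mult, (Rabs_right S), (Rabs_right (/ 2)) by lra.
          pose proof (Rmult_le_compat_l S _ _ ltac:(lra) (th_bound t)). lra. }
        pose proof (pcf_bound b A B K S HK ltac:(lra)) as h2.
        pose proof (dpcf_bound b A B K K' S HK HK' ltac:(lra)) as h3.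
        pose proof (exp_sqr_bound S) as h4. set (e := exp (- (S ^ 2 / 4))) in *. set (f := exp 1 * exp (- S)) in *.
        assert (0 < e) as he by apply exp_pos.
        assert (Cmod (pcf b A B (RtoC S)) * Rabs (S * th t / 2) <= K * f * S) as h5.
        { apply Rmult_le_compat; auto; try apply Cmod_ge_0; try apply Rabs_pos.
          eapply Rle_trans; [apply h2|]. apply Rmult_le_compat_l; auto. }
        assert (Cmod (dpcf b A B (RtoC S)) <= (K' + K) * S * f) as h6.
        { eapply Rle_trans; [apply h3|]. apply Rmult_le_compat; auto; nra. }
        nra.
    + assert (exp (- S) <= exp (- (S / 2))) as h1 by (apply exp_le; lra).
      pose proof (exp_pos (- S)). pose proof (exp_pos 1).
      replace ((S - 0) * ((K * S + (K' + K) * S) * (exp 1 * exp (- S)))) with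
        ((K * exp 1 + (K' + K) * exp 1) * (S ^ 2 * exp (- S))) by ring.
      apply Rmult_le_compat_l; [nra|]. apply Rmult_le_compat_l; auto. nra.
Qed.

(** * Moments of the Gamma kernel *)

(* With t = e^y, moment s = int_0^oo t^(2s-1) e^{-t^2/2} dt = 2^(s-1) Gamma(s). *)
Definition gamma_kernel (s : C) (y : R) : C := cexp (RtoC 2 * s * RtoC y - RtoC (exp (2 * y) / 2)).
Definition real_kernel (sg y : R) : R := exp (2 * sg * y - exp (2 * y) / 2).
Definition trunc_moment (s : C) (T : R) : C := cRInt (gamma_kernel s) (- T) T.

Lemma Cmod_gamma_kernel (s : C) (y : R) : Cmod (gamma_kernel s y) = real_kernel (Re s) y.
Proof.
  unfold gamma_kernel, real_kernel. rewrite Cmod_cexp. f_equal. unfold Re; simpl; ring.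
Qed.

Lemma gamma_kernel_RtoC (x y : R) : gamma_kernel (RtoC x) y = RtoC (real_kernel x y).
Proof.
  unfold gamma_kernel, real_kernel. rewrite <- !RtoC_mult, <- RtoC_minus, cexp_RtoC. reflexivity.
Qed.

Lemma gamma_kernel_add (s u : C) (y : R) : gamma_kernel (s + u) y = (gamma_kernel s y * cexp (RtoC 2 * u * RtoC y))%C.
Proof. unfold gamma_kernel. rewrite <- cexp_add. f_equal; ring. Qed.

Lemma cder_gamma_kernel (s : C) (y : R) : cder (gamma_kernel s) y (RtoC 2 * s * gamma_kernel s y - gamma_kernel (s + 1) y)%C.
Proof.
  eapply cder_eq; [unfold gamma_kernel; apply cder_cexp, cder_minus; [apply cder_mult; [apply cder_const|apply cder_id]|apply cder_RtoC]|].
  - instantiate (1 := exp (2 * y)). auto_derive; auto. field.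
  - cbv beta. rewrite gamma_kernel_add. fold (gamma_kernel s y).
    replace (RtoC 2 * 1 * RtoC y)%C with (RtoC (2 * y)) by (rewrite RtoC_mult; ring). rewrite cexp_RtoC. ring.
Qed.

Lemma ccont_gamma_kernel (s : C) : ccont (gamma_kernel s).
Proof. apply (cder_ccont _ _ (cder_gamma_kernel s)). Qed.

Lemma real_kernel_pos_bound (sg y : R) : 0 <= y -> real_kernel sg y <= exp ((2 * sg + 1) ^ 2 / 4) * exp (- (1 * y)).
Proof.
  intros Hy. unfold real_kernel. rewrite <- exp_plus. apply exp_le.
  (* The doubly exponential term is traded for y^2, after which the claim is that the square of y -
     (2 sg + 1)/2 is nonnegative. *)
  assert (y ^ 2 <= exp (2 * y) / 2) as H.
  { assert ((1 + y) ^ 2 <= exp (2 * y)) as h.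
    { replace (2 * y) with (y + y) by ring. rewrite exp_plus.
      assert (1 + y <= exp y) by (destruct (Req_dec y 0) as [->|h]; [rewrite exp_0; lra|left; apply exp_ineq1; auto]).
      simpl. rewrite Rmult_1_r. apply Rmult_le_compat; lra. }
    destruct (Rle_dec y 2) as [h2|h2].
    - simpl in *; nra.
    - assert (exp (2 * y) = exp y * exp y) as Ee by (rewrite <- exp_plus; f_equal; ring).
      assert (exp y = exp (y/2) * exp (y/2)) as Ee2 by (rewrite <- exp_plus; f_equal; field).
      assert (1 + y / 2 <= exp (y / 2)) by (left; apply exp_ineq1; lra).
      assert (2 * y <= exp y) by nra. rewrite Ee. simpl; nra. }
  pose proof (pow2_ge_0 (y - (2 * sg + 1) / 2)). lra.
Qed.

Lemma real_kernel_neg_bound (sg y : R) : real_kernel sg (- y) <= 1 * exp (- (2 * sg * y)).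
Proof.
  unfold real_kernel. rewrite Rmult_1_l. apply exp_le. pose proof (exp_pos (2 * - y)). lra.
Qed.

Lemma RInt_reflect (f : R -> R) (T : R) : (forall t, continuous f t) ->
  RInt f (- T) 0 = RInt (fun y => f (- y)) 0 T.
Proof.
  intros Hf. symmetry; apply is_RInt_unique.
  assert (is_RInt f (- T) (- 0) (RInt f (- T) 0)) as H.
  { rewrite Ropp_0. apply (RInt_correct (V := R_CompleteNormedModule)).
    apply (ex_RInt_continuous (V := R_CompleteNormedModule)); auto. }
  apply (is_RInt_comp_opp (V := R_NormedModule)), (is_RInt_swap (V := R_NormedModule)),
    (is_RInt_opp (V := R_NormedModule)) in H.
  eapply is_RInt_ext; [|rewrite <- (opp_opp (RInt f (- T) 0)); apply H].
  intros x _; simpl. apply opp_opp.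
Qed.

Lemma trunc_moment_split (s : C) (T : R) :
  trunc_moment s T = (cRInt (gamma_kernel s) 0 T + cRInt (fun y => gamma_kernel s (- y)) 0 T)%C.
Proof.
  unfold trunc_moment. rewrite (cRInt_Chasles _ (- T) 0 T) by apply ccont_gamma_kernel. rewrite Cplus_comm. f_equal.
  unfold cRInt. f_equal.
  - apply (RInt_reflect (fun y => Re (gamma_kernel s y))). intros t; apply (ccont_gamma_kernel s t).
  - apply (RInt_reflect (fun y => Im (gamma_kernel s y))). intros t; apply (ccont_gamma_kernel s t).
Qed.

Lemma ccont_reflect (f : R -> C) : ccont f -> ccont (fun y => f (- y)).
Proof.
  intros H t. destruct (H (- t)) as [h1 h2].
  assert (continuous Ropp t) as h by (apply (ex_derive_continuous (V := R_NormedModule)); auto_derive; auto).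
  split; [apply (continuous_comp Ropp (fun s => Re (f s)))|apply (continuous_comp Ropp (fun s => Im (f s)))]; auto.
Qed.

Definition moment (s : C) : C :=
  (real (Lim (fun T => Re (trunc_moment s T)) p_infty), real (Lim (fun T => Im (trunc_moment s T)) p_infty)).

Lemma climit_infty_eq (u : R -> C) (l : C) : climit (Rbar_locally p_infty) u l ->
  (real (Lim (fun T => Re (u T)) p_infty), real (Lim (fun T => Im (u T)) p_infty)) = l.
Proof.
  intros H. destruct l as [x y].
  rewrite (is_lim_unique _ _ (Finite x)), (is_lim_unique _ _ (Finite y)); auto.
  - apply (climit_Im _ _ _ H).
  - apply (climit_Re _ _ _ H).
Qed.

Lemma moment_lim (s : C) : 0 < Re s -> climit (Rbar_locally p_infty) (trunc_moment s) (moment s).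
Proof.
  intros Hs.
  destruct (ex_improper (gamma_kernel s) (exp ((2 * Re s + 1) ^ 2 / 4)) 1) as [l1 H1]; [lra|apply ccont_gamma_kernel| |].
  { intros t Ht. rewrite Cmod_gamma_kernel. apply real_kernel_pos_bound; auto. }
  destruct (ex_improper (fun y => gamma_kernel s (- y)) 1 (2 * Re s)) as [l2 H2]; [lra|apply ccont_reflect, ccont_gamma_kernel| |].
  { intros t Ht. rewrite Cmod_gamma_kernel. apply real_kernel_neg_bound; auto. }
  pose proof (Rbar_locally_filter p_infty) as FF.
  assert (climit (Rbar_locally p_infty) (trunc_moment s) (l1 + l2)%C) as H.
  { eapply (climit_ext _ (fun T => cRInt (gamma_kernel s) 0 T + cRInt (fun y => gamma_kernel s (- y)) 0 T)%C).
    - intros T; symmetry; apply trunc_moment_split.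
    - apply climit_plus; try apply FF; auto. }
  unfold moment. rewrite (climit_infty_eq _ _ H). auto.
Qed.

Lemma moment_eq (s l : C) : climit (Rbar_locally p_infty) (trunc_moment s) l -> moment s = l.
Proof. apply climit_infty_eq. Qed.

Lemma lim_exp_neg (K c : R) : 0 < c -> 0 <= K ->
  filterlim (fun T => K * exp (- (c * T))) (Rbar_locally p_infty) (locally 0).
Proof.
  intros Hc HK. apply (filterlim_squeeze0 _ _ (fun T => (K / c) / T)); [|apply lim_inv_infty].
  exists 0. intros T HT. split; [apply Rmult_le_pos; auto; left; apply exp_pos|].
  unfold Rdiv; rewrite Rmult_assoc. apply Rmult_le_compat_l; auto.
  rewrite <- Rinv_mult, exp_Ropp. apply Rinv_le_contravar; [nra|].
  left. apply Rlt_trans with (1 + c * T); [lra|]. apply exp_ineq1. nra.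
Qed.

Lemma climit_gamma_kernel_infty (s : C) : climit (Rbar_locally p_infty) (gamma_kernel s) 0.
Proof.
  apply (climit_squeeze _ _ _ (fun T => exp ((2 * Re s + 1) ^ 2 / 4) * exp (- (1 * T)))).
  - exists 0; intros T HT. replace (gamma_kernel s T - 0)%C with (gamma_kernel s T) by ring.
    rewrite Cmod_gamma_kernel. apply real_kernel_pos_bound; lra.
  - apply lim_exp_neg; [lra|left; apply exp_pos].
Qed.

Lemma climit_gamma_kernel_minfty (s : C) : 0 < Re s -> climit (Rbar_locally p_infty) (fun T => gamma_kernel s (- T)) 0.
Proof.
  intros Hs. apply (climit_squeeze _ _ _ (fun T => 1 * exp (- ((2 * Re s) * T)))).
  - exists 0; intros T HT. replace (gamma_kernel s (- T) - 0)%C with (gamma_kernel s (- T)) by ring.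
    rewrite Cmod_gamma_kernel. apply real_kernel_neg_bound; lra.
  - apply lim_exp_neg; lra.
Qed.

(** The functional equation of Gamma: [cder_gamma_kernel] is integrated over [-T, T]. The boundary
    term at the left end vanishes because Re s > 0. *)
Lemma moment_rec (s : C) : 0 < Re s -> moment (s + 1) = (RtoC 2 * s * moment s)%C.
Proof.
  intros Hs. pose proof (Rbar_locally_filter p_infty) as FF.
  apply moment_eq.
  eapply (climit_ext _ (fun T => RtoC 2 * s * trunc_moment s T - (gamma_kernel s T - gamma_kernel s (- T)))%C).
  - intros T. unfold trunc_moment.
    rewrite <- (cRInt_FTC (gamma_kernel s) (fun y => RtoC 2 * s * gamma_kernel s y - gamma_kernel (s + 1) y)%C).
    + rewrite cRInt_minus; [|apply ccont_mult; [apply ccont_const|apply ccont_gamma_kernel]|apply ccont_gamma_kernel].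
      rewrite cRInt_scal by apply ccont_gamma_kernel. ring.
    + intros; apply cder_gamma_kernel.
    + apply ccont_minus; [apply ccont_mult; [apply ccont_const|]|]; apply ccont_gamma_kernel.
  - replace (RtoC 2 * s * moment s)%C with (RtoC 2 * s * moment s - (0 - 0))%C by ring.
    apply climit_minus; try apply FF.
    + apply climit_scal; [apply FF|]. apply moment_lim; auto.
    + apply climit_minus; try apply FF; [apply climit_gamma_kernel_infty|apply climit_gamma_kernel_minfty; auto].
Qed.

(** [gamma_kernel 0] is a primitive of [- gamma_kernel 1] and tends to 1 at minus infinity and to 0
    at plus infinity. *)
Lemma moment_1 : moment 1 = 1%C.
Proof.
  pose proof (Rbar_locally_filter p_infty) as FF.
  assert (forall y, cder (gamma_kernel 0) y (- gamma_kernel 1 y)%C) as D.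
  { intros y. eapply cder_eq; [apply cder_gamma_kernel|]. rewrite Cplus_0_l. ring. }
  apply moment_eq.
  eapply (climit_ext _ (fun T => gamma_kernel 0 (- T) - gamma_kernel 0 T)%C).
  - intros T. unfold trunc_moment.
    replace (gamma_kernel 0 (- T) - gamma_kernel 0 T)%C with (- (gamma_kernel 0 T - gamma_kernel 0 (- T)))%C by ring.
    rewrite <- (cRInt_FTC (gamma_kernel 0) (fun y => - gamma_kernel 1 y)%C) by (auto; apply ccont_opp, ccont_gamma_kernel).
    rewrite cRInt_opp by apply ccont_gamma_kernel. ring.
  - replace (RtoC 1) with (RtoC 1 - 0)%C by ring. apply climit_minus; try apply FF; [|apply climit_gamma_kernel_infty].
    apply (climit_squeeze _ _ _ (fun T => 1/2 * exp (- (2 * T)))); [|apply lim_exp_neg; lra].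
    exists 0; intros T HT. rewrite gamma_kernel_RtoC, <- RtoC_minus, Cmod_R. unfold real_kernel.
    replace (2 * 0 * - T - exp (2 * - T) / 2) with (- (1/2 * exp (- (2 * T)))) by (replace (2 * - T) with (- (2 * T)) by ring; field).
    set (x := 1/2 * exp (- (2 * T))).
    assert (0 < x) as Hx by (unfold x; pose proof (exp_pos (- (2 * T))); lra).
    assert (exp (- x) <= 1) by (rewrite <- exp_0; apply exp_le; lra).
    assert (1 + - x <= exp (- x)) by (left; apply exp_ineq1; lra).
    apply Rabs_le; lra.
Qed.

Lemma moment_nat (n : nat) : moment (RtoC (INR n) + 1) = RtoC (2 ^ n * INR (fact n)).
Proof.
  induction n.
  - simpl. rewrite Cplus_0_l, moment_1. f_equal; ring.
  - rewrite INR_Sk, moment_rec, IHn.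
    + rewrite fact_simpl, mult_INR, S_INR. cbn [pow]. rewrite !RtoC_mult, RtoC_plus. ring.
    + rewrite re_plus, !re_RtoC. pose proof (pos_INR n); lra.
Qed.

Lemma moment_poch (s : C) (n : nat) : 0 < Re s ->
  moment (s + RtoC (INR n)) = (RtoC (2 ^ n) * cpoch s n * moment s)%C.
Proof.
  intros Hs. induction n.
  - simpl. rewrite Cplus_0_r. ring.
  - rewrite INR_Sk, Cplus_assoc, moment_rec, IHn.
    + cbn [cpoch pow]. rewrite RtoC_mult. ring.
    + rewrite re_plus, re_RtoC. pose proof (pos_INR n); lra.
Qed.

Definition real_trunc_moment (x T : R) : R := RInt (real_kernel x) (- T) T.
Definition real_moment (x : R) : R := Re (moment (RtoC x)).

Lemma continuous_real_kernel (x y : R) : continuous (real_kernel x) y.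
Proof. unfold real_kernel; apply (ex_derive_continuous (V := R_NormedModule)); auto_derive; auto. Qed.

Lemma ex_RInt_real_kernel (x a b : R) : ex_RInt (real_kernel x) a b.
Proof. apply (ex_RInt_continuous (V := R_CompleteNormedModule)); intros; apply continuous_real_kernel. Qed.

Lemma trunc_moment_RtoC (x T : R) : trunc_moment (RtoC x) T = RtoC (real_trunc_moment x T).
Proof.
  unfold trunc_moment, real_trunc_moment. rewrite (cRInt_ext _ (fun y => RtoC (real_kernel x y))) by (intros; apply gamma_kernel_RtoC).
  apply cRInt_RtoC.
Qed.

Lemma real_trunc_moment_lim (x : R) : 0 < x -> filterlim (real_trunc_moment x) (Rbar_locally p_infty) (locally (real_moment x)).
Proof.
  intros Hx. eapply filterlim_ext; [|apply (climit_Re _ _ _ (moment_lim (RtoC x) Hx))].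
  intros T; cbv beta. rewrite trunc_moment_RtoC; reflexivity.
Qed.

Lemma moment_RtoC (x : R) : 0 < x -> moment (RtoC x) = RtoC (real_moment x).
Proof.
  intros Hx. apply moment_eq. apply (climit_ext _ (fun T => RtoC (real_trunc_moment x T))).
  - intros; symmetry; apply trunc_moment_RtoC.
  - apply climit_RtoC; [apply Rbar_locally_filter|]. apply real_trunc_moment_lim; auto.
Qed.

Lemma real_trunc_moment_mono (x S T : R) : 0 <= S <= T -> real_trunc_moment x S <= real_trunc_moment x T.
Proof.
  intros H. unfold real_trunc_moment.
  rewrite <- (RInt_Chasles (V := R_CompleteNormedModule) (real_kernel x) (- T) (- S) T) by apply ex_RInt_real_kernel.
  rewrite <- (RInt_Chasles (V := R_CompleteNormedModule) (real_kernel x) (- S) S T) by apply ex_RInt_real_kernel.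
  unfold plus; simpl.
  assert (0 <= RInt (real_kernel x) (- T) (- S)) by (apply RInt_pos; [lra|apply ex_RInt_real_kernel|intros; left; apply exp_pos]).
  assert (0 <= RInt (real_kernel x) S T) by (apply RInt_pos; [lra|apply ex_RInt_real_kernel|intros; left; apply exp_pos]).
  lra.
Qed.

Lemma real_trunc_moment_le_real_moment (x T : R) : 0 < x -> 0 <= T -> real_trunc_moment x T <= real_moment x.
Proof.
  intros Hx HT. apply Rnot_lt_le; intros Hlt.
  pose proof (real_trunc_moment_lim x Hx) as H.
  assert (0 < real_trunc_moment x T - real_moment x) as Hp by lra.
  destruct (proj1 (filterlim_locally _ _) H (mkposreal _ Hp)) as [B HB].
  specialize (HB (Rmax T (B + 1)) ltac:(pose proof (Rmax_r T (B + 1)); lra)).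
  unfold ball in HB; simpl in HB; unfold AbsRing_ball, abs, minus, plus, opp in HB; simpl in HB.
  apply Rabs_lt_between in HB.
  pose proof (real_trunc_moment_mono x T (Rmax T (B + 1)) ltac:(pose proof (Rmax_l T (B + 1)); lra)). lra.
Qed.

(** Integrating p e^{pv} bounds the left side by |p|/sg times |e^{sg u} - 1| with sg = Re p. Since 0
    < sg <= 1, the power can be replaced by e^u, of which the Gamma law has simple moments. *)
Lemma cexp_pow_bound (p : C) (u : R) : 0 < Re p <= 1 ->
  Cmod (cexp (p * RtoC u) - 1) <= Cmod p / Re p * Rabs (exp u - 1).
Proof.
  intros Hp. set (sg := Re p) in *.
  assert (forall v, cder (fun v => cexp (p * RtoC v)) v (cexp (p * RtoC v) * p)%C) as D.
  { intros v. eapply cder_eq; [apply cder_cexp, cder_scal, cder_id|]. cbv beta; ring. }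
  assert (ccont (fun v => cexp (p * RtoC v) * p)%C) as Cc.
  { apply ccont_mult; [|apply ccont_const]. apply (cder_ccont _ _ D). }
  assert (forall a b, a <= b -> Cmod (cexp (p * RtoC b) - cexp (p * RtoC a)) <= Cmod p / sg * (exp (sg * b) - exp (sg * a))) as H.
  { intros a b Hab. rewrite <- (cRInt_FTC _ _ a b D Cc).
    assert (is_RInt (fun v => Cmod p * exp (sg * v)) a b (Cmod p / sg * (exp (sg * b) - exp (sg * a)))) as I.
    { replace (Cmod p / sg * (exp (sg * b) - exp (sg * a))) with
        (minus (Cmod p / sg * exp (sg * b)) (Cmod p / sg * exp (sg * a))) by (unfold minus, plus, opp; simpl; ring).
      apply (is_RInt_derive (V := R_CompleteNormedModule) (fun v => Cmod p / sg * exp (sg * v))).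
      - intros x _. auto_derive; auto. field. lra.
      - intros x _. apply (ex_derive_continuous (V := R_NormedModule)); auto_derive; auto. }
    rewrite <- (is_RInt_unique _ _ _ _ I).
    apply cRInt_bound; auto; [|eexists; apply I].
    intros x _. rewrite Cmod_mult, Cmod_cexp, re_scal_r. fold sg. lra. }
  assert (0 <= Cmod p / sg) as Hc by (apply Rdiv_le_0_compat; [apply Cmod_ge_0|lra]).
  destruct (Rle_dec 0 u) as [Hu|Hu].
  - specialize (H 0 u Hu). rewrite Cmult_0_r, cexp_0 in H. eapply Rle_trans; [apply H|].
    apply Rmult_le_compat_l; auto. rewrite Rmult_0_r, exp_0, Rabs_right.
    + assert (exp (sg * u) <= exp u) by (apply exp_le; nra). lra.
    + assert (exp 0 <= exp u) by (apply exp_le; lra). rewrite exp_0 in H0; lra.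
  - specialize (H u 0 ltac:(lra)). rewrite Cmult_0_r, cexp_0 in H.
    replace (cexp (p * RtoC u) - 1)%C with (- (1 - cexp (p * RtoC u)))%C by ring. rewrite Cmod_opp.
    eapply Rle_trans; [apply H|].
    apply Rmult_le_compat_l; auto. rewrite Rmult_0_r, exp_0, Rabs_left1.
    + assert (exp u <= exp (sg * u)) by (apply exp_le; nra). lra.
    + assert (exp u <= exp 0) by (apply exp_le; lra). rewrite exp_0 in H0; lra.
Qed.

(** Replaces an absolute deviation by a squared one, so that second moments control it; [d] is
    chosen later. *)
Lemma abs_le_amgm (a d : R) : 0 < d -> Rabs a <= d + a ^ 2 / d.
Proof.
  intros Hd. rewrite <- (pow2_abs a). set (x := Rabs a). pose proof (Rabs_pos a) as Hx; fold x in Hx.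
  apply Rmult_le_reg_r with d; auto. replace ((d + x ^ 2 / d) * d) with (d * d + x ^ 2) by (field; lra).
  pose proof (pow2_ge_0 (x - d)). nra.
Qed.

(** * The Gauss limit for the reciprocal Gamma function *)

Lemma Re_half (b : C) : Re (b / RtoC 2) = Re b / 2.
Proof. unfold Cdiv. rewrite <- RtoC_inv, re_scal_r by lra. field. Qed.

Lemma Cmod_cpow_pos (b : R) (s : C) : Cmod (cpow_pos b s) = exp (Re s * ln b).
Proof. unfold cpow_pos. rewrite Cmod_cexp, re_scal_r. auto. Qed.

Lemma cpow_pos_neq_0 (b : R) (s : C) : cpow_pos b s <> 0%C.
Proof. apply cexp_neq_0. Qed.

Lemma cpow_pos_mult (x y : R) (s : C) : 0 < x -> 0 < y -> cpow_pos (x * y) s = (cpow_pos x s * cpow_pos y s)%C.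
Proof.
  intros; unfold cpow_pos. rewrite ln_mult, RtoC_plus, <- cexp_add by auto. f_equal; ring.
Qed.

Lemma cpow_pos_add (x : R) (s u : C) : cpow_pos x (s + u) = (cpow_pos x s * cpow_pos x u)%C.
Proof. unfold cpow_pos. rewrite <- cexp_add. f_equal; ring. Qed.

Lemma cpow_pos_conj (b : R) (s : C) : cpow_pos b (Cconj s) = Cconj (cpow_pos b s).
Proof. unfold cpow_pos. rewrite <- cexp_conj, Cmult_conj, RtoC_conj. auto. Qed.

Lemma real_kernel_add (x z y : R) : real_kernel (x + z) y = real_kernel x y * exp (2 * z * y).
Proof. unfold real_kernel. rewrite <- exp_plus. f_equal; ring. Qed.

(* The variable x = e^{2y}/(2n) has mean close to 1 and variance O(1/n) under the Gamma law of
   parameter n + 1, while |x^p - 1| <= C |x - 1| <= C (d + (x - 1)^2 / d). *)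
Lemma trunc_moment_conc (p : C) (n : nat) (d T : R) : 0 < Re p <= 1 -> (1 <= n)%nat -> 0 < d -> 0 <= T ->
  let N := 2 * INR n in let K := exp (Re p * ln N) * (Cmod p / Re p) in
  Cmod (trunc_moment (RtoC (INR n + 1) + p) T - cpow_pos N p * trunc_moment (RtoC (INR n + 1)) T) <=
  K * (d + / d) * real_trunc_moment (INR n + 1) T + K * (- 2 / (N * d)) * real_trunc_moment (INR n + 2) T + K * (/ (N * N * d)) * real_trunc_moment (INR n + 3) T.
Proof.
  intros Hp Hn Hd HT N K.
  assert (0 < N) as HN by (unfold N; apply le_INR in Hn; simpl in Hn; lra).
  set (x := INR n + 1).
  unfold trunc_moment. rewrite <- cRInt_scal by apply ccont_gamma_kernel.
  rewrite <- cRInt_minus; [|apply ccont_gamma_kernel|apply ccont_mult; [apply ccont_const|apply ccont_gamma_kernel]].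
  set (g := fun y => plus (plus (scal (K * (d + / d)) (real_kernel x y)) (scal (K * (- 2 / (N * d))) (real_kernel (INR n + 2) y)))
     (scal (K * (/ (N * N * d))) (real_kernel (INR n + 3) y))).
  assert (is_RInt g (- T) T (plus (plus (scal (K * (d + / d)) (real_trunc_moment x T)) (scal (K * (- 2 / (N * d))) (real_trunc_moment (INR n + 2) T)))
     (scal (K * (/ (N * N * d))) (real_trunc_moment (INR n + 3) T)))) as I.
  { unfold g. apply (is_RInt_plus (V := R_NormedModule)); [apply (is_RInt_plus (V := R_NormedModule))|];
    apply (is_RInt_scal (V := R_NormedModule)), (RInt_correct (V := R_CompleteNormedModule)), ex_RInt_real_kernel. }
  change (_ + _ + _) with (plus (plus (scal (K * (d + / d)) (real_trunc_moment x T)) (scal (K * (- 2 / (N * d))) (real_trunc_moment (INR n + 2) T)))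
     (scal (K * (/ (N * N * d))) (real_trunc_moment (INR n + 3) T))).
  rewrite <- (is_RInt_unique _ _ _ _ I).
  apply cRInt_bound; [lra| | |eexists; apply I].
  { apply ccont_minus; [|apply ccont_mult; [apply ccont_const|]]; apply ccont_gamma_kernel. }
  intros y _. rewrite gamma_kernel_add.
  set (u := 2 * y - ln N).
  replace (cexp (RtoC 2 * p * RtoC y)) with (cpow_pos N p * cexp (p * RtoC u))%C.
  2:{ unfold cpow_pos. rewrite <- cexp_add. f_equal. unfold u. rewrite RtoC_minus, RtoC_mult. ring. }
  replace (gamma_kernel (RtoC x) y * (cpow_pos N p * cexp (p * RtoC u)) - cpow_pos N p * gamma_kernel (RtoC x) y)%C with
    (cpow_pos N p * (gamma_kernel (RtoC x) y * (cexp (p * RtoC u) - 1)))%C by ring.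
  rewrite !Cmod_mult, Cmod_cpow_pos, Cmod_gamma_kernel, re_RtoC.
  assert (0 < real_kernel x y) as Hk by apply exp_pos.
  assert (0 < exp (Re p * ln N)) as He by apply exp_pos.
  assert (0 <= Cmod p / Re p) as Hc by (apply Rdiv_le_0_compat; [apply Cmod_ge_0|lra]).
  apply Rle_trans with (exp (Re p * ln N) * (real_kernel x y * (Cmod p / Re p * (d + (exp u - 1) ^ 2 / d)))).
  - apply Rmult_le_compat_l; [lra|]. apply Rmult_le_compat_l; [lra|].
    eapply Rle_trans; [apply cexp_pow_bound; auto|]. apply Rmult_le_compat_l; auto. apply abs_le_amgm; auto.
  - right. unfold g, plus, scal; simpl; unfold mult; simpl.
    replace (INR n + 2) with (x + 1) by (unfold x; ring). replace (INR n + 3) with (x + 1 + 1) by (unfold x; ring).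
    rewrite !real_kernel_add. replace (exp (2 * 1 * y)) with (N * exp u).
    2:{ unfold u, Rminus. rewrite exp_plus, exp_Ropp, exp_ln by auto. rewrite Rmult_1_r. field; lra. }
    unfold K. field. repeat split; lra.
Qed.

Lemma real_moment_nat1 (n : nat) : real_moment (INR n + 1) = 2 ^ n * INR (fact n).
Proof. unfold real_moment. rewrite RtoC_plus, moment_nat, re_RtoC. auto. Qed.

(** As T tends to infinity the three real moments become m, 2(n+1) m and 4(n+1)(n+2) m; the squared
    deviation is then 1 - 2(n+1)/n + (n+1)(n+2)/n^2 = (n+2)/n^2. *)
Lemma moment_conc (p : C) (n : nat) (d : R) : 0 < Re p <= 1 -> (1 <= n)%nat -> 0 < d ->
  let N := 2 * INR n in let K := exp (Re p * ln N) * (Cmod p / Re p) in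
  let m := 2 ^ n * INR (fact n) in
  Cmod (moment (RtoC (INR n + 1) + p) - cpow_pos N p * RtoC m) <= K * m * (d + (INR n + 2) / (INR n * INR n * d)).
Proof.
  intros Hp Hn Hd N K m. pose proof (Rbar_locally_filter p_infty) as FF.
  assert (1 <= INR n) as Hn1 by (apply le_INR in Hn; simpl in Hn; lra).
  pose proof (trunc_moment_conc p n d) as H.
  assert (filterlim (fun T => K * (d + / d) * real_trunc_moment (INR n + 1) T + K * (- 2 / (N * d)) * real_trunc_moment (INR n + 2) T + K * (/ (N * N * d)) * real_trunc_moment (INR n + 3) T)
    (Rbar_locally p_infty) (locally (K * (d + / d) * real_moment (INR n + 1) + K * (- 2 / (N * d)) * real_moment (INR n + 2) + K * (/ (N * N * d)) * real_moment (INR n + 3)))) as L.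
  { apply filterlim_RtoC_inv; [apply FF|].
    rewrite !RtoC_plus, !(RtoC_mult (K * _)).
    eapply (climit_ext _ (fun T => RtoC (K * (d + / d)) * RtoC (real_trunc_moment (INR n + 1) T) + RtoC (K * (- 2 / (N * d))) * RtoC (real_trunc_moment (INR n + 2) T)
       + RtoC (K * (/ (N * N * d))) * RtoC (real_trunc_moment (INR n + 3) T))%C).
    { intros T; rewrite !RtoC_plus, !(RtoC_mult (K * _)); auto. }
    apply climit_plus; try apply FF; [apply climit_plus; try apply FF|];
    (apply climit_scal; [apply FF|]; apply climit_RtoC; [apply FF|]; apply real_trunc_moment_lim; lra). }
  assert (filterlim (fun T => Cmod (trunc_moment (RtoC (INR n + 1) + p) T - cpow_pos N p * trunc_moment (RtoC (INR n + 1)) T)) (Rbar_locally p_infty)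
    (locally (Cmod (moment (RtoC (INR n + 1) + p) - cpow_pos N p * RtoC m)))) as L2.
  { apply climit_Cmod; [apply FF|]. apply climit_minus; try apply FF.
    - apply moment_lim. rewrite re_plus, re_RtoC; lra.
    - apply climit_scal; [apply FF|]. unfold m. rewrite <- moment_nat, <- RtoC_plus. apply moment_lim. rewrite re_RtoC; lra. }
  apply Rle_trans with (K * (d + / d) * real_moment (INR n + 1) + K * (- 2 / (N * d)) * real_moment (INR n + 2) + K * (/ (N * N * d)) * real_moment (INR n + 3)).
  - apply (filterlim_le (F := Rbar_locally p_infty) _ _ (Finite _) (Finite _)) with (2 := L2) (3 := L).
    exists 0; intros T HT. apply H; auto; lra.
  - right.
    replace (INR n + 2) with (INR (S n) + 1) at 1 by (rewrite S_INR; ring).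
    replace (INR n + 3) with (INR (S (S n)) + 1) by (rewrite !S_INR; ring).
    rewrite !real_moment_nat1, !fact_simpl, !mult_INR, !S_INR. cbn [pow]. unfold m, N.
    field. split; lra.
Qed.

Lemma lim_inv_sqrt (c : R) : filterlim (fun n => c / sqrt (INR n)) eventually (locally 0).
Proof.
  apply (filterlim_comp _ _ _ (fun n => sqrt (INR n)) (fun S => c / S) _ (Rbar_locally p_infty)); [|apply lim_inv_infty].
  intros Q [M HM]. destruct (INR_unbounded (Rabs M * Rabs M + 1)) as [N HN].
  exists N; intros n Hn. apply HM. apply le_INR in Hn.
  apply Rle_lt_trans with (Rabs M); [apply Rle_abs|].
  rewrite <- (sqrt_square (Rabs M)) by apply Rabs_pos. apply sqrt_lt_1_alt.
  pose proof (Rabs_pos M). split; nra.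
Qed.

Definition rgamma_seq (p : C) (n : nat) : C := (cpoch p (S n) / (RtoC (INR (fact n)) * cpow_pos (INR n) p))%C.

Lemma rgamma_eq (p l : C) : climit eventually (rgamma_seq p) l -> rgamma p = l.
Proof. apply climseq_eq. Qed.

(** By [moment_poch] the expression is the moment at n + 1 + p divided by (2n)^p times the moment at
    n + 1, and concentration makes this ratio tend to 1. *)
Lemma rgamma_seq_moment_lim (p : C) : 0 < Re p <= 1 ->
  climit eventually (fun n => RtoC 2 * moment p * rgamma_seq p n / cpow_pos 2 p)%C 1.
Proof.
  intros Hp. set (c := Cmod p / Re p).
  assert (0 <= c) as Hc by (apply Rdiv_le_0_compat; [apply Cmod_ge_0|lra]).
  apply (climit_squeeze _ _ _ (fun n => (4 * c) / sqrt (INR n))); [|apply lim_inv_sqrt].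
  exists 1%nat. intros n Hn.
  assert (1 <= INR n) as Hn1 by (apply le_INR in Hn; simpl in Hn; lra).
  assert (1 <= sqrt (INR n)) as Hs by (rewrite <- sqrt_1; apply sqrt_le_1_alt; auto).
  assert (sqrt (INR n) * sqrt (INR n) = INR n) as Hss by (apply sqrt_sqrt; lra).
  set (r := sqrt (INR n)) in *.
  (* With d = 1/sqrt n the mean and the variance term are both O(1/sqrt n), with sum at most 4/sqrt
     n. *)
  pose proof (moment_conc p n (/ r) Hp Hn ltac:(apply Rinv_0_lt_compat; lra)) as H. cbv zeta in H.
  set (m := 2 ^ n * INR (fact n)) in *.
  assert (0 < m) as Hm by (apply Rmult_lt_0_compat; [apply pow_lt; lra|apply lt_0_INR, lt_O_fact]).
  replace (RtoC (INR n + 1) + p)%C with (p + RtoC (INR (S n)))%C in H by (rewrite INR_Sk, RtoC_plus; ring).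
  rewrite moment_poch in H by lra.
  assert (RtoC (INR (fact n)) <> 0%C) as hf by (apply RtoC_neq_0, not_0_INR, fact_neq_0).
  pose proof (cpow_pos_neq_0 (INR n) p) as hp. pose proof (cpow_pos_neq_0 2 p) as hp2.
  replace (RtoC 2 * moment p * rgamma_seq p n / cpow_pos 2 p - 1)%C with
    ((RtoC (2 ^ S n) * cpoch p (S n) * moment p - cpow_pos (2 * INR n) p * RtoC m) / (cpow_pos (2 * INR n) p * RtoC m))%C.
  2:{ unfold rgamma_seq, m. rewrite cpow_pos_mult by lra. cbn [pow]. rewrite !RtoC_mult.
      assert (RtoC (2 ^ n) <> 0%C) as hq by (apply RtoC_neq_0, pow_nonzero; lra).
      field. repeat split; auto. }
  assert (cpow_pos (2 * INR n) p * RtoC m <> 0)%C as hnz.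
  { apply Cmult_neq_0; [apply cpow_pos_neq_0|apply RtoC_neq_0; lra]. }
  rewrite Cmod_div by auto. rewrite (Cmod_mult (cpow_pos _ _)), Cmod_cpow_pos, Cmod_R, (Rabs_right m) by lra.
  set (E := exp (Re p * ln (2 * INR n))) in *. assert (0 < E) as HE by apply exp_pos.
  apply Rmult_le_reg_r with (E * m); [nra|].
  unfold Rdiv at 1. rewrite Rmult_assoc, Rinv_l, Rmult_1_r by nra.
  eapply Rle_trans; [apply H|].
  replace (4 * c / r * (E * m)) with (E * c * m * (4 / r)) by (field; lra).
  fold c. apply Rmult_le_compat_l; [apply Rmult_le_pos; [apply Rmult_le_pos|]; lra|].
  rewrite <- Hss. apply Rmult_le_reg_r with (r ^ 3); [apply pow_lt; lra|].
  replace ((/ r + (r * r + 2) / (r * r * (r * r) * / r)) * r ^ 3) with (2 * (r * r) + 2) by (field; lra).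
  replace (4 / r * r ^ 3) with (4 * (r * r)) by (field; lra). nra.
Qed.

(** A zero moment would make the constant sequence 0 converge to 1. *)
Lemma moment_neq_0 (p : C) : 0 < Re p <= 1 -> moment p <> 0%C.
Proof.
  intros Hp E. pose proof (rgamma_seq_moment_lim p Hp) as H.
  assert (RtoC 0 = RtoC 1) as F; [|injection F; lra].
  apply (climit_unique eventually (fun _ => RtoC 0)); [apply climit_const, eventually_filter|].
  eapply climit_ext; [apply eventually_filter| |apply H]. intros n; cbv beta. rewrite E. unfold Cdiv; ring.
Qed.

Lemma rgamma_seq_lim (p : C) : 0 < Re p <= 1 -> climit eventually (rgamma_seq p) (rgamma p).
Proof.
  intros Hp. assert (climit eventually (rgamma_seq p) (cpow_pos 2 p / (RtoC 2 * moment p) * 1)%C) as H.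
  { eapply climit_ext; [apply eventually_filter| |apply climit_scal; [apply eventually_filter|apply (rgamma_seq_moment_lim p Hp)]].
    intros n; cbv beta. field. split; (apply cpow_pos_neq_0 || (apply moment_neq_0; auto)). }
  rewrite (rgamma_eq _ _ H); auto.
Qed.

Lemma rgamma_moment (p : C) : 0 < Re p <= 1 -> (rgamma p * moment p)%C = (cpow_pos 2 p / RtoC 2)%C.
Proof.
  intros Hp.
  assert (RtoC 2 * moment p * rgamma p / cpow_pos 2 p = 1)%C as H.
  { apply (climit_unique eventually (fun n => RtoC 2 * moment p * rgamma_seq p n / cpow_pos 2 p)%C); [|apply rgamma_seq_moment_lim; auto].
    apply climit_mult; try apply eventually_filter; [|apply climit_const, eventually_filter].
    apply climit_scal; [apply eventually_filter|]. apply rgamma_seq_lim; auto. }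
  replace (rgamma p * moment p)%C with ((RtoC 2 * moment p * rgamma p / cpow_pos 2 p) * cpow_pos 2 p / RtoC 2)%C.
  - rewrite H. unfold Cdiv; ring.
  - field. apply cpow_pos_neq_0.
Qed.

Lemma rgamma_neq_0 (p : C) : 0 < Re p <= 1 -> rgamma p <> 0%C.
Proof.
  intros Hp E. pose proof (rgamma_moment p Hp) as H. rewrite E, Cmult_0_l in H.
  apply (cpow_pos_neq_0 2 p). replace (cpow_pos 2 p) with (RtoC 2 * (cpow_pos 2 p / RtoC 2))%C by field.
  rewrite <- H. ring.
Qed.

(** * Taylor remainder of the exponential in the left half-plane *)

Definition exp_taylor (N : nat) (w : C) : C := cpsum (fun n => cpown w n / RtoC (INR (fact n)))%C N.

Lemma exp_taylor_0 (N : nat) : exp_taylor (S N) 0 = 1%C.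
Proof.
  unfold exp_taylor. induction N.
  - simpl. field.
  - rewrite cpsum_S, IHN. cbn [cpown]. unfold Cdiv; ring.
Qed.

Lemma cder_cpown (w : C) (n : nat) (t : R) :
  cder (fun s => cpown (RtoC s * w) (S n)) t (RtoC (INR (S n)) * (w * cpown (RtoC t * w) n))%C.
Proof.
  induction n.
  - eapply cder_ext; [|eapply cder_eq; [apply (cder_affine 0 w t)|]].
    + intros s; simpl; ring.
    + simpl; ring.
  - eapply cder_ext; [|eapply cder_eq; [apply (cder_mult _ _ _ _ _ (cder_affine 0 w t) IHn)|]].
    + intros s; cbn [cpown]. ring.
    + cbv beta. rewrite (INR_Sk (S n)). cbn [cpown]. ring.
Qed.

Lemma cder_exp_taylor (w : C) (N : nat) (t : R) :
  cder (fun s => exp_taylor (S N) (RtoC s * w)) t (w * exp_taylor N (RtoC t * w))%C.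
Proof.
  induction N.
  - unfold exp_taylor; simpl. eapply cder_eq; [apply cder_const|]. ring.
  - unfold exp_taylor. eapply cder_ext; [|eapply cder_eq; [apply (cder_plus _ _ _ _ _ IHN (cder_scal (/ RtoC (INR (fact (S N)))) _ _ _ (cder_cpown w N t)))|]].
    + intros s. unfold exp_taylor. rewrite (cpsum_S _ (S N)). unfold Cdiv; ring.
    + unfold exp_taylor. rewrite (cpsum_S _ N). rewrite fact_simpl, mult_INR, RtoC_mult.
      field. split; apply RtoC_neq_0, not_0_INR; [apply fact_neq_0|lia].
Qed.

(** Induction through e^w - T_(N+1)(w) = int_0^1 w (e^{sw} - T_N(sw)) ds; the segment from 0 to w
    stays in the half-plane Re <= 0, where |e^w| <= 1 starts the induction. *)
Lemma taylor_rem (N : nat) : forall w, Re w <= 0 ->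
  Cmod (cexp w - exp_taylor N w) <= Cmod w ^ N / INR (fact N).
Proof.
  induction N; intros w Hw.
  - unfold exp_taylor; simpl. replace (cexp w - 0)%C with (cexp w) by ring. rewrite Cmod_cexp.
    replace (1 / 1) with 1 by field. rewrite <- exp_0. apply exp_le; auto.
  - assert (forall t, cder (fun s => cexp (RtoC s * w) - exp_taylor (S N) (RtoC s * w))%C t (w * (cexp (RtoC t * w) - exp_taylor N (RtoC t * w)))%C) as D.
    { intros t. eapply cder_eq; [apply cder_minus; [apply cder_cexp, cder_mult; [apply cder_id|apply cder_const]|apply cder_exp_taylor]|].
      cbv beta. ring. }
    assert (ccont (fun t => w * (cexp (RtoC t * w) - exp_taylor N (RtoC t * w)))%C) as Cc.
    { assert (ccont (fun t => RtoC t * w)%C) as h by (apply ccont_mult; [apply ccont_RtoC_id|apply ccont_const]).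
      apply ccont_mult; [apply ccont_const|]. apply ccont_minus; [apply ccont_cexp; auto|].
      destruct N; [unfold exp_taylor; simpl; apply ccont_const|]. apply (cder_ccont _ _ (cder_exp_taylor w N)). }
    pose proof (cRInt_FTC _ _ 0 1 D Cc) as E. cbv beta in E.
    rewrite !Cmult_0_l, cexp_0, exp_taylor_0, !Cmult_1_l in E.
    replace (cexp w - exp_taylor (S N) w)%C with (cexp w - exp_taylor (S N) w - (1 - 1))%C by ring. rewrite <- E.
    set (A := Cmod w ^ S N / INR (fact N)).
    assert (0 < INR (fact N)) as hf by apply lt_0_INR, lt_O_fact.
    assert (is_RInt (fun s => A * s ^ N) 0 1 (Cmod w ^ S N / INR (fact (S N)))) as I.
    { replace (Cmod w ^ S N / INR (fact (S N))) with (minus (A / INR (S N) * 1 ^ S N) (A / INR (S N) * 0 ^ S N)).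
      2:{ unfold minus, plus, opp; simpl plus. rewrite pow1, pow_i by lia. unfold A. rewrite fact_simpl, mult_INR.
          change ((Cmod w ^ S N / INR (fact N)) / INR (S N) * 1 + - ((Cmod w ^ S N / INR (fact N)) / INR (S N) * 0) = Cmod w ^ S N / (INR (S N) * INR (fact N))).
          field. split; [lra|apply not_0_INR; lia]. }
      apply (is_RInt_derive (V := R_CompleteNormedModule) (fun s => A / INR (S N) * s ^ S N)).
      - intros x _. eapply is_derive_eq; [apply is_derive_Rmult; [apply (is_derive_const (V := R_NormedModule))|apply is_derive_pow, (is_derive_id x)]|].
        unfold zero, one; simpl pred. change (0 * x ^ S N + A / INR (S N) * (INR (S N) * 1 * x ^ N) = A * x ^ N).
        field. apply not_0_INR; lia.
      - intros x _. apply (ex_derive_continuous (V := R_NormedModule)); auto_derive; auto. }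
    rewrite <- (is_RInt_unique _ _ _ _ I). apply cRInt_bound; auto; [lra| |eexists; apply I].
    intros s Hs. rewrite Cmod_mult.
    specialize (IHN (RtoC s * w)%C). rewrite re_scal_l in IHN. specialize (IHN ltac:(nra)).
    rewrite Cmod_mult, Cmod_R, Rabs_right, Rpow_mult_distr in IHN by lra.
    unfold A. cbn [pow]. replace (Cmod w * Cmod w ^ N / INR (fact N) * s ^ N) with (Cmod w * (s ^ N * Cmod w ^ N / INR (fact N))) by (field; lra).
    apply Rmult_le_compat_l; auto. apply Cmod_ge_0.
Qed.

(** * Recessiveness of U(b, z) *)

Lemma cpown_mult (a b : C) (n : nat) : cpown (a * b) n = (cpown a n * cpown b n)%C.
Proof. induction n; simpl; [ring|]. rewrite IHn; ring. Qed.

Lemma cpown_exp (y : R) (n : nat) : cpown (RtoC (exp y)) n = cexp (RtoC 2 * RtoC (INR n / 2) * RtoC y).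
Proof.
  induction n.
  - simpl. replace (0 / 2) with 0 by field. rewrite Cmult_0_r, Cmult_0_l, cexp_0. auto.
  - cbn [cpown]. rewrite IHn, <- (cexp_RtoC y), <- cexp_add. f_equal.
    rewrite S_INR. replace ((INR n + 1) / 2) with (INR n / 2 + / 2) by field. rewrite RtoC_plus, RtoC_inv by lra. field.
Qed.

Lemma RtoC_half_S (n : nat) : RtoC (INR (S n) / 2) = (RtoC (INR n / 2) + RtoC (1/2))%C.
Proof. rewrite <- RtoC_plus, S_INR; f_equal; field. Qed.

(** These are the Taylor coefficients of int_0^oo t^(2q-1) e^{-t^2/2 - zt} dt at z = 0; the two-step
    recurrence is [moment_rec]. *)
Lemma pcf_coeff_moment (q : C) (n : nat) : 0 < Re q ->
  pcf_coeff q (moment q) (- moment (q + RtoC (1/2))) n = (cpown (- (1)) n / RtoC (INR (fact n)) * moment (q + RtoC (INR n / 2)))%C.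
Proof.
  intros Hq. symmetry.
  apply (pcf_coeff_eq q _ _ (fun n => cpown (- (1)) n / RtoC (INR (fact n)) * moment (q + RtoC (INR n / 2)))%C).
  - simpl. replace (0 / 2) with 0 by field. rewrite Cplus_0_r. field.
  - simpl. field.
  - intros m. rewrite !RtoC_half_S.
    replace (q + (RtoC (INR m / 2) + RtoC (1 / 2) + RtoC (1 / 2)))%C with (q + RtoC (INR m / 2) + 1)%C.
    2:{ replace (RtoC 1) with (RtoC (1/2) + RtoC (1/2))%C by (rewrite <- RtoC_plus; f_equal; field). ring. }
    rewrite moment_rec.
    2:{ rewrite re_plus, re_RtoC. pose proof (pos_INR m); lra. }
    rewrite !fact_simpl, !mult_INR, !RtoC_mult. cbn [cpown].
    rewrite RtoC_div by lra.
    field. repeat split; apply RtoC_neq_0, not_0_INR; try lia; apply fact_neq_0.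
Qed.

(** Continuity is proved along with the identity because each induction step splits the integral of
    a sum. *)
Lemma cpsum_trunc_moment (q z : C) (T : R) (N : nat) :
  cpsum (fun n => cpown (- (1)) n / RtoC (INR (fact n)) * trunc_moment (q + RtoC (INR n / 2)) T * cpown z n)%C N
  = cRInt (fun y => gamma_kernel q y * exp_taylor N (- z * RtoC (exp y)))%C (- T) T
  /\ ccont (fun y => gamma_kernel q y * exp_taylor N (- z * RtoC (exp y)))%C.
Proof.
  induction N as [|N [IH1 IH2]].
  - unfold exp_taylor; simpl. split.
    + rewrite (cRInt_ext _ (fun _ => RtoC 0)) by (intros; ring).
      rewrite (cRInt_RtoC (fun _ => 0)), (RInt_const (V := R_CompleteNormedModule)). unfold scal; simpl; unfold mult; simpl. f_equal; ring.
    + apply ccont_mult; [apply ccont_gamma_kernel|apply ccont_const].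
  - assert (forall y, gamma_kernel q y * exp_taylor (S N) (- z * RtoC (exp y)) = gamma_kernel q y * exp_taylor N (- z * RtoC (exp y)) +
      cpown (- (1)) N / RtoC (INR (fact N)) * cpown z N * gamma_kernel (q + RtoC (INR N / 2)) y)%C as E.
    { intros y. unfold exp_taylor. rewrite cpsum_S, gamma_kernel_add, <- cpown_exp.
      replace (- z * RtoC (exp y))%C with (- (1) * z * RtoC (exp y))%C by ring.
      rewrite !cpown_mult. field. apply RtoC_neq_0, not_0_INR, fact_neq_0. }
    assert (ccont (fun y => cpown (- (1)) N / RtoC (INR (fact N)) * cpown z N * gamma_kernel (q + RtoC (INR N / 2)) y)%C) as C1.
    { apply ccont_mult; [apply ccont_const|apply ccont_gamma_kernel]. }
    split.
    + rewrite cpsum_S, IH1. rewrite (cRInt_ext _ _ (- T) T E), cRInt_plus, cRInt_scal; auto; [|apply ccont_gamma_kernel].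
      f_equal. unfold trunc_moment. ring.
    + eapply ccont_ext; [intros y; symmetry; apply E|]. apply ccont_plus; auto.
Qed.

(* The partial sums are integrals of Taylor polynomials of e^{-zt}, whose remainder is at most
   |zt|^N / N! for Re z >= 0, so no limit is exchanged with an improper integral. *)
Lemma H_bounded (q : C) : 0 < Re q -> bounded_rhp (pcf_series q (moment q) (- moment (q + RtoC (1/2)))) (real_moment (Re q)).
Proof.
  intros Hq z Hz. set (sg := Re q) in *.
  pose proof (Rbar_locally_filter p_infty) as FF.
  set (e := fun N => Cmod z ^ N / INR (fact N) * real_moment (sg + INR N / 2)).
  assert (forall N, Cmod (cpsum (fun n => pcf_coeff q (moment q) (- moment (q + RtoC (1/2))) n * cpown z n)%C N) <= real_moment sg + e N) as HN.
  { intros N.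
    apply (climit_bound (Rbar_locally p_infty) (fun T =>
      cpsum (fun n => cpown (- (1)) n / RtoC (INR (fact n)) * trunc_moment (q + RtoC (INR n / 2)) T * cpown z n)%C N)).
    - induction N; [simpl; apply climit_const; apply FF|].
      simpl cpsum. apply climit_plus; try apply FF; auto.
      apply climit_mult; try apply FF; [|apply climit_const; apply FF].
      rewrite pcf_coeff_moment by auto. apply climit_scal; [apply FF|]. apply moment_lim.
      rewrite re_plus, re_RtoC. pose proof (pos_INR N). fold sg; lra.
    - exists 0; intros T HT. destruct (cpsum_trunc_moment q z T N) as [-> C1].
      assert (0 <= INR N / 2) as hN by (pose proof (pos_INR N); lra).
      assert (0 < INR (fact N)) as hf by apply lt_0_INR, lt_O_fact.
      apply Rle_trans with (real_trunc_moment sg T + Cmod z ^ N / INR (fact N) * real_trunc_moment (sg + INR N / 2) T).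
      + set (c := Cmod z ^ N / INR (fact N)).
        assert (is_RInt (fun y => plus (real_kernel sg y) (scal c (real_kernel (sg + INR N / 2) y))) (- T) T
          (plus (real_trunc_moment sg T) (scal c (real_trunc_moment (sg + INR N / 2) T)))) as I.
        { apply (is_RInt_plus (V := R_NormedModule)); [|apply (is_RInt_scal (V := R_NormedModule))];
          apply (RInt_correct (V := R_CompleteNormedModule)), ex_RInt_real_kernel. }
        change (real_trunc_moment sg T + c * real_trunc_moment (sg + INR N / 2) T) with (plus (real_trunc_moment sg T) (scal c (real_trunc_moment (sg + INR N / 2) T))).
        rewrite <- (is_RInt_unique _ _ _ _ I). apply cRInt_bound; auto; [lra| |eexists; apply I].
        intros y _. rewrite Cmod_mult, Cmod_gamma_kernel. fold sg. rewrite real_kernel_add.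
        change (real_kernel sg y * Cmod (exp_taylor N (- z * RtoC (exp y))) <= real_kernel sg y + c * (real_kernel sg y * exp (2 * (INR N / 2) * y))).
        assert (0 < real_kernel sg y) as hk by apply exp_pos.
        replace (real_kernel sg y + c * (real_kernel sg y * exp (2 * (INR N / 2) * y))) with (real_kernel sg y * (1 + c * exp (2 * (INR N / 2) * y))) by ring.
        apply Rmult_le_compat_l; [lra|].
        set (w := (- z * RtoC (exp y))%C).
        assert (Re w <= 0) as hw.
        { unfold w. rewrite re_scal_r, re_opp. pose proof (exp_pos y); nra. }
        replace (exp_taylor N w) with (cexp w - (cexp w - exp_taylor N w))%C by ring.
        eapply Rle_trans; [apply Cmod_triangle|]. rewrite Cmod_opp, Cmod_cexp.
        apply Rplus_le_compat; [rewrite <- exp_0; apply exp_le; auto|].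
        eapply Rle_trans; [apply taylor_rem; auto|]. right. unfold c, w.
        rewrite Cmod_mult, Cmod_opp, Rpow_mult_distr, <- (Cmod_cpown (RtoC (exp y))), cpown_exp.
        rewrite <- !RtoC_mult, cexp_RtoC, Cmod_R, Rabs_right by (left; apply exp_pos). field. lra.
      + unfold e. apply Rplus_le_compat; [apply real_trunc_moment_le_real_moment; lra|].
        apply Rmult_le_compat_l; [|apply real_trunc_moment_le_real_moment; lra].
        apply Rdiv_le_0_compat; auto. apply pow_le, Cmod_ge_0. }
  (* The error e_N is the modulus of the N-th term of the same kind of series at the real parameter
     [sg] and radius |z|; that series is entire, so its terms tend to 0. *)
  assert (filterlim e eventually (locally 0)) as He.
  { destruct (entire_pcf_coeff (RtoC sg) (moment (RtoC sg)) (- moment (RtoC sg + RtoC (1/2))) (2 * (Cmod z + 1))) as [M HM].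
    { pose proof (Cmod_ge_0 z); lra. }
    apply (filterlim_squeeze0 _ _ (fun n => M * (/ 2) ^ n)).
    - apply filter_forall. intros n.
      assert (0 < INR (fact n)) as hf by apply lt_0_INR, lt_O_fact.
      assert (0 <= INR n / 2) as hN by (pose proof (pos_INR n); lra).
      assert (e n = Cmod (pcf_coeff (RtoC sg) (moment (RtoC sg)) (- moment (RtoC sg + RtoC (1/2))) n) * Cmod z ^ n) as cos_osc_int.
      { rewrite pcf_coeff_moment by (rewrite re_RtoC; auto). rewrite <- RtoC_plus, moment_RtoC by lra.
        unfold Cdiv. rewrite !Cmod_mult, Cmod_inv by (apply RtoC_neq_0; lra). rewrite Cmod_cpown, Cmod_opp, Cmod_1, pow1, !Cmod_R.
        rewrite (Rabs_right (INR (fact n))) by lra.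
        rewrite Rabs_right.
        - unfold e. field. lra.
        - apply Rle_ge. eapply Rle_trans; [|apply (real_trunc_moment_le_real_moment _ 0); lra]. unfold real_trunc_moment. apply RInt_pos; [lra|apply ex_RInt_real_kernel|].
          intros; left; apply exp_pos. }
      rewrite cos_osc_int. split; [apply Rmult_le_pos; [apply Cmod_ge_0|apply pow_le, Cmod_ge_0]|].
      apply Rle_trans with (Cmod (pcf_coeff (RtoC sg) (moment (RtoC sg)) (- moment (RtoC sg + RtoC (1/2))) n) * (Cmod z + 1) ^ n).
      + apply Rmult_le_compat_l; [apply Cmod_ge_0|]. apply pow_incr; pose proof (Cmod_ge_0 z); lra.
      + rewrite pow_half_split. apply Rmult_le_compat_r; auto. apply pow_le; lra.
    - replace 0 with (M * 0) by ring. apply (is_lim_seq_scal_l (fun n => (/ 2) ^ n) M 0).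
      apply is_lim_seq_geom. rewrite Rabs_right; lra. }
  pose proof (climit_Cmod _ _ _ (power_series_cv _ z (entire_pcf_coeff q (moment q) (- moment (q + RtoC (1/2)))))) as L.
  apply (fun h1 h2 => filterlim_le (F := eventually) _ (fun N => real_moment sg + e N) (Finite _) (Finite (real_moment sg)) h1 L h2).
  - apply filter_forall; auto.
  - assert (is_lim_seq (fun N => real_moment sg + e N) (real_moment sg + 0)) as h.
    { apply (is_lim_seq_plus' (fun _ => real_moment sg) e (real_moment sg) 0); auto. apply is_lim_seq_const. }
    rewrite Rplus_0_r in h. apply h.
Qed.

(* U(b, z) = pcf_norm b * e^{-z^2/4} * sum_n (-z)^n / n! * moment (p + n/2) with p = b/2 + 1/4. *)
Definition pcf_norm (b : C) : C :=
  (RtoC (sqrt PI) * rgamma (b / RtoC 2 + RtoC (1/4)) * rgamma (b / RtoC 2 + RtoC (1/4) + RtoC (1/2))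
    * RtoC 2 / (cpow_pos 2 (b / RtoC 2 + RtoC (1/4)) * cpow_pos 2 (b / RtoC 2 + RtoC (1/4))))%C.

Lemma U_at_0_pcf_norm (b : C) : Re b = 0 -> U_at_0 b = (pcf_norm b * moment (b / RtoC 2 + RtoC (1/4)))%C.
Proof.
  intros Hb. unfold U_at_0, pcf_norm. set (p := (b / RtoC 2 + RtoC (1/4))%C).
  assert (Re p = 1/4) as Hp by (unfold p; rewrite re_plus, Re_half, Hb, re_RtoC; field).
  pose proof (rgamma_moment p ltac:(lra)) as H.
  replace (RtoC (3/4) + b / RtoC 2)%C with (p + RtoC (1/2))%C.
  2:{ unfold p. replace (RtoC (3/4)) with (RtoC (1/4) + RtoC (1/2))%C by (rewrite <- RtoC_plus; f_equal; field). ring. }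
  pose proof (cpow_pos_neq_0 2 p) as h2.
  transitivity (RtoC (sqrt PI) * rgamma (p + RtoC (1/2)) * RtoC 2 / (cpow_pos 2 p * cpow_pos 2 p) * (rgamma p * moment p))%C.
  - rewrite H. field. auto.
  - field. auto.
Qed.

Lemma dU_at_0_pcf_norm (b : C) : Re b = 0 -> dU_at_0 b = (- (pcf_norm b * moment (b / RtoC 2 + RtoC (1/4) + RtoC (1/2))))%C.
Proof.
  intros Hb. unfold dU_at_0, pcf_norm. set (p := (b / RtoC 2 + RtoC (1/4))%C).
  assert (Re p = 1/4) as Hp by (unfold p; rewrite re_plus, Re_half, Hb, re_RtoC; field).
  assert (Re (p + RtoC (1/2)) = 3/4) as Hp2 by (rewrite re_plus, Hp, re_RtoC; field).
  pose proof (rgamma_moment (p + RtoC (1/2)) ltac:(lra)) as H.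
  replace (RtoC (1/4) + b / RtoC 2)%C with p by (unfold p; ring).
  replace p with (b / RtoC 2 - RtoC (1/4) + RtoC (1/2))%C at 4 5.
  2:{ unfold p. replace (RtoC (1/2)) with (RtoC (1/4) + RtoC (1/4))%C by (rewrite <- RtoC_plus; f_equal; field). ring. }
  pose proof (cpow_pos_neq_0 2 (b / RtoC 2 - RtoC (1/4))) as h2.
  pose proof (cpow_pos_neq_0 2 (RtoC (1/2))) as h3.
  assert (cpow_pos 2 (p + RtoC (1/2)) = cpow_pos 2 (b / RtoC 2 - RtoC (1/4)) * cpow_pos 2 (RtoC (1/2)) * cpow_pos 2 (RtoC (1/2)))%C as E.
  { rewrite <- !cpow_pos_add. f_equal. unfold p.
    replace (RtoC (1/2)) with (RtoC (1/4) + RtoC (1/4))%C by (rewrite <- RtoC_plus; f_equal; field). ring. }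
  rewrite !(cpow_pos_add 2 (b / RtoC 2 - RtoC (1/4))).
  set (X := cpow_pos 2 (b / RtoC 2 - RtoC (1/4))) in *. set (Y := cpow_pos 2 (RtoC (1/2))) in *.
  f_equal.
  transitivity (RtoC (sqrt PI) * rgamma p * RtoC 2 / (X * Y * (X * Y)) * (rgamma (p + RtoC (1/2)) * moment (p + RtoC (1/2))))%C.
  - rewrite H, E. field. auto.
  - field. auto.
Qed.

Lemma pcf_series_scal (p c A B z : C) : pcf_series p (c * A) (c * B) z = (c * pcf_series p A B z)%C.
Proof. rewrite pcf_series_lin, (pcf_series_lin p A B). ring. Qed.

Lemma bounded_scal (f g : C -> C) (c : C) (K : R) : (forall z, f z = c * g z)%C -> bounded_rhp g K ->
  bounded_rhp f (Cmod c * K).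
Proof.
  intros E H z Hz. rewrite E, Cmod_mult. apply Rmult_le_compat_l; auto. apply Cmod_ge_0.
Qed.

(** Differentiating the Laplace-type integral raises its parameter by 1/2 and changes the sign, so
    [H_bounded] also covers the derived series, with the norm factor negated. *)
Lemma U_bounded (b : C) : Re b = 0 -> exists K K',
  bounded_rhp (pcf_series (b / RtoC 2 + RtoC (1/4)) (U_at_0 b) (dU_at_0 b)) K /\
  bounded_rhp (pcf_series (b / RtoC 2 + RtoC (1/4) + RtoC (1/2)) (dU_at_0 b) (2 * (b / RtoC 2 + RtoC (1/4)) * U_at_0 b)) K'.
Proof.
  intros Hb. rewrite (U_at_0_pcf_norm b Hb), (dU_at_0_pcf_norm b Hb). set (p := (b / RtoC 2 + RtoC (1/4))%C).
  assert (Re p = 1/4) as Hp by (unfold p; rewrite re_plus, Re_half, Hb, re_RtoC; field).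
  assert (Re (p + RtoC (1/2)) = 3/4) as Hp2 by (rewrite re_plus, Hp, re_RtoC; field).
  do 2 eexists; split.
  - eapply (bounded_scal _ _ (pcf_norm b)); [|apply (H_bounded p); lra].
    intros z. rewrite <- pcf_series_scal. f_equal; ring.
  - eapply (bounded_scal _ _ (- pcf_norm b)%C); [|apply (H_bounded (p + RtoC (1/2))); lra].
    intros z. rewrite <- pcf_series_scal. f_equal; [ring|].
    replace (p + RtoC (1/2) + RtoC (1/2))%C with (p + 1)%C.
    2:{ replace (RtoC 1) with (RtoC (1/2) + RtoC (1/2))%C by (rewrite <- RtoC_plus; f_equal; field). ring. }
    rewrite moment_rec by lra. ring.
Qed.

(** * The hypergeometric series *)

Definition half_one_minus_th (t : R) : R := (1 - th t) / 2.

Lemma half_one_minus_th_bound (t : R) : 0 <= t -> 0 <= half_one_minus_th t <= 1/2.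
Proof.
  intros Ht. unfold half_one_minus_th. pose proof (th_bound t) as H. apply Rabs_le_between in H.
  assert (0 <= th t); [|lra].
  unfold th. apply Rdiv_le_0_compat; [|apply cosh_pos].
  unfold sinh. assert (exp (- t) <= exp t) by (apply exp_le; lra). lra.
Qed.

Lemma is_derive_half_one_minus_th (t : R) : is_derive half_one_minus_th t (- (2 * half_one_minus_th t * (1 - half_one_minus_th t))).
Proof.
  unfold half_one_minus_th. eapply is_derive_ext; [|eapply is_derive_eq; [apply is_derive_Rmult; [|apply (is_derive_const (V := R_NormedModule) (/ 2))]|]].
  - intros s; simpl. reflexivity.
  - apply (is_derive_minus (V := R_NormedModule)); [apply (is_derive_const (V := R_NormedModule))|apply is_derive_th].
  - unfold minus, plus, opp, zero; simpl. field.
Qed.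

(* With x = (1 - tanh t)/2, the integrals K_n of e^{-bt} (cosh t)^{-1/2} x^n over t >= 0 satisfy
   (b + 2n + 1/2) K_n = 2^{-n} + (2n + 1) K_{n+1}; iterating from K_0 produces the
   hypergeometric series at 1/2. *)
Definition mehler_K (b : C) (n : nat) (t : R) : C := (mehler_time b t * RtoC (half_one_minus_th t ^ n))%C.

Lemma cder_mehler_K (b : C) (n : nat) (t : R) :
  cder (mehler_K b n) t (RtoC (2 * INR n + 1) * mehler_K b (S n) t - (b + RtoC (2 * INR n + 1/2)) * mehler_K b n t)%C.
Proof.
  unfold mehler_K. eapply cder_eq; [apply cder_mult; [apply cder_mehler_time|apply cder_RtoC, is_derive_pow, is_derive_half_one_minus_th]|].
  replace (RtoC (th t) / RtoC 2)%C with (RtoC (1/2) - RtoC (half_one_minus_th t))%C.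
  2:{ rewrite <- RtoC_div, <- RtoC_minus by lra. f_equal. unfold half_one_minus_th. field. }
  replace (INR n * - (2 * half_one_minus_th t * (1 - half_one_minus_th t)) * half_one_minus_th t ^ pred n) with (- (2 * INR n * (1 - half_one_minus_th t)) * half_one_minus_th t ^ n).
  2:{ destruct n; simpl pred; [simpl; ring|]. cbn [pow]. ring. }
  cbn [pow]. rewrite !RtoC_mult, RtoC_opp, !RtoC_plus, !RtoC_mult, RtoC_minus. ring.
Qed.

Lemma mehler_K_bound (b : C) (n : nat) (t : R) : Re b = 0 -> 0 <= t ->
  Cmod (mehler_K b n t) <= (/ 2) ^ n * exp (1/2 * ln 2) * exp (- (1/2 * t)).
Proof.
  intros Hb Ht. unfold mehler_K. rewrite Cmod_mult, Cmod_mehler_time, Cmod_R by auto.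
  pose proof (half_one_minus_th_bound t Ht) as Hx. rewrite Rabs_right by (apply Rle_ge, pow_le; lra).
  rewrite (Rmult_assoc _ (exp _)), Rmult_comm. apply Rmult_le_compat.
  - apply pow_le; lra.
  - left; apply exp_pos.
  - apply pow_incr; lra.
  - apply cosh_npow_le_exp; lra.
Qed.

Lemma ccont_mehler_K (b : C) (n : nat) : ccont (mehler_K b n).
Proof. apply (cder_ccont _ _ (cder_mehler_K b n)). Qed.

Lemma mehler_K_ex (b : C) (n : nat) : Re b = 0 -> exists l, is_improper (mehler_K b n) l /\ Cmod l <= 2 * exp (1/2 * ln 2) * (/ 2) ^ n.
Proof.
  intros Hb. set (M := (/ 2) ^ n * exp (1/2 * ln 2)).
  destruct (ex_improper (mehler_K b n) M (1/2)) as [l Hl]; [lra|apply ccont_mehler_K| |].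
  { intros t Ht. apply mehler_K_bound; auto. }
  exists l; split; auto. pose proof (Rbar_locally_filter p_infty) as FF.
  apply (climit_bound _ _ _ _ Hl). exists 0; intros T HT.
  apply Rle_trans with (RInt (fun t => M * exp (- (1/2 * t))) 0 T).
  - apply cRInt_bound; [lra|apply ccont_mehler_K| |].
    + intros x Hx. apply mehler_K_bound; auto; lra.
    + apply (ex_RInt_continuous (V := R_CompleteNormedModule)); intros.
      apply (ex_derive_continuous (V := R_NormedModule)); auto_derive; auto.
  - rewrite RInt_exp_decay by lra. pose proof (exp_pos (- (1/2 * T))).
    assert (0 <= M) by (apply Rmult_le_pos; [apply pow_le; lra|left; apply exp_pos]).
    replace (2 * exp (1/2 * ln 2) * (/ 2) ^ n) with (2 * M) by (unfold M; ring).
    replace (M / (1/2)) with (2 * M) by field. nra.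
Qed.

Lemma mehler_K_0 (b : C) (n : nat) : mehler_K b n 0 = RtoC ((/ 2) ^ n).
Proof.
  unfold mehler_K, mehler_time, cosh_npow, half_one_minus_th, th. rewrite sinh_0, cosh_0, ln_1, Rmult_0_r, Ropp_0, exp_0, Cmult_0_r, cexp_0.
  replace ((1 - 0 / 1) / 2) with (/ 2) by field. ring.
Qed.

Lemma climit_decay (f : R -> C) (M c : R) : 0 < c -> 0 <= M ->
  (forall t, 0 <= t -> Cmod (f t) <= M * exp (- (c * t))) -> climit (Rbar_locally p_infty) f 0.
Proof.
  intros Hc HM H. apply (climit_squeeze _ _ _ (fun T => M * exp (- (c * T)))); [|apply lim_exp_neg; auto].
  exists 0; intros T HT. replace (f T - 0)%C with (f T) by ring. apply H; lra.
Qed.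

Lemma mehler_K_rec (b k0 k1 : C) (n : nat) : Re b = 0 -> is_improper (mehler_K b n) k0 -> is_improper (mehler_K b (S n)) k1 ->
  ((b + RtoC (2 * INR n + 1/2)) * k0 = RtoC ((/ 2) ^ n) + RtoC (2 * INR n + 1) * k1)%C.
Proof.
  intros Hb H0 H1. pose proof (Rbar_locally_filter p_infty) as FF.
  assert (forall c m, ccont (fun t => c * mehler_K b m t)%C) as C1 by (intros; apply ccont_mult; [apply ccont_const|apply ccont_mehler_K]).
  assert (RtoC (2 * INR n + 1) * k1 - (b + RtoC (2 * INR n + 1/2)) * k0 = 0 - RtoC ((/ 2) ^ n))%C as E.
  { apply (climit_unique (Rbar_locally p_infty) (fun T => mehler_K b n T - RtoC ((/ 2) ^ n))%C).
    - eapply (climit_ext _ (fun T => RtoC (2 * INR n + 1) * cRInt (mehler_K b (S n)) 0 T - (b + RtoC (2 * INR n + 1/2)) * cRInt (mehler_K b n) 0 T)%C).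
      + intros T. rewrite <- (mehler_K_0 b n), <- (cRInt_FTC _ _ 0 T (cder_mehler_K b n)) by (apply ccont_minus; apply C1).
        rewrite cRInt_minus by apply C1. rewrite !cRInt_scal by apply ccont_mehler_K. reflexivity.
      + apply climit_minus; try apply FF; apply climit_scal; try apply FF; auto.
    - apply climit_minus; try apply FF; [|apply climit_const; apply FF].
      apply (climit_decay _ ((/ 2) ^ n * exp (1/2 * ln 2)) (1/2)); [lra| |].
      + apply Rmult_le_pos; [apply pow_le; lra|left; apply exp_pos].
      + intros; apply mehler_K_bound; auto. }
  replace (RtoC (2 * INR n + 1) * k1)%C with ((RtoC (2 * INR n + 1) * k1 - (b + RtoC (2 * INR n + 1/2)) * k0) + (b + RtoC (2 * INR n + 1/2)) * k0)%C by ring.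
  rewrite E; ring.
Qed.

Lemma poch_1 (n : nat) : cpoch (RtoC 1) n = RtoC (INR (fact n)).
Proof.
  induction n; [reflexivity|]. cbn [cpoch]. rewrite IHn, fact_simpl, mult_INR, S_INR, !RtoC_mult, !RtoC_plus. ring.
Qed.

(** The base 3/2 lies strictly between 1 and 2, so the product with 2^(-n) still decays
    geometrically. *)
Lemma INR_le_geom (n : nat) : INR n <= 2 * (3/2) ^ n.
Proof.
  induction n; [simpl; lra|]. rewrite S_INR. cbn [pow].
  assert (1 <= (3/2) ^ n) by (apply pow_R1_Rle; lra). lra.
Qed.

(** Iterating [mehler_K_rec] gives an exact remainder for each partial sum of the hypergeometric
    series. It tends to 0: the Pochhammer quotients [c] are at most 1, b + 2n + 1/2 grows linearly,
    and K_n is O(2^(-n)). *)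
Lemma K0_hyp (b K0 : C) : Re b = 0 -> is_improper (mehler_time b) K0 ->
  hyp2F1 (RtoC (1/2)) (RtoC 1) (RtoC (5/4) + b / RtoC 2) (RtoC (1/2)) = ((b + RtoC (1/2)) * K0)%C.
Proof.
  intros Hb H0. pose proof (Rbar_locally_filter p_infty) as FF.
  set (ga := (RtoC (5/4) + b / RtoC 2)%C).
  assert (forall n : nat, exists l, is_improper (mehler_K b n) l /\ Cmod l <= 2 * exp (1/2 * ln 2) * (/ 2) ^ n) as Ex by (intros; apply mehler_K_ex; auto).
  assert (forall n : nat, 1/2 + INR n <= Cmod (ga + RtoC (INR n))) as Hga.
  { intros n. eapply Rle_trans; [|apply re_le_Cmod]. eapply Rle_trans; [|apply Rle_abs].
    unfold ga. rewrite !re_plus, Re_half, Hb, !re_RtoC. lra. }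
  assert (forall n, ga + RtoC (INR n) <> 0)%C as Hga0.
  { intros n. apply Cmod_gt_0. eapply Rlt_le_trans; [|apply Hga]. pose proof (pos_INR n); lra. }
  assert (forall n, cpoch ga n <> 0%C) as Hpg.
  { induction n; [apply RtoC_neq_0; lra|]. apply Cmult_neq_0; auto. }
  set (c := fun n => (cpoch (RtoC (1/2)) n / cpoch ga n)%C).
  assert (forall n, Cmod (c n) <= 1) as Hc.
  { induction n.
    - unfold c; simpl. rewrite Cmod_div, Cmod_1 by (apply RtoC_neq_0; lra). lra.
    - replace (c (S n)) with (c n * ((RtoC (1/2) + RtoC (INR n)) / (ga + RtoC (INR n))))%C.
      2:{ unfold c. cbn [cpoch]. field. auto. }
      rewrite Cmod_mult, Cmod_div by auto. rewrite <- (Rmult_1_r 1). apply Rmult_le_compat; auto; try apply Cmod_ge_0.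
      + apply Rdiv_le_0_compat; [apply Cmod_ge_0|apply Cmod_gt_0; auto].
      + specialize (Hga n). pose proof (pos_INR n).
        apply Rmult_le_reg_r with (Cmod (ga + RtoC (INR n))); [lra|].
        unfold Rdiv at 1. rewrite Rmult_assoc, Rinv_l, Rmult_1_r, Rmult_1_l by lra.
        rewrite <- RtoC_plus, Cmod_R, Rabs_right; lra. }
  set (F := cpsum (fun n => cpoch (RtoC (1/2)) n * cpoch (RtoC 1) n / (cpoch ga n * RtoC (INR (fact n))) * cpown (RtoC (1/2)) n)%C).
  (* The next remainder factor is b + 2(n+1) + 1/2 = 2 (ga + n), which is the new denominator factor
     of the series. *)
  assert (forall n k, is_improper (mehler_K b n) k -> F n = (b + RtoC (1/2)) * K0 - c n * (b + RtoC (2 * INR n + 1/2)) * k)%C as HF.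
  { induction n; intros k Hk.
    - assert (k = K0) as ->.
      { apply (climit_unique (Rbar_locally p_infty) (fun T => cRInt (mehler_time b) 0 T)); auto.
        eapply climit_ext; [apply FF| |apply Hk]. intros T; apply cRInt_ext; intros t. unfold mehler_K; simpl; ring. }
      unfold F, c; simpl. replace (2 * 0 + 1/2) with (1/2) by ring. field.
    - destruct (Ex n) as [k0 [Hk0 _]]. specialize (IHn k0 Hk0).
      unfold F in *. rewrite cpsum_S, IHn.
      pose proof (mehler_K_rec b k0 k n Hb Hk0 Hk) as R.
      replace (c n * (b + RtoC (2 * INR n + 1/2)) * k0)%C with (c n * ((b + RtoC (2 * INR n + 1/2)) * k0))%C by ring.
      rewrite R, poch_1.
      replace (cpown (RtoC (1/2)) n) with (RtoC ((/ 2) ^ n)).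
      2:{ clear. induction n; [reflexivity|]. cbn [cpown pow]. rewrite RtoC_mult, IHn. do 2 f_equal; field. }
      replace (c (S n)) with (c n * ((RtoC (1/2) + RtoC (INR n)) / (ga + RtoC (INR n))))%C.
      2:{ unfold c. cbn [cpoch]. field. auto. }
      replace (b + RtoC (2 * INR (S n) + 1/2))%C with (RtoC 2 * (ga + RtoC (INR n)))%C.
      2:{ unfold ga. rewrite S_INR. replace (2 * (INR n + 1) + 1/2) with (2 * (5/4 + INR n)) by field.
          rewrite RtoC_mult, RtoC_plus. field. }
      replace (RtoC (2 * INR n + 1)) with (RtoC 2 * (RtoC (1/2) + RtoC (INR n)))%C.
      2:{ rewrite <- RtoC_plus, <- RtoC_mult. f_equal; field. }
      unfold c. field. split; [auto|]. split; auto. apply RtoC_neq_0, not_0_INR, fact_neq_0. }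
  apply cseries_eq. fold F.
  set (M := 2 * exp (1/2 * ln 2)). assert (0 < M) as HM by (unfold M; pose proof (exp_pos (1/2 * ln 2)); lra).
  apply (climit_squeeze _ _ _ (fun n => M * (Cmod b + 1/2 + 4) * (3/4) ^ n)).
  - apply filter_forall; intros n. destruct (Ex n) as [k [Hk Bk]]. rewrite (HF n k Hk).
    match goal with |- Cmod ?X <= _ => replace X with (- (c n * ((b + RtoC (2 * INR n + 1/2)) * k)))%C by ring end.
    rewrite Cmod_opp, !Cmod_mult. pose proof (pos_INR n) as hn.
    assert (Cmod (b + RtoC (2 * INR n + 1/2)) <= (Cmod b + 1/2 + 4) * (3/2) ^ n) as h1.
    { eapply Rle_trans; [apply Cmod_triangle|]. rewrite Cmod_R, Rabs_right by lra.
      pose proof (INR_le_geom n). assert (1 <= (3/2) ^ n) by (apply pow_R1_Rle; lra). pose proof (Cmod_ge_0 b). nra. }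
    apply Rle_trans with (1 * (((Cmod b + 1/2 + 4) * (3/2) ^ n) * (M * (/ 2) ^ n))).
    + apply Rmult_le_compat; auto; try apply Cmod_ge_0.
      * apply Rmult_le_pos; apply Cmod_ge_0.
      * apply Rmult_le_compat; auto; apply Cmod_ge_0.
    + right. replace (3/4) with (3/2 * / 2) by field. rewrite Rpow_mult_distr. ring.
  - replace 0 with (M * (Cmod b + 1/2 + 4) * 0) by ring. apply (is_lim_seq_scal_l (fun n => (3/4) ^ n) _ 0).
    apply is_lim_seq_geom. rewrite Rabs_right; lra.
Qed.

(** * Wallis-type integrals of powers of cosh *)

Definition cosh_cos (s a t : R) : R := cos (a * t) * cosh_npow s t.
(** A Beta integral, classically 2^(s-2) |Gamma((s + ia)/2)|^2 / Gamma(s). The value wanted is at s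
    = 1/2. *)
Definition cosh_cos_int (s a : R) : R := real (Lim (fun T => RInt (cosh_cos s a) 0 T) p_infty).

Lemma continuous_cosh_npow (s t : R) : continuous (cosh_npow s) t.
Proof. apply (ex_derive_continuous (V := R_NormedModule)). eexists; apply is_derive_cosh_npow. Qed.

Lemma continuous_cosh_cos (s a t : R) : continuous (cosh_cos s a) t.
Proof.
  apply (continuous_mult (K := R_AbsRing) (fun t => cos (a * t))); [|apply continuous_cosh_npow].
  apply (ex_derive_continuous (V := R_NormedModule)); auto_derive; auto.
Qed.

Lemma ex_RInt_cosh_cos (s a u v : R) : ex_RInt (cosh_cos s a) u v.
Proof. apply (ex_RInt_continuous (V := R_CompleteNormedModule)); intros; apply continuous_cosh_cos. Qed.

Lemma cosh_cos_int_lim (s a : R) : 0 < s -> filterlim (fun T => RInt (cosh_cos s a) 0 T) (Rbar_locally p_infty) (locally (cosh_cos_int s a)).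
Proof.
  intros Hs. destruct (ex_improper_real (cosh_cos s a) (exp (s * ln 2)) s) as [l Hl]; auto.
  - apply continuous_cosh_cos.
  - intros t Ht. unfold cosh_cos. rewrite Rabs_mult, (Rabs_right (cosh_npow s t)) by (left; apply exp_pos).
    apply Rle_trans with (1 * cosh_npow s t).
    + apply Rmult_le_compat_r; [left; apply exp_pos|]. apply Rabs_le, COS_bound.
    + rewrite Rmult_1_l. apply cosh_npow_le_exp; lra.
  - unfold cosh_cos_int. rewrite (is_lim_unique _ p_infty (Finite l)); auto.
Qed.

Lemma cosh_cos_int_eq (s a l : R) : filterlim (fun T => RInt (cosh_cos s a) 0 T) (Rbar_locally p_infty) (locally l) -> cosh_cos_int s a = l.
Proof. intros H. unfold cosh_cos_int. rewrite (is_lim_unique _ p_infty (Finite l)); auto. Qed.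

Lemma cosh_npow_add (s u t : R) : cosh_npow (s + u) t = cosh_npow s t * cosh_npow u t.
Proof. unfold cosh_npow. rewrite <- exp_plus. f_equal; ring. Qed.

Lemma cosh_npow_2 (t : R) : cosh_npow 2 t = 1 - th t ^ 2.
Proof.
  unfold cosh_npow, th. pose proof (cosh_pos t) as H. pose proof (cosh_sinh t) as H2.
  replace (- (2 * ln (cosh t))) with (- ln (cosh t) + - ln (cosh t)) by ring.
  rewrite exp_plus, exp_Ropp, exp_ln by auto.
  replace (1 - (sinh t / cosh t) ^ 2) with ((cosh t * cosh t - sinh t * sinh t) / (cosh t * cosh t)) by (field; lra).
  rewrite H2. field; lra.
Qed.

(** The expression u v' - u' v for u = cos (at) and v = (cosh t)^(-s). Since u'' = -a^2 u and v'' =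
    s^2 v - s(s+1) (cosh t)^(-s-2), its derivative is the integrand of the recurrence in s. *)
Definition cosh_cos_prim (s a t : R) : R := cos (a * t) * (- (s * th t) * cosh_npow s t) + a * sin (a * t) * cosh_npow s t.

Lemma is_derive_cosh_cos_prim (s a t : R) : is_derive (cosh_cos_prim s a) t ((s * s + a * a) * cosh_cos s a t - s * (s + 1) * cosh_cos (s + 2) a t).
Proof.
  unfold cosh_cos_prim, cosh_cos. rewrite cosh_npow_add, cosh_npow_2.
  eapply is_derive_eq; [apply (is_derive_plus (V := R_NormedModule)); apply is_derive_Rmult|].
  - instantiate (1 := - a * sin (a * t)). auto_derive; auto; ring.
  - apply is_derive_Rmult; [|apply is_derive_cosh_npow]. apply (is_derive_opp (V := R_NormedModule)), is_derive_Rmult;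
    [apply (is_derive_const (V := R_NormedModule))|apply is_derive_th].
  - instantiate (1 := a * a * cos (a * t)). auto_derive; auto; ring.
  - apply is_derive_cosh_npow.
  - unfold plus, opp, zero; simpl. ring.
Qed.

Lemma Rlim_decay (f : R -> R) (M c : R) : 0 < c -> 0 <= M ->
  (forall t, 0 <= t -> Rabs (f t) <= M * exp (- (c * t))) -> filterlim f (Rbar_locally p_infty) (locally 0).
Proof.
  intros Hc HM H. apply filterlim_RtoC_inv; [apply Rbar_locally_filter|].
  apply (climit_decay _ M c); auto. intros; rewrite Cmod_R; auto.
Qed.

Lemma Rlim_plus (f g : R -> R) (l m : R) : filterlim f (Rbar_locally p_infty) (locally l) ->
  filterlim g (Rbar_locally p_infty) (locally m) -> filterlim (fun t => f t + g t) (Rbar_locally p_infty) (locally (l + m)).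
Proof. intros H1 H2. apply (is_lim_plus' f g p_infty l m); auto. Qed.

Lemma Rlim_scal (c : R) (f : R -> R) (l : R) : filterlim f (Rbar_locally p_infty) (locally l) ->
  filterlim (fun t => c * f t) (Rbar_locally p_infty) (locally (c * l)).
Proof. intros H1. apply (is_lim_scal_l f c p_infty l); auto. Qed.

Lemma Rlim_eq (f : R -> R) (l m : R) : l = m -> filterlim f (Rbar_locally p_infty) (locally l) ->
  filterlim f (Rbar_locally p_infty) (locally m).
Proof. intros <-; auto. Qed.

Lemma Rlim_unique (f : R -> R) (l m : R) : filterlim f (Rbar_locally p_infty) (locally l) ->
  filterlim f (Rbar_locally p_infty) (locally m) -> l = m.
Proof.
  intros H1 H2. apply (is_lim_unique f p_infty (Finite l)) in H1. apply (is_lim_unique f p_infty (Finite m)) in H2.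
  rewrite H1 in H2. injection H2; auto.
Qed.

Lemma cosh_cos_int_rec (s a : R) : 0 < s -> (s * s + a * a) * cosh_cos_int s a = s * (s + 1) * cosh_cos_int (s + 2) a.
Proof.
  intros Hs.
  assert (filterlim (cosh_cos_prim s a) (Rbar_locally p_infty) (locally 0)) as LG.
  { apply (Rlim_decay _ ((s + Rabs a) * exp (s * ln 2)) s); auto.
    - pose proof (Rabs_pos a). pose proof (exp_pos (s * ln 2)). nra.
    - intros t Ht. unfold cosh_cos_prim.
      replace (_ + _) with ((- (s * (cos (a * t) * th t)) + a * sin (a * t)) * cosh_npow s t) by ring.
      rewrite Rabs_mult, (Rabs_right (cosh_npow s t)) by (left; apply exp_pos).
      rewrite Rmult_assoc. apply Rmult_le_compat; [apply Rabs_pos|left; apply exp_pos| |apply cosh_npow_le_exp; lra].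
      eapply Rle_trans; [apply Rabs_triang|]. rewrite Rabs_Ropp, !Rabs_mult, (Rabs_right s) by lra.
      assert (Rabs (cos (a * t)) <= 1) as h1 by apply Rabs_le, COS_bound.
      assert (Rabs (sin (a * t)) <= 1) as h2 by apply Rabs_le, SIN_bound.
      pose proof (th_bound t) as h3. pose proof (Rabs_pos (cos (a * t))). pose proof (Rabs_pos (th t)).
      pose proof (Rabs_pos a). pose proof (Rabs_pos (sin (a * t))).
      assert (Rabs (cos (a * t)) * Rabs (th t) <= 1 * 1) by (apply Rmult_le_compat; auto).
      apply Rplus_le_compat; [nra|]. rewrite <- (Rmult_1_r (Rabs a)) at 2. apply Rmult_le_compat_l; auto. }
  assert (forall T, cosh_cos_prim s a T = (s * s + a * a) * RInt (cosh_cos s a) 0 T + (- (s * (s + 1))) * RInt (cosh_cos (s + 2) a) 0 T) as E.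
  { intros T. assert (cosh_cos_prim s a 0 = 0) as G0.
    { unfold cosh_cos_prim. replace (th 0) with 0 by (unfold th; rewrite sinh_0; field; apply Rgt_not_eq, cosh_pos).
      rewrite Rmult_0_r, sin_0. ring. }
    assert (is_RInt (fun t => (s * s + a * a) * cosh_cos s a t - s * (s + 1) * cosh_cos (s + 2) a t) 0 T (cosh_cos_prim s a T)) as I1.
    { replace (cosh_cos_prim s a T) with (minus (cosh_cos_prim s a T) (cosh_cos_prim s a 0)) by (rewrite G0; unfold minus, plus, opp; simpl; ring).
      apply (is_RInt_derive (V := R_CompleteNormedModule) (cosh_cos_prim s a)).
      - intros; apply is_derive_cosh_cos_prim.
      - intros x _. apply (continuous_minus (V := R_NormedModule) (fun t => (s * s + a * a) * cosh_cos s a t));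
        apply (continuous_mult (K := R_AbsRing) (fun _ => _)); try apply continuous_const; apply continuous_cosh_cos. }
    rewrite <- (is_RInt_unique _ _ _ _ I1). apply is_RInt_unique.
    eapply is_RInt_ext; [|apply (is_RInt_plus (V := R_NormedModule)); apply (is_RInt_scal (V := R_NormedModule));
      apply (RInt_correct (V := R_CompleteNormedModule)), ex_RInt_cosh_cos].
    intros x _. unfold plus, scal; simpl; unfold mult; simpl. ring. }
  assert ((s * s + a * a) * cosh_cos_int s a + (- (s * (s + 1))) * cosh_cos_int (s + 2) a = 0) as H; [|lra].
  apply (Rlim_unique (cosh_cos_prim s a)); auto.
  eapply filterlim_ext; [intros T; symmetry; apply E|].
  apply Rlim_plus; apply Rlim_scal, cosh_cos_int_lim; lra.
Qed.

Lemma cosh_cos_0 (s t : R) : cosh_cos s 0 t = cosh_npow s t.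
Proof. unfold cosh_cos. rewrite Rmult_0_l, cos_0; ring. Qed.

Lemma cosh_cos_int_le (s a s' a' c : R) : 0 < s -> 0 < s' -> (forall t, 0 <= t -> cosh_cos s a t <= c * cosh_cos s' a' t) -> cosh_cos_int s a <= c * cosh_cos_int s' a'.
Proof.
  intros Hs Hs' H.
  apply (fun h1 h2 h3 => filterlim_le (F := Rbar_locally p_infty) (fun T => RInt (cosh_cos s a) 0 T) (fun T => c * RInt (cosh_cos s' a') 0 T) (Finite _) (Finite (c * cosh_cos_int s' a')) h1 h2 h3).
  - exists 0; intros T HT. rewrite <- (RInt_scal (V := R_CompleteNormedModule)) by apply ex_RInt_cosh_cos.
    apply RInt_le; [lra|apply ex_RInt_cosh_cos|apply (ex_RInt_scal (V := R_NormedModule)), ex_RInt_cosh_cos|].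
    intros; apply H; lra.
  - apply cosh_cos_int_lim; auto.
  - apply Rlim_scal, cosh_cos_int_lim; auto.
Qed.

Lemma cosh_cos_int_mono (s s' : R) : 0 < s <= s' -> cosh_cos_int s' 0 <= cosh_cos_int s 0.
Proof.
  intros Hs. rewrite <- (Rmult_1_l (cosh_cos_int s 0)). apply cosh_cos_int_le; try lra.
  intros t Ht. rewrite !cosh_cos_0, Rmult_1_l. unfold cosh_npow. apply exp_le.
  assert (0 <= ln (cosh t)); [|nra]. rewrite <- ln_1. apply ln_le; [lra|apply cosh_ge_1].
Qed.

Lemma cosh_cos_int_1 : cosh_cos_int 1 0 = PI / 2.
Proof.
  apply cosh_cos_int_eq.
  apply (filterlim_ext (fun T => PI / 2 + - 2 * atan (exp (- T)))).
  - intros T. symmetry; apply is_RInt_unique.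
    replace (PI / 2 + - 2 * atan (exp (- T))) with (minus (- 2 * atan (exp (- T))) (- 2 * atan (exp (- 0)))).
    2:{ rewrite Ropp_0, exp_0, atan_1. unfold minus, plus, opp; simpl. field. }
    apply (is_RInt_derive (V := R_CompleteNormedModule) (fun T => - 2 * atan (exp (- T)))).
    + intros x _. rewrite cosh_cos_0. unfold cosh_npow. rewrite Rmult_1_l, exp_Ropp, exp_ln by apply cosh_pos.
      eapply is_derive_eq; [apply is_derive_Rmult; [apply (is_derive_const (V := R_NormedModule))|]|].
      * apply (is_derive_Rcomp atan (fun t => exp (- t))); [apply is_derive_Reals, derivable_pt_lim_atan|].
        instantiate (1 := - exp (- x)). auto_derive; auto; ring.
      * unfold zero; simpl. unfold cosh. rewrite exp_Ropp. pose proof (exp_pos x).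
        unfold Rsqr. field. repeat split; nra.
    + intros x _. apply continuous_cosh_cos.
  - apply (Rlim_eq _ (PI / 2 + - 2 * 0)); [ring|].
    apply Rlim_plus; [apply filterlim_const|]. apply Rlim_scal.
    rewrite <- atan_0. apply (filterlim_comp _ _ _ (fun T => exp (- T)) atan _ (locally 0)).
    + apply (Rlim_decay _ 1 1); try lra. intros t Ht. rewrite Rmult_1_l, Rmult_1_l, Rabs_right; [lra|left; apply exp_pos].
    + apply (ex_derive_continuous (V := R_NormedModule)). eexists; apply is_derive_Reals, derivable_pt_lim_atan.
Qed.

Lemma cosh_cos_int_2 : cosh_cos_int 2 0 = 1.
Proof.
  apply cosh_cos_int_eq. apply (filterlim_ext th).
  - intros T. symmetry; apply is_RInt_unique.
    replace (th T) with (minus (th T) (th 0)).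
    2:{ replace (th 0) with 0 by (unfold th; rewrite sinh_0; field; apply Rgt_not_eq, cosh_pos). unfold minus, plus, opp; simpl. ring. }
    apply (is_RInt_derive (V := R_CompleteNormedModule) th).
    + intros x _. rewrite cosh_cos_0, cosh_npow_2. apply is_derive_th.
    + intros x _. apply continuous_cosh_cos.
  - apply (filterlim_ext (fun T => 1 + - 1 * (1 - th T))); [intros; ring|].
    apply (Rlim_eq _ (1 + - 1 * 0)); [ring|]. apply Rlim_plus; [apply filterlim_const|]. apply Rlim_scal.
    apply (Rlim_decay _ 1 1); try lra. intros t Ht.
    assert (1 - th t = exp (- t) / cosh t) as ->.
    { unfold th. pose proof (cosh_pos t). unfold sinh. replace (1 - (exp t - exp (- t)) / 2 / cosh t) with ((cosh t - (exp t - exp (- t)) / 2) / cosh t) by (field; lra).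
      unfold cosh at 1. field. lra. }
    pose proof (exp_pos (- t)). pose proof (cosh_ge_1 t). unfold Rdiv. rewrite !Rmult_1_l, Rabs_mult, !Rabs_right.
    + rewrite <- (Rmult_1_r (exp (- t))) at 2. apply Rmult_le_compat_l; [lra|]. rewrite <- Rinv_1. apply Rinv_le_contravar; lra.
    + left; apply Rinv_0_lt_compat; lra.
    + lra.
Qed.

(** The product n I_n I_(n+1) is invariant under the recurrence at a = 0. *)
Lemma cosh_cos_int_wallis (n : nat) : INR (S n) * cosh_cos_int (INR (S n)) 0 * cosh_cos_int (INR (S (S n))) 0 = PI / 2.
Proof.
  induction n.
  - replace (INR 2) with 2 by (simpl; ring). replace (INR 1) with 1 by (simpl; ring). rewrite cosh_cos_int_1, cosh_cos_int_2. ring.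
  - pose proof (cosh_cos_int_rec (INR (S n)) 0 (INR_S_pos n)) as H.
    replace (INR (S (S (S n)))) with (INR (S n) + 2) by (rewrite !S_INR; ring).
    pose proof (INR_S_pos n).
    replace (INR (S (S n)) * cosh_cos_int (INR (S (S n))) 0 * cosh_cos_int (INR (S n) + 2) 0) with
      (cosh_cos_int (INR (S (S n))) 0 * (INR (S n) * (INR (S n) + 1) * cosh_cos_int (INR (S n) + 2) 0) / INR (S n)).
    2:{ rewrite (S_INR (S n)). field. lra. }
    rewrite <- H, <- IHn. field. lra.
Qed.

Lemma cosh_cos_int_pos (n : nat) : 0 <= cosh_cos_int (INR (S n)) 0.
Proof.
  apply (fun h1 h2 h3 => filterlim_le (F := Rbar_locally p_infty) (fun T => 0) (fun T => RInt (cosh_cos (INR (S n)) 0) 0 T) (Finite 0) (Finite (cosh_cos_int (INR (S n)) 0)) h1 h2 h3).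
  - exists 0; intros T HT. apply RInt_pos; [lra|apply ex_RInt_cosh_cos|]. intros; rewrite cosh_cos_0; left; apply exp_pos.
  - apply filterlim_const.
  - apply cosh_cos_int_lim, INR_S_pos.
Qed.

(** The integral decreases in its exponent, so the value at 2n + 5/2 lies between those at 2n + 3
    and 2n + 2. Their squares are compared with the Wallis products of neighbouring integer
    exponents. *)
Lemma cosh_cos_int_half_bounds (n : nat) : sqrt (PI / 2 / (2 * INR n + 3)) <= cosh_cos_int (2 * INR n + 5/2) 0 <= sqrt (PI / 2 / (2 * INR n + 1)).
Proof.
  pose proof (pos_INR n) as hn. pose proof PI_RGT_0 as hp.
  assert (INR (S (2 * n)) = 2 * INR n + 1) as e1 by (rewrite S_INR, mult_INR; simpl INR; ring).
  assert (INR (S (S (2 * n))) = 2 * INR n + 2) as e2 by (rewrite S_INR, e1; ring).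
  assert (INR (S (S (S (2 * n)))) = 2 * INR n + 3) as e3 by (rewrite S_INR, e2; ring).
  assert (INR (S (S (S (S (2 * n))))) = 2 * INR n + 4) as e4 by (rewrite S_INR, e3; ring).
  pose proof (cosh_cos_int_wallis (2 * n)) as w1. rewrite e1, e2 in w1.
  pose proof (cosh_cos_int_wallis (S (S (2 * n)))) as w3. rewrite e3, e4 in w3.
  pose proof (cosh_cos_int_pos (S (2 * n))) as p2. rewrite e2 in p2.
  pose proof (cosh_cos_int_pos (S (S (2 * n)))) as p3. rewrite e3 in p3.
  split.
  - apply Rle_trans with (cosh_cos_int (2 * INR n + 3) 0); [|apply cosh_cos_int_mono; lra].
    rewrite <- (sqrt_square (cosh_cos_int (2 * INR n + 3) 0)) by auto. apply sqrt_le_1_alt.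
    rewrite <- w3. replace ((2 * INR n + 3) * cosh_cos_int (2 * INR n + 3) 0 * cosh_cos_int (2 * INR n + 4) 0 / (2 * INR n + 3)) with
      (cosh_cos_int (2 * INR n + 3) 0 * cosh_cos_int (2 * INR n + 4) 0) by (field; lra).
    apply Rmult_le_compat_l; auto. apply cosh_cos_int_mono; lra.
  - apply Rle_trans with (cosh_cos_int (2 * INR n + 2) 0); [apply cosh_cos_int_mono; lra|].
    rewrite <- (sqrt_square (cosh_cos_int (2 * INR n + 2) 0)) by auto. apply sqrt_le_1_alt.
    rewrite <- w1. replace ((2 * INR n + 1) * cosh_cos_int (2 * INR n + 1) 0 * cosh_cos_int (2 * INR n + 2) 0 / (2 * INR n + 1)) with
      (cosh_cos_int (2 * INR n + 1) 0 * cosh_cos_int (2 * INR n + 2) 0) by (field; lra).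
    apply Rmult_le_compat_r; auto. apply cosh_cos_int_mono; lra.
Qed.

Lemma sinh_ge (t : R) : 0 <= t -> t <= sinh t.
Proof.
  intros Ht.
  destruct (MVT_gen (fun t => sinh t - t) 0 t (fun t => cosh t - 1)) as [c [Hc E]].
  - intros x _. apply (is_derive_minus (V := R_NormedModule)); [apply is_derive_sinh|apply (is_derive_id x)].
  - intros x _. apply continuity_pt_filterlim.
    apply (continuous_minus (V := R_NormedModule) sinh (fun t => t)); [|apply continuous_id].
    apply (ex_derive_continuous (V := R_NormedModule)). eexists; apply is_derive_sinh.
  - rewrite sinh_0 in E. pose proof (cosh_ge_1 c). nra.
Qed.

Lemma cos_ge (x : R) : 1 - x ^ 2 / 2 <= cos x.
Proof.
  replace x with (2 * (x / 2)) at 2 by field. rewrite cos_2a_sin.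
  assert (sin (x / 2) ^ 2 <= (x / 2) ^ 2); [|lra].
  rewrite <- (pow2_abs (sin _)), <- (pow2_abs (x / 2)). apply pow_incr. split; [apply Rabs_pos|].
  assert (forall y, 0 <= y -> Rabs (sin y) <= y) as H.
  { intros y Hy. destruct (Rle_dec y 1) as [h|h].
    - pose proof PI2_1. rewrite Rabs_right by (apply Rle_ge, sin_ge_0; lra).
      destruct (Req_dec y 0) as [->|h2]; [rewrite sin_0; lra|left; apply sin_lt_x; lra].
    - apply Rle_trans with 1; [apply Rabs_le, SIN_bound|lra]. }
  destruct (Rle_dec 0 (x / 2)) as [h|h].
  - rewrite (Rabs_right (x / 2)) by lra. auto.
  - rewrite (Rabs_left1 (x / 2)) by lra. rewrite <- Rabs_Ropp, <- sin_neg. apply H; lra.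
Qed.

(** 1 - cos (at) is at most a^2 t^2/2, and t <= sinh t gives t^2/cosh^2 t <= tanh^2 t = 1 - 1/cosh^2
    t. *)
Lemma cosh_cos_conc (s a t : R) : 0 <= t -> cosh_cos s 0 t <= cosh_cos s a t + a ^ 2 / 2 * (cosh_cos (s - 2) 0 t - cosh_cos s 0 t).
Proof.
  intros Ht. rewrite !cosh_cos_0. unfold cosh_cos. pose proof (cos_ge (a * t)) as Hc.
  replace s with (s - 2 + 2) at 1 2 4 by ring. rewrite cosh_npow_add.
  set (c := cosh_npow (s - 2) t). assert (0 < c) as h by apply exp_pos.
  assert (cosh_npow 2 t * t ^ 2 <= th t ^ 2) as H.
  { unfold cosh_npow, th. pose proof (cosh_pos t).
    replace (- (2 * ln (cosh t))) with (- ln (cosh t) + - ln (cosh t)) by ring.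
    rewrite exp_plus, exp_Ropp, exp_ln by auto.
    replace ((sinh t / cosh t) ^ 2) with (/ cosh t * / cosh t * sinh t ^ 2) by (field; lra).
    apply Rmult_le_compat_l; [left; apply Rmult_lt_0_compat; apply Rinv_0_lt_compat; auto|].
    apply pow_incr; split; auto. apply sinh_ge; auto. }
  assert (0 < cosh_npow 2 t) as h2 by apply exp_pos.
  replace (c - c * cosh_npow 2 t) with (c * th t ^ 2) by (rewrite cosh_npow_2; ring).
  assert (cosh_npow 2 t * (1 - cos (a * t)) <= a ^ 2 / 2 * th t ^ 2) as H3.
  { apply Rle_trans with (cosh_npow 2 t * ((a * t) ^ 2 / 2)); [apply Rmult_le_compat_l; lra|].
    replace (cosh_npow 2 t * ((a * t) ^ 2 / 2)) with (a ^ 2 / 2 * (cosh_npow 2 t * t ^ 2)) by field.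
    apply Rmult_le_compat_l; auto. pose proof (pow2_ge_0 a); lra. }
  nra.
Qed.

Lemma cosh_cos_int_conc (s a : R) : 2 < s -> Rabs (cosh_cos_int s a - cosh_cos_int s 0) <= a ^ 2 / 2 * (cosh_cos_int s 0 / (s - 2)).
Proof.
  intros Hs.
  assert (cosh_cos_int s a <= cosh_cos_int s 0) as H1.
  { rewrite <- (Rmult_1_l (cosh_cos_int s 0)). apply cosh_cos_int_le; try lra. intros t Ht. rewrite Rmult_1_l, cosh_cos_0. unfold cosh_cos.
    rewrite <- (Rmult_1_l (cosh_npow s t)) at 2. apply Rmult_le_compat_r; [left; apply exp_pos|apply COS_bound]. }
  assert (cosh_cos_int s 0 <= cosh_cos_int s a + a ^ 2 / 2 * (cosh_cos_int (s - 2) 0 + - 1 * cosh_cos_int s 0)) as H2.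
  { apply (fun h1 h2 h3 => filterlim_le (F := Rbar_locally p_infty) (fun T => RInt (cosh_cos s 0) 0 T)
      (fun T => RInt (cosh_cos s a) 0 T + a ^ 2 / 2 * (RInt (cosh_cos (s - 2) 0) 0 T + - 1 * RInt (cosh_cos s 0) 0 T)) (Finite _)
      (Finite (cosh_cos_int s a + a ^ 2 / 2 * (cosh_cos_int (s - 2) 0 + - 1 * cosh_cos_int s 0))) h1 h2 h3).
    - exists 0; intros T HT.
      assert (is_RInt (fun t => cosh_cos s a t + a ^ 2 / 2 * (cosh_cos (s - 2) 0 t + - 1 * cosh_cos s 0 t)) 0 T
        (RInt (cosh_cos s a) 0 T + a ^ 2 / 2 * (RInt (cosh_cos (s - 2) 0) 0 T + - 1 * RInt (cosh_cos s 0) 0 T))) as I.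
      { apply (is_RInt_plus (V := R_NormedModule)); [|apply (is_RInt_scal (V := R_NormedModule)), (is_RInt_plus (V := R_NormedModule));
         [|apply (is_RInt_scal (V := R_NormedModule))]]; apply (RInt_correct (V := R_CompleteNormedModule)), ex_RInt_cosh_cos. }
      rewrite <- (is_RInt_unique _ _ _ _ I). apply RInt_le; [lra|apply ex_RInt_cosh_cos|eexists; apply I|].
      intros t Ht. pose proof (cosh_cos_conc s a t ltac:(lra)). lra.
    - apply cosh_cos_int_lim; lra.
    - apply Rlim_plus; [apply cosh_cos_int_lim; lra|]. apply Rlim_scal, Rlim_plus; [|apply Rlim_scal]; apply cosh_cos_int_lim; lra. }
  pose proof (cosh_cos_int_rec (s - 2) 0 ltac:(lra)) as R. replace (s - 2 + 2) with s in R by ring.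
  (* The recurrence at a = 0 turns the difference of the integrals at s - 2 and s into I(s)/(s - 2),
     a relative error of order 1/s. *)
  assert (cosh_cos_int (s - 2) 0 = (s - 1) / (s - 2) * cosh_cos_int s 0) as E.
  { apply Rmult_eq_reg_l with ((s - 2) * (s - 2)); [|nra].
    replace ((s - 2) * (s - 2)) with ((s - 2) * (s - 2) + 0 * 0) at 1 by ring. rewrite R. field. lra. }
  rewrite E in H2.
  replace ((s - 1) / (s - 2) * cosh_cos_int s 0 + - 1 * cosh_cos_int s 0) with (cosh_cos_int s 0 / (s - 2)) in H2 by (field; lra).
  apply Rabs_le; lra.
Qed.

Lemma lim_inv_lin (c a b : R) : 0 < a -> 0 <= b -> is_lim_seq (fun n => c / (a * INR n + b)) 0.
Proof.
  intros Ha Hb. apply (filterlim_comp _ _ _ (fun n => a * INR n + b) (fun S => c / S) _ (Rbar_locally p_infty)); [|apply lim_inv_infty].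
  intros Q [M HM]. destruct (INR_unbounded (Rabs M / a)) as [N HN].
  exists N; intros n Hn. apply HM. apply le_INR in Hn.
  apply Rle_lt_trans with (Rabs M); [apply Rle_abs|].
  replace (Rabs M) with (a * (Rabs M / a)) by (field; lra). nra.
Qed.

Lemma lim_sqrt_ratio (b : R) : 0 < b -> is_lim_seq (fun n => sqrt (INR n) * sqrt (PI / 2 / (2 * INR n + b))) (sqrt PI / 2).
Proof.
  intros Hb. pose proof PI_RGT_0 as hp.
  assert (is_lim_seq (fun n => PI / 4 - (PI * b / 4) / (2 * INR n + b)) (PI / 4 - 0)) as H.
  { apply is_lim_seq_minus'; [apply is_lim_seq_const|]. apply lim_inv_lin; lra. }
  rewrite Rminus_0_r in H.
  apply (is_lim_seq_continuous sqrt) in H; [|apply continuity_pt_sqrt; lra].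
  replace (sqrt PI / 2) with (sqrt (PI / 4)).
  2:{ rewrite sqrt_div by lra. f_equal. replace 4 with (2 * 2) by ring. apply sqrt_square; lra. }
  eapply is_lim_seq_ext; [|apply H]. intros n; cbv beta.
  pose proof (pos_INR n). rewrite <- sqrt_mult by (try lra; apply Rdiv_le_0_compat; lra).
  f_equal. field. lra.
Qed.

Lemma cosh_cos_int_asym_0 : is_lim_seq (fun n => sqrt (INR n) * cosh_cos_int (2 * INR n + 5/2) 0) (sqrt PI / 2).
Proof.
  eapply is_lim_seq_le_le; [|apply (lim_sqrt_ratio 3); lra|apply (lim_sqrt_ratio 1); lra].
  intros n; cbv beta. pose proof (cosh_cos_int_half_bounds n). pose proof (sqrt_pos (INR n)).
  split; apply Rmult_le_compat_l; lra.
Qed.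

Lemma cosh_cos_int_asym (a : R) : is_lim_seq (fun n => sqrt (INR n) * cosh_cos_int (2 * INR n + 5/2) a) (sqrt PI / 2).
Proof.
  apply (is_lim_seq_ext (fun n => sqrt (INR n) * cosh_cos_int (2 * INR n + 5/2) 0 +
    (sqrt (INR n) * cosh_cos_int (2 * INR n + 5/2) a - sqrt (INR n) * cosh_cos_int (2 * INR n + 5/2) 0))); [intros; ring|].
  replace (Finite (sqrt PI / 2)) with (Finite (sqrt PI / 2 + 0)) by (f_equal; ring).
  apply is_lim_seq_plus'; [apply cosh_cos_int_asym_0|].
  apply is_lim_seq_abs_0.
  eapply is_lim_seq_le_le; [|apply is_lim_seq_const|].
  - intros n. split; [apply Rabs_pos|].
    pose proof (pos_INR n).
    rewrite <- Rmult_minus_distr_l, Rabs_mult, (Rabs_right (sqrt (INR n))) by (apply Rle_ge, sqrt_pos).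
    eapply Rle_trans; [apply Rmult_le_compat_l; [apply sqrt_pos|apply cosh_cos_int_conc; lra]|].
    right. instantiate (1 := fun n => (sqrt (INR n) * cosh_cos_int (2 * INR n + 5/2) 0) * (a ^ 2 / 2 / (2 * INR n + 1/2))).
    cbv beta. field. lra.
  - replace (Finite 0) with (Finite (sqrt PI / 2 * 0)) by (f_equal; ring).
    apply is_lim_seq_mult'; [apply cosh_cos_int_asym_0|]. apply lim_inv_lin; lra.
Qed.

Definition quarter_minus (a : R) : C := (RtoC (1/4) - Ci * RtoC a / RtoC 2)%C.
Definition quarter_plus (a : R) : C := (RtoC (1/4) + Ci * RtoC a / RtoC 2)%C.

(** For s = 2n + 1/2 the two factors of the recurrence are s^2 + a^2 = 4 (1/4 + n - ia/2)(1/4 + n +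
    ia/2) and s(s + 1) = 4 (1/4 + n)(3/4 + n). *)
Lemma cosh_cos_int_poch (a : R) (n : nat) : (RtoC (cosh_cos_int (1/2) a) * (cpoch (quarter_minus a) n * cpoch (quarter_plus a) n) =
  RtoC (cosh_cos_int (2 * INR n + 1/2) a) * (cpoch (RtoC (1/4)) n * cpoch (RtoC (3/4)) n))%C.
Proof.
  induction n.
  - simpl. replace (2 * 0 + 1/2) with (1/2) by field. ring.
  - cbn [cpoch].
    transitivity ((RtoC (cosh_cos_int (1/2) a) * (cpoch (quarter_minus a) n * cpoch (quarter_plus a) n)) * ((quarter_minus a + RtoC (INR n)) * (quarter_plus a + RtoC (INR n))))%C; [ring|].
    rewrite IHn. pose proof (pos_INR n) as hn.
    pose proof (cosh_cos_int_rec (2 * INR n + 1/2) a ltac:(lra)) as R.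
    replace (2 * INR (S n) + 1/2) with (2 * INR n + 1/2 + 2) by (rewrite S_INR; ring).
    assert ((quarter_minus a + RtoC (INR n)) * (quarter_plus a + RtoC (INR n)) = RtoC (((2 * INR n + 1/2) * (2 * INR n + 1/2) + a * a) / 4))%C as E.
    { unfold quarter_minus, quarter_plus, Cdiv. rewrite <- RtoC_inv by lra. csimp; field. }
    rewrite E. rewrite <- !RtoC_plus.
    transitivity (RtoC (cosh_cos_int (2 * INR n + 1/2) a * (((2 * INR n + 1/2) * (2 * INR n + 1/2) + a * a) / 4)) * (cpoch (RtoC (1/4)) n * cpoch (RtoC (3/4)) n))%C.
    + rewrite (RtoC_mult (cosh_cos_int _ _)). ring.
    + replace (cosh_cos_int (2 * INR n + 1/2) a * (((2 * INR n + 1/2) * (2 * INR n + 1/2) + a * a) / 4))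
        with (cosh_cos_int (2 * INR n + 1/2 + 2) a * ((1/4 + INR n) * (3/4 + INR n))) by lra.
      rewrite !RtoC_mult. ring.
Qed.

Lemma Re_quarter_minus (a : R) : Re (quarter_minus a) = 1/4.
Proof. unfold quarter_minus, Cdiv. rewrite <- RtoC_inv by lra. unfold Re; simpl; field. Qed.

Lemma Re_quarter_plus (a : R) : Re (quarter_plus a) = 1/4.
Proof. unfold quarter_plus, Cdiv. rewrite <- RtoC_inv by lra. unfold Re; simpl; field. Qed.

(* Iterating the recurrence in s from s = 1/2, the dependence on a disappears in the limit, where
   Wallis' product applies. *)
Lemma cosh_cos_int_rgamma (a : R) : (RtoC (cosh_cos_int (1/2) a) * (rgamma (quarter_minus a) * rgamma (quarter_plus a)) =
  RtoC (sqrt PI / 2) * (rgamma (RtoC (1/4)) * rgamma (RtoC (3/4))))%C.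
Proof.
  pose proof eventually_filter as FF.
  apply (climit_unique eventually (fun n => RtoC (cosh_cos_int (1/2) a) * (rgamma_seq (quarter_minus a) n * rgamma_seq (quarter_plus a) n))%C).
  - apply climit_scal; [apply FF|]. apply climit_mult; try apply FF; apply rgamma_seq_lim; rewrite ?Re_quarter_minus, ?Re_quarter_plus; lra.
  - eapply (climit_ext_loc _ (fun n => RtoC (sqrt (INR n) * cosh_cos_int (2 * INR n + 5/2) a) * (rgamma_seq (RtoC (1/4)) n * rgamma_seq (RtoC (3/4)) n))%C).
    + exists 1%nat; intros n Hn.
      assert (1 <= INR n) as Hn1 by (apply le_INR in Hn; simpl in Hn; lra).
      (* The Gauss terms contain n + 1 factors, hence the index [S n] and the exponent 2n + 5/2. *)
      pose proof (cosh_cos_int_poch a (S n)) as H. replace (2 * INR (S n) + 1/2) with (2 * INR n + 5/2) in H by (rewrite S_INR; field).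
      unfold rgamma_seq. set (f := RtoC (INR (fact n))).
      assert (f <> 0%C) as hf by (apply RtoC_neq_0, not_0_INR, fact_neq_0).
      (* The exponents add up to 1/2 for one pair and to 1 for the other; the quotient leaves the
         factor sqrt n that [cosh_cos_int_asym] needs. *)
      assert (cpow_pos (INR n) (quarter_minus a) * cpow_pos (INR n) (quarter_plus a) = RtoC (sqrt (INR n)))%C as E1.
      { rewrite <- cpow_pos_add. replace (quarter_minus a + quarter_plus a)%C with (RtoC (1/2)).
        2:{ unfold quarter_minus, quarter_plus. replace (RtoC (1/2)) with (RtoC (1/4) + RtoC (1/4))%C by (rewrite <- RtoC_plus; f_equal; field). ring. }
        unfold cpow_pos. rewrite <- RtoC_mult, cexp_RtoC. f_equal.
        rewrite <- (Rpower_sqrt (INR n)) by lra. unfold Rpower. f_equal; field. }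
      assert (cpow_pos (INR n) (RtoC (1/4)) * cpow_pos (INR n) (RtoC (3/4)) = RtoC (sqrt (INR n)) * RtoC (sqrt (INR n)))%C as E2.
      { rewrite <- cpow_pos_add, <- !RtoC_plus. unfold cpow_pos. rewrite <- !RtoC_mult, cexp_RtoC. f_equal.
        rewrite sqrt_sqrt by lra. replace ((1/4 + 3/4) * ln (INR n)) with (ln (INR n)) by field. apply exp_ln; lra. }
      set (r := RtoC (sqrt (INR n))) in *.
      assert (r <> 0%C) as hr by (apply RtoC_neq_0, Rgt_not_eq, sqrt_lt_R0; lra).
      pose proof (cpow_pos_neq_0 (INR n) (quarter_minus a)) as h1. pose proof (cpow_pos_neq_0 (INR n) (quarter_plus a)) as h2.
      pose proof (cpow_pos_neq_0 (INR n) (RtoC (1/4))) as h3. pose proof (cpow_pos_neq_0 (INR n) (RtoC (3/4))) as h4.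
      rewrite RtoC_mult. fold r.
      transitivity (r * (RtoC (cosh_cos_int (2 * INR n + 5/2) a) * (cpoch (RtoC (1/4)) (S n) * cpoch (RtoC (3/4)) (S n))) / (f * f * (cpow_pos (INR n) (RtoC (1/4)) * cpow_pos (INR n) (RtoC (3/4)))))%C.
      { field. repeat split; auto. }
      rewrite <- H, E2.
      transitivity ((RtoC (cosh_cos_int (1/2) a) * (cpoch (quarter_minus a) (S n) * cpoch (quarter_plus a) (S n))) / (f * f * (cpow_pos (INR n) (quarter_minus a) * cpow_pos (INR n) (quarter_plus a))))%C.
      { rewrite E1. field. split; auto. }
      field. repeat split; auto.
    + apply climit_mult; try apply FF.
      * apply climit_RtoC; [apply FF|]. apply cosh_cos_int_asym.
      * apply climit_mult; try apply FF; apply rgamma_seq_lim; rewrite re_RtoC; lra.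
Qed.

Lemma Re_K0 (a : R) (K0 : C) : is_improper (mehler_time (- (Ci * RtoC a))) K0 -> Re K0 = cosh_cos_int (1/2) a.
Proof.
  intros H. apply climit_Re in H; [|apply Rbar_locally_filter].
  symmetry; apply cosh_cos_int_eq. eapply filterlim_ext; [|apply H].
  intros T. change (RInt (fun s => Re (mehler_time (- (Ci * RtoC a)) s)) 0 T = RInt (cosh_cos (1/2) a) 0 T).
  apply RInt_ext. intros t _.
  unfold mehler_time, cosh_cos. rewrite re_scal_r.
  replace (- - (Ci * RtoC a) * RtoC t)%C with (RtoC (a * t) * Ci)%C by (rewrite RtoC_mult; ring).
  rewrite cexp_Ci. reflexivity.
Qed.

(** * Euler's reflection formula *)

Definition exp_osc (s : C) (t : R) : C := cexp (RtoC 2 * Ci * s * RtoC t).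
(* (4 n^2 - 4 s^2) E_n(s) = 2n (2n - 1) E_{n-1}(s) and E_n(s) / E_n(0) -> 1: this is Euler's
   product for sin (pi s). *)
Definition cos_osc_int (s : C) (n : nat) : C := cRInt (fun t => exp_osc s t * RtoC (cos t ^ (2 * n)))%C (- (PI / 2)) (PI / 2).

Lemma cder_exp_osc (s : C) (t : R) : cder (exp_osc s) t (RtoC 2 * Ci * s * exp_osc s t)%C.
Proof.
  unfold exp_osc. eapply cder_eq; [apply cder_cexp, cder_scal, cder_id|]. cbv beta. ring.
Qed.

Lemma ccont_exp_osc (s : C) : ccont (exp_osc s).
Proof. apply (cder_ccont _ _ (cder_exp_osc s)). Qed.

Lemma continuous_cosn (n : nat) (t : R) : continuous (fun t => cos t ^ n) t.
Proof. apply (ex_derive_continuous (V := R_NormedModule)). auto_derive; auto. Qed.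

Lemma ccont_cos_osc_int (s : C) (n : nat) : ccont (fun t => exp_osc s t * RtoC (cos t ^ (2 * n)))%C.
Proof. apply ccont_mult; [apply ccont_exp_osc|]. apply ccont_RtoC, continuous_cosn. Qed.

(** In other words s E_0(s) = sin (pi s): this is where the sine of the reflection formula
    enters. *)
Lemma cos_osc_int_0 (s : C) : (RtoC 2 * Ci * s * cos_osc_int s 0)%C = (cexp (RtoC PI * Ci * s) - cexp (- (RtoC PI * Ci * s)))%C.
Proof.
  unfold cos_osc_int. rewrite <- cRInt_scal by apply ccont_cos_osc_int.
  rewrite (cRInt_ext _ (fun t => RtoC 2 * Ci * s * exp_osc s t)%C) by (intros; simpl; ring).
  rewrite (cRInt_FTC (exp_osc s)); [|apply cder_exp_osc|apply ccont_mult; [apply ccont_const|apply ccont_exp_osc]].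
  unfold exp_osc. f_equal; [f_equal|f_equal; f_equal].
  - replace PI with (2 * (PI / 2)) at 2 by field. rewrite (RtoC_mult 2). ring.
  - rewrite RtoC_opp. replace (RtoC PI) with (RtoC 2 * RtoC (PI / 2))%C by (rewrite <- RtoC_mult; f_equal; field). ring.
Qed.

(** The expression u v' - u' v for u = e^{2ist} and v = (cos t)^(2n+2). It vanishes at both ends of
    the interval, which yields the recurrence in n. *)
Definition cos_osc_prim (s : C) (n : nat) (t : R) : C :=
  (exp_osc s t * (RtoC (- (INR (2 * S n) * cos t ^ S (2 * n) * sin t)) - RtoC 2 * Ci * s * RtoC (cos t ^ (2 * S n))))%C.

Lemma cder_cos_osc_prim (s : C) (n : nat) (t : R) : cder (cos_osc_prim s n) t
  (exp_osc s t * (RtoC (INR (2 * S n) * INR (S (2 * n))) * RtoC (cos t ^ (2 * n))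
     - RtoC 4 * (RtoC (INR (S n) * INR (S n)) - s * s) * RtoC (cos t ^ (2 * S n))))%C.
Proof.
  assert (is_derive (fun t => - (INR (2 * S n) * cos t ^ S (2 * n) * sin t)) t
    (INR (2 * S n) * INR (S (2 * n)) * cos t ^ (2 * n) - 4 * (INR (S n) * INR (S n)) * cos t ^ (2 * S n))) as D1.
  { evar_last; [apply (is_derive_opp (V := R_NormedModule)), is_derive_Rmult; [apply is_derive_Rmult;
     [apply (is_derive_const (V := R_NormedModule))|apply is_derive_pow, is_derive_cos]|apply is_derive_sin]|].
    unfold opp, zero; simpl opp. simpl pred.
    replace (2 * S n)%nat with (S (S (2 * n))) by lia. rewrite (S_INR (S (2 * n))), (S_INR (2 * n)).
    assert (INR (S n) = (INR (2 * n) + 2) / 2) as e by (rewrite S_INR, mult_INR; simpl (INR 2); field).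
    rewrite e. cbn [pow].
    assert (sin t * sin t = 1 - cos t * cos t) as es by (pose proof (sin2_cos2 t) as h; unfold Rsqr in h; lra).
    set (c := cos t ^ (2 * n)). set (N := INR (2 * n)).
    transitivity ((N + 1 + 1) * (N + 1) * c * (sin t * sin t) - (N + 1 + 1) * (cos t * c) * cos t).
    - change (- ((0 * (cos t * c) + (N + 1 + 1) * ((N + 1) * - sin t * c)) * sin t + (N + 1 + 1) * (cos t * c) * cos t) =
        (N + 1 + 1) * (N + 1) * c * (sin t * sin t) - (N + 1 + 1) * (cos t * c) * cos t). ring.
    - rewrite es. field. }
  assert (is_derive (fun t => cos t ^ (2 * S n)) t (- (INR (2 * S n) * cos t ^ S (2 * n) * sin t))) as D2.
  { evar_last; [apply is_derive_pow, is_derive_cos|]. replace (pred (2 * S n)) with (S (2 * n)) by lia.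
    change (INR (2 * S n) * - sin t * cos t ^ S (2 * n) = - (INR (2 * S n) * cos t ^ S (2 * n) * sin t)). ring. }
  unfold cos_osc_prim. eapply cder_eq; [apply cder_mult; [apply cder_exp_osc|apply cder_minus; [apply cder_RtoC, D1|apply cder_scal, cder_RtoC, D2]]|].
  cbv beta. rewrite RtoC_minus, !RtoC_opp, !RtoC_mult.
  set (X := (RtoC (INR (2 * S n)) * RtoC (cos t ^ S (2 * n)) * RtoC (sin t))%C).
  set (Y := RtoC (cos t ^ (2 * S n))). set (Z := RtoC (cos t ^ (2 * n))).
  assert (Ci * Ci = - (1))%C as Hi by (csimp; ring).
  replace (RtoC 4) with (RtoC 2 * RtoC 2)%C by (rewrite <- RtoC_mult; f_equal; ring).
  transitivity (exp_osc s t * (RtoC (INR (2 * S n)) * RtoC (INR (S (2 * n))) * Z - RtoC 2 * RtoC 2 * (RtoC (INR (S n)) * RtoC (INR (S n))) * Y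
    - RtoC 2 * RtoC 2 * (Ci * Ci) * s * s * Y))%C; [ring|]. rewrite Hi. ring.
Qed.

Lemma cos_osc_int_rec (s : C) (n : nat) :
  (RtoC 4 * (RtoC (INR (S n) * INR (S n)) - s * s) * cos_osc_int s (S n) = RtoC (INR (2 * S n) * INR (S (2 * n))) * cos_osc_int s n)%C.
Proof.
  set (k1 := RtoC (INR (2 * S n) * INR (S (2 * n)))). set (k2 := (RtoC 4 * (RtoC (INR (S n) * INR (S n)) - s * s))%C).
  assert (k1 * cos_osc_int s n - k2 * cos_osc_int s (S n) = cos_osc_prim s n (PI / 2) - cos_osc_prim s n (- (PI / 2)))%C as H.
  { rewrite <- (cRInt_FTC _ _ _ _ (cder_cos_osc_prim s n)).
    - unfold cos_osc_int. rewrite <- !cRInt_scal by apply ccont_cos_osc_int. rewrite <- cRInt_minus; try (apply ccont_mult; [apply ccont_const|apply ccont_cos_osc_int]).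
      apply cRInt_ext; intros t. unfold k1, k2. ring.
    - apply ccont_mult; [apply ccont_exp_osc|].
      apply ccont_minus; (apply ccont_mult; [apply ccont_const|apply ccont_RtoC, continuous_cosn]). }
  assert (forall t, cos t = 0 -> cos_osc_prim s n t = 0%C) as G0.
  { intros t Ht. unfold cos_osc_prim. rewrite Ht, !pow_i by lia. rewrite Rmult_0_r, Rmult_0_l, Ropp_0. ring. }
  rewrite (G0 (PI / 2)), (G0 (- (PI / 2))) in H; [|rewrite cos_neg; apply cos_PI2|apply cos_PI2].
  replace (k2 * cos_osc_int s (S n))%C with (k1 * cos_osc_int s n - (k1 * cos_osc_int s n - k2 * cos_osc_int s (S n)))%C by ring. rewrite H. ring.
Qed.

Definition cos_int (n : nat) : R := RInt (fun t => cos t ^ (2 * n)) (- (PI / 2)) (PI / 2).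

Lemma cos_osc_int_cos_int (n : nat) : cos_osc_int 0 n = RtoC (cos_int n).
Proof.
  unfold cos_osc_int, cos_int. rewrite <- cRInt_RtoC. apply cRInt_ext. intros t. unfold exp_osc.
  rewrite Cmult_0_r, Cmult_0_l, cexp_0. ring.
Qed.

Lemma cos_int_0 : cos_int 0 = PI.
Proof.
  unfold cos_int. simpl. rewrite (RInt_const (V := R_CompleteNormedModule)). unfold scal; simpl; unfold mult; simpl. field.
Qed.

Lemma cos_int_rec (n : nat) : INR (2 * S n) * cos_int (S n) = INR (S (2 * n)) * cos_int n.
Proof.
  pose proof (cos_osc_int_rec 0 n) as H. rewrite !cos_osc_int_cos_int, Cmult_0_l in H.
  replace (RtoC (INR (S n) * INR (S n)) - 0)%C with (RtoC (INR (S n) * INR (S n))) in H by ring.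
  rewrite <- !RtoC_mult in H. apply (f_equal Re) in H. rewrite !re_RtoC in H.
  assert (INR (2 * S n) = 2 * INR (S n)) as e by (rewrite mult_INR; simpl (INR 2); ring).
  rewrite e in *. pose proof (INR_S_pos n).
  apply Rmult_eq_reg_l with (2 * INR (S n)); [|lra].
  transitivity (4 * (INR (S n) * INR (S n)) * cos_int (S n)); [ring|]. rewrite H. ring.
Qed.

Lemma cos_int_pos (n : nat) : 0 < cos_int n.
Proof.
  induction n; [rewrite cos_int_0; apply PI_RGT_0|].
  pose proof (cos_int_rec n) as H. pose proof (INR_S_pos (2 * n)). assert (0 < INR (2 * S n)) by (apply lt_0_INR; lia).
  assert (0 < INR (2 * S n) * cos_int (S n)) by (rewrite H; apply Rmult_lt_0_compat; auto).
  apply Rmult_lt_reg_l with (INR (2 * S n)); auto. lra.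
Qed.

Lemma t_cos_le_sin (t : R) : 0 <= t <= PI / 2 -> t * cos t <= sin t.
Proof.
  intros Ht.
  destruct (MVT_gen (fun t => sin t - t * cos t) 0 t (fun t => t * sin t)) as [c [Hc E]].
  - intros x _. auto_derive; auto. ring.
  - intros x _. apply continuity_pt_filterlim. apply (ex_derive_continuous (V := R_NormedModule) (fun t => sin t - t * cos t)). auto_derive; auto.
  - rewrite Rmin_left, Rmax_right in Hc by lra.
    rewrite sin_0 in E. assert (0 <= sin c) by (apply sin_ge_0; lra).
    assert (0 <= c * sin c * (t - 0)); [|lra]. apply Rmult_le_pos; [apply Rmult_le_pos|]; lra.
Qed.

(** Controls the second moment of t: the weight t^2 (cos t)^(2n+2) is at most (cos t)^(2n) - (cos
    t)^(2n+2), whose integral is small compared with that of the power itself. *)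
Lemma sqr_cos_le (t : R) : - (PI / 2) <= t <= PI / 2 -> t ^ 2 * cos t ^ 2 <= 1 - cos t ^ 2.
Proof.
  intros Ht. pose proof (sin2_cos2 t) as h; unfold Rsqr in h.
  replace (1 - cos t ^ 2) with (sin t ^ 2) by (simpl; lra). rewrite <- Rpow_mult_distr.
  assert (0 <= cos t) by (apply cos_ge_0; lra).
  destruct (Rle_dec 0 t).
  - apply pow_incr. split; [apply Rmult_le_pos; auto|apply t_cos_le_sin; lra].
  - replace ((t * cos t) ^ 2) with ((- t * cos (- t)) ^ 2) by (rewrite cos_neg; ring).
    replace (sin t ^ 2) with (sin (- t) ^ 2) by (rewrite sin_neg; ring).
    apply pow_incr. split; [apply Rmult_le_pos; [lra|rewrite cos_neg; auto]|apply t_cos_le_sin; lra].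
Qed.

Lemma exp_osc_bound (s : C) (t : R) : - (PI / 2) <= t <= PI / 2 -> Cmod (exp_osc s t - 1) <= 2 * Cmod s * exp (PI * Cmod s) * Rabs t.
Proof.
  intros Ht. eapply Rle_trans; [apply cexp_sub_1|].
  assert (Cmod (RtoC 2 * Ci * s * RtoC t) = 2 * Cmod s * Rabs t) as ->.
  { rewrite !Cmod_mult, Cmod_Ci, !Cmod_R, (Rabs_right 2) by lra. ring. }
  assert (Rabs t <= PI / 2) as h by (apply Rabs_le; lra).
  pose proof (Cmod_ge_0 s). pose proof (Rabs_pos t).
  assert (exp (2 * Cmod s * Rabs t) <= exp (PI * Cmod s)) as h2 by (apply exp_le; nra).
  replace (2 * Cmod s * exp (PI * Cmod s) * Rabs t) with (2 * Cmod s * Rabs t * exp (PI * Cmod s)) by ring.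
  apply Rmult_le_compat_l; auto. apply Rmult_le_pos; lra.
Qed.

(** The weight (cos t)^(2n+2) concentrates at t = 0, where e^{2ist} is 1. The deviation is bounded
    by K |t| <= K (d + t^2/d), and by [cos_int_rec] the second moment is at most the total mass
    divided by 2n + 1. *)
Lemma cos_osc_int_conc (s : C) (n : nat) (d : R) : 0 < d ->
  let K := 2 * Cmod s * exp (PI * Cmod s) in
  Cmod (cos_osc_int s (S n) - RtoC (cos_int (S n))) <= K * cos_int (S n) * (d + / d / INR (S (2 * n))).
Proof.
  intros Hd K. assert (0 <= K) as HK.
  { unfold K. apply Rmult_le_pos; [pose proof (Cmod_ge_0 s); lra|left; apply exp_pos]. }
  pose proof PI_RGT_0 as hpi.
  rewrite <- cos_osc_int_cos_int. unfold cos_osc_int. rewrite <- cRInt_minus by apply ccont_cos_osc_int.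
  assert (is_RInt (fun t => K * (d - / d) * cos t ^ (2 * S n) + K * / d * cos t ^ (2 * n)) (- (PI / 2)) (PI / 2)
    (K * (d - / d) * cos_int (S n) + K * / d * cos_int n)) as I.
  { apply (is_RInt_plus (V := R_NormedModule)); apply (is_RInt_scal (V := R_NormedModule) (fun t => cos t ^ _));
    apply (RInt_correct (V := R_CompleteNormedModule)), (ex_RInt_continuous (V := R_CompleteNormedModule)); intros; apply continuous_cosn. }
  apply Rle_trans with (K * (d - / d) * cos_int (S n) + K * / d * cos_int n).
  - rewrite <- (is_RInt_unique _ _ _ _ I). apply cRInt_bound; [lra| | |eexists; apply I].
    + apply ccont_minus; [apply (ccont_cos_osc_int s)|apply (ccont_cos_osc_int 0)].
    + intros t Ht.
      replace (exp_osc s t * RtoC (cos t ^ (2 * S n)) - exp_osc 0 t * RtoC (cos t ^ (2 * S n)))%C with ((exp_osc s t - 1) * RtoC (cos t ^ (2 * S n)))%C.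
      2:{ unfold exp_osc at 3. rewrite Cmult_0_r, Cmult_0_l, cexp_0. ring. }
      rewrite Cmod_mult, Cmod_R.
      replace (2 * S n)%nat with (2 + 2 * n)%nat by lia. rewrite pow_add.
      assert (0 <= cos t) as hc by (apply cos_ge_0; lra).
      set (c2 := cos t ^ 2). set (c := cos t ^ (2 * n)).
      assert (0 <= c2) by (apply pow_le; auto). assert (0 <= c) by (apply pow_le; auto).
      rewrite Rabs_right by (apply Rle_ge, Rmult_le_pos; auto).
      apply Rle_trans with (K * (d + t ^ 2 / d) * (c2 * c)).
      * apply Rmult_le_compat_r; [apply Rmult_le_pos; auto|].
        eapply Rle_trans; [apply exp_osc_bound; auto|]. apply Rmult_le_compat_l; auto. apply abs_le_amgm; auto.
      * pose proof (sqr_cos_le t Ht) as h. fold c2 in h.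
        replace (K * (d + t ^ 2 / d) * (c2 * c)) with (K * d * (c2 * c) + K * / d * c * (t ^ 2 * c2)) by (field; lra).
        replace (K * (d - / d) * (c2 * c) + K * / d * c) with (K * d * (c2 * c) + K * / d * c * (1 - c2)) by (field; lra).
        apply Rplus_le_compat_l, Rmult_le_compat_l; auto.
        apply Rmult_le_pos; [apply Rmult_le_pos; [exact HK|left; apply Rinv_0_lt_compat; auto]|auto].
  - right. pose proof (INR_S_pos (2 * n)). pose proof (cos_int_rec n) as R.
    assert (cos_int n = INR (2 * S n) / INR (S (2 * n)) * cos_int (S n)) as ->.
    { apply Rmult_eq_reg_l with (INR (S (2 * n))); [|lra]. rewrite <- R. field. lra. }
    replace (2 * S n)%nat with (S (S (2 * n))) by lia. rewrite (S_INR (S (2 * n))). field. lra.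
Qed.

Lemma cos_osc_int_ratio (s : C) : climit eventually (fun n => cos_osc_int s n / RtoC (cos_int n))%C 1.
Proof.
  apply climit_incr. set (K := 2 * Cmod s * exp (PI * Cmod s)).
  assert (0 <= K) as HK.
  { unfold K. apply Rmult_le_pos; [pose proof (Cmod_ge_0 s); lra|left; apply exp_pos]. }
  apply (climit_squeeze _ _ _ (fun n => (2 * K) / sqrt (INR n))); [|apply lim_inv_sqrt].
  exists 1%nat. intros n Hn.
  assert (1 <= INR n) as Hn1 by (apply le_INR in Hn; simpl in Hn; lra).
  assert (1 <= sqrt (INR n)) as Hs by (rewrite <- sqrt_1; apply sqrt_le_1_alt; auto).
  assert (sqrt (INR n) * sqrt (INR n) = INR n) as Hss by (apply sqrt_sqrt; lra).
  set (r := sqrt (INR n)) in *.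
  (* Again d = 1/sqrt n, which makes both error terms O(1/sqrt n). *)
  pose proof (cos_osc_int_conc s n (/ r) ltac:(apply Rinv_0_lt_compat; lra)) as H. cbv zeta in H. fold K in H.
  pose proof (cos_int_pos (S n)) as he. set (e := cos_int (S n)) in *.
  assert (RtoC e <> 0%C) as hne by (apply RtoC_neq_0; lra).
  replace (cos_osc_int s (S n) / RtoC e - 1)%C with ((cos_osc_int s (S n) - RtoC e) / RtoC e)%C by (field; auto).
  rewrite Cmod_div, Cmod_R, (Rabs_right e) by (auto; lra).
  apply Rmult_le_reg_r with e; auto. unfold Rdiv at 1. rewrite Rmult_assoc, Rinv_l, Rmult_1_r by lra.
  eapply Rle_trans; [apply H|].
  replace (2 * K / r * e) with (K * e * (/ r + / r)) by (field; lra).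
  apply Rmult_le_compat_l; [apply Rmult_le_pos; lra|]. apply Rplus_le_compat_l.
  rewrite Rinv_inv, S_INR, mult_INR. simpl (INR 2). replace (1 + 1) with 2 by ring. rewrite <- Hss.
  apply Rmult_le_reg_r with (r * (2 * (r * r) + 1)); [nra|].
  replace (r / (2 * (r * r) + 1) * (r * (2 * (r * r) + 1))) with (r * r) by (field; nra).
  replace (/ r * (r * (2 * (r * r) + 1))) with (2 * (r * r) + 1) by (field; lra). pose proof (Rle_0_sqr r) as hr; unfold Rsqr in hr; lra.
Qed.

(** The factor 4 ((n+1)^2 - s^2) of the recurrence splits into s + n + 1 and 1 - s + n, the next
    factors of the two Pochhammer symbols. The one of s is a factor longer because it also contains
    s itself. *)
Lemma cos_osc_int_poch (s : C) (n : nat) :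
  (RtoC PI * cos_osc_int s n * (cpoch s (S n) * cpoch (1 - s) n) = RtoC (cos_int n) * RtoC (INR (fact n) * INR (fact n)) * (s * cos_osc_int s 0))%C.
Proof.
  induction n.
  - rewrite cos_int_0. simpl. rewrite Rmult_1_l. ring.
  - pose proof (cos_osc_int_rec s n) as R. pose proof (cos_int_rec n) as r.
    pose proof (INR_S_pos n) as hp. pose proof (INR_S_pos (2 * n)) as hp2.
    assert (INR (2 * S n) = 2 * INR (S n)) as e by (rewrite mult_INR; simpl (INR 2); ring). rewrite e in *.
    assert (RtoC 2 * RtoC (INR (S n)) <> 0)%C as hnz by (rewrite <- RtoC_mult; apply RtoC_neq_0; lra).
    assert (RtoC 4 = RtoC 2 * RtoC 2)%C as h4 by (rewrite <- RtoC_mult; f_equal; ring).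
    assert (RtoC (cos_int (S n)) * (RtoC 2 * RtoC (INR (S n))) = RtoC (INR (S (2 * n))) * RtoC (cos_int n))%C as r'.
    { rewrite <- !RtoC_mult. f_equal. lra. }
    assert ((RtoC 2 * RtoC (INR (S n))) * (RtoC 2 * (RtoC PI * cos_osc_int s (S n) * (cpoch s (S (S n)) * cpoch (1 - s) (S n)))) =
      (RtoC 2 * RtoC (INR (S n))) * (RtoC 2 * (RtoC (cos_int (S n)) * RtoC (INR (fact (S n)) * INR (fact (S n))) * (s * cos_osc_int s 0))))%C as E.
    { transitivity ((RtoC PI * (cpoch s (S n) * cpoch (1 - s) n)) * RtoC (INR (S n)) * (RtoC 4 * (RtoC (INR (S n) * INR (S n)) - s * s) * cos_osc_int s (S n)))%C.
      { change (cpoch s (S (S n))) with (cpoch s (S n) * (s + RtoC (INR (S n))))%C.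
        change (cpoch (1 - s) (S n)) with (cpoch (1 - s) n * (1 - s + RtoC (INR n)))%C.
        replace (1 - s + RtoC (INR n))%C with (RtoC (INR (S n)) - s)%C by (rewrite INR_Sk; ring).
        rewrite h4, RtoC_mult. ring. }
      rewrite R.
      transitivity (RtoC (INR (S n)) * RtoC (2 * INR (S n) * INR (S (2 * n))) * (RtoC PI * cos_osc_int s n * (cpoch s (S n) * cpoch (1 - s) n)))%C; [ring|].
      rewrite IHn, fact_simpl, mult_INR.
      transitivity (RtoC 2 * RtoC (INR (S n) * INR (fact n) * (INR (S n) * INR (fact n))) * (s * cos_osc_int s 0) * (RtoC (cos_int (S n)) * (RtoC 2 * RtoC (INR (S n)))))%C; [|ring].
      rewrite r', !RtoC_mult. ring. }
    assert (RtoC 2 * RtoC (INR (S n)) * RtoC 2 <> 0)%C as hnz2 by (apply Cmult_neq_0; auto; apply RtoC_neq_0; lra).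
    set (X := (RtoC PI * cos_osc_int s (S n) * (cpoch s (S (S n)) * cpoch (1 - s) (S n)))%C) in *.
    set (Y := (RtoC (cos_int (S n)) * RtoC (INR (fact (S n)) * INR (fact (S n))) * (s * cos_osc_int s 0))%C) in *.
    replace X with (/ (RtoC 2 * RtoC (INR (S n)) * RtoC 2) * ((RtoC 2 * RtoC (INR (S n))) * (RtoC 2 * X)))%C.
    + rewrite E. field. apply RtoC_neq_0; lra.
    + field. apply RtoC_neq_0; lra.
Qed.

Definition csin (w : C) : C := ((cexp (Ci * w) - cexp (- (Ci * w))) / (RtoC 2 * Ci))%C.

(** The Gauss products for s and 1 - s together form, by [cos_osc_int_poch], the sine divided by the
    ratio E_n(s)/E_n(0), and that ratio tends to 1. *)
Lemma reflection (s : C) : 0 < Re s < 1 -> (RtoC PI * (rgamma s * rgamma (1 - s)) = csin (RtoC PI * s))%C.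
Proof.
  intros Hs. pose proof eventually_filter as FF.
  assert (Re (1 - s) = 1 - Re s) as Hs' by (unfold Re; simpl; ring).
  assert (RtoC 2 * Ci <> 0)%C as h2i.
  { apply Cmult_neq_0; [apply RtoC_neq_0; lra|]. intros E; injection E; lra. }
  assert (s * cos_osc_int s 0 = csin (RtoC PI * s))%C as E0.
  { unfold csin. replace (Ci * (RtoC PI * s))%C with (RtoC PI * Ci * s)%C by ring. rewrite <- cos_osc_int_0. field.
    intros E; injection E; lra. }
  apply (climit_unique eventually (fun n => RtoC PI * (rgamma_seq s n * rgamma_seq (1 - s) n) * (cos_osc_int s n / RtoC (cos_int n)))%C).
  - replace (RtoC PI * (rgamma s * rgamma (1 - s)))%C with (RtoC PI * (rgamma s * rgamma (1 - s)) * 1)%C by ring.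
    apply climit_mult; try apply FF; [|apply cos_osc_int_ratio].
    apply climit_scal; [apply FF|]. apply climit_mult; try apply FF; apply rgamma_seq_lim; lra.
  (* The Gauss term for 1 - s has one factor more than [cos_osc_int_poch] supplies; divided by n, it
     is 1 + (1 - s)/n. *)
  - eapply (climit_ext_loc _ (fun n => csin (RtoC PI * s) * (1 + (1 - s) * RtoC (/ INR n)))%C).
    + exists 1%nat; intros n Hn.
      assert (1 <= INR n) as Hn1 by (apply le_INR in Hn; simpl in Hn; lra).
      pose proof (cos_osc_int_poch s n) as H. rewrite E0 in H.
      assert (RtoC (cos_int n) <> 0%C) as he by (apply RtoC_neq_0, Rgt_not_eq, cos_int_pos).
      assert (RtoC (INR (fact n)) <> 0%C) as hf by (apply RtoC_neq_0, not_0_INR, fact_neq_0).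
      assert (RtoC (INR n) <> 0%C) as hn by (apply RtoC_neq_0; lra).
      assert (cpow_pos (INR n) s * cpow_pos (INR n) (1 - s) = RtoC (INR n))%C as E1.
      { rewrite <- cpow_pos_add. replace (s + (1 - s))%C with (RtoC 1) by ring. unfold cpow_pos.
        rewrite <- RtoC_mult, cexp_RtoC, Rmult_1_l, exp_ln by lra. auto. }
      pose proof (cpow_pos_neq_0 (INR n) s) as h1. pose proof (cpow_pos_neq_0 (INR n) (1 - s)) as h2.
      unfold rgamma_seq. change (cpoch (1 - s) (S n)) with (cpoch (1 - s) n * (1 - s + RtoC (INR n)))%C.
      rewrite RtoC_mult in H.
      transitivity ((RtoC (cos_int n) * (RtoC (INR (fact n)) * RtoC (INR (fact n))) * csin (RtoC PI * s)) * (1 - s + RtoC (INR n))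
         / (RtoC (cos_int n) * (RtoC (INR (fact n)) * RtoC (INR (fact n))) * (cpow_pos (INR n) s * cpow_pos (INR n) (1 - s))))%C.
      * rewrite E1, RtoC_inv by lra. field. repeat split; auto.
      * rewrite <- H. field. repeat split; auto.
    + replace (csin (RtoC PI * s)) with (csin (RtoC PI * s) * (1 + (1 - s) * RtoC 0))%C at 1 by ring.
      apply climit_scal; [apply FF|]. apply climit_plus; try apply FF; [apply climit_const; apply FF|].
      apply climit_scal; [apply FF|]. apply climit_RtoC; [apply FF|].
      assert (is_lim_seq (fun n => 1 / (1 * INR n + 0)) 0) as h by (apply lim_inv_lin; lra).
      eapply filterlim_ext; [|apply h]. intros n; cbv beta. unfold Rdiv. rewrite Rmult_1_l, Rmult_1_l, Rplus_0_r. auto.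
Qed.

(** * The phase of Gamma(1/2 + i a) *)

Lemma quarter_plus_opp (a : R) : quarter_plus (- a) = quarter_minus a.
Proof. unfold quarter_plus, quarter_minus. rewrite RtoC_opp. unfold Cdiv; ring. Qed.

Lemma csin_quarter_plus (a : R) : csin (RtoC PI * quarter_plus a) =
  ((exp (PI * a / 2) + exp (- (PI * a / 2))) / (2 * sqrt 2), (exp (PI * a / 2) - exp (- (PI * a / 2))) / (2 * sqrt 2)).
Proof.
  unfold csin. set (y := PI * a / 2).
  assert (Ci * (RtoC PI * quarter_plus a) = RtoC (- y) + RtoC (PI / 4) * Ci)%C as E.
  { unfold quarter_plus, y, Cdiv. rewrite <- RtoC_inv by lra. csimp; field. }
  rewrite E.
  replace (- (RtoC (- y) + RtoC (PI / 4) * Ci))%C with (RtoC y + RtoC (- (PI / 4)) * Ci)%C by (rewrite !RtoC_opp; ring).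
  rewrite !cexp_add, !cexp_RtoC, !cexp_Ci, cos_neg, sin_neg, cos_PI4, sin_PI4.
  assert (sqrt 2 <> 0) as h by (apply Rgt_not_eq, sqrt_lt_R0; lra).
  assert (Ci <> 0)%C as hi by (intros F; injection F; lra).
  assert (RtoC 2 <> 0)%C as h2 by (apply RtoC_neq_0; lra).
  assert (/ (RtoC 2 * Ci) = ((0, - / 2)%R : C))%C as E2.
  { transitivity (((0, - / 2)%R : C) * (RtoC 2 * Ci) / (RtoC 2 * Ci))%C; [|field; auto].
    replace (((0, - / 2)%R : C) * (RtoC 2 * Ci))%C with (RtoC 1) by (csimp; field). unfold Cdiv; ring. }
  unfold Cdiv. rewrite E2. csimp; field; auto.
Qed.

Lemma atan_diff (x : R) : Rabs (x - atan x) <= x ^ 2.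
Proof.
  destruct (MVT_gen (fun t => t - atan t) 0 x (fun t => 1 - / (1 + Rsqr t))) as [c [Hc E]].
  - intros t _. apply (is_derive_minus (V := R_NormedModule)); [apply (is_derive_id t)|apply is_derive_atan].
  - intros t _. apply continuity_pt_filterlim.
    apply (continuous_minus (V := R_NormedModule) (fun t => t) atan); [apply continuous_id|apply continuous_atan].
  - rewrite atan_0 in E. replace (x - atan x) with (x - atan x - (0 - 0)) by ring. rewrite E.
    replace (1 - / (1 + Rsqr c)) with (Rsqr c / (1 + Rsqr c)) by (field; pose proof (Rle_0_sqr c); lra).
    rewrite Rminus_0_r, Rabs_mult, <- (pow2_abs x).
    assert (Rabs c <= Rabs x) as hc.
    { destruct (Rle_dec 0 x).
      - rewrite Rmin_left, Rmax_right in Hc by lra. rewrite !Rabs_right; lra.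
      - rewrite Rmin_right, Rmax_left in Hc by lra. rewrite !Rabs_left1; lra. }
    assert (Rabs (Rsqr c / (1 + Rsqr c)) <= Rabs c) as h.
    { pose proof (Rle_0_sqr c) as hs. rewrite Rabs_right by (apply Rle_ge, Rdiv_le_0_compat; lra).
      rewrite Rsqr_abs in *. unfold Rsqr in *. set (d := Rabs c) in *. assert (0 <= d) by apply Rabs_pos.
      apply Rmult_le_reg_r with (1 + d * d); [lra|]. unfold Rdiv. rewrite Rmult_assoc, Rinv_l by lra.
      pose proof (pow2_ge_0 (d - 1)). nra. }
    simpl. rewrite Rmult_1_r. apply Rmult_le_compat_r; [apply Rabs_pos|lra].
Qed.

Lemma ln_step (x : R) : 0 < x -> / (x + 1) <= ln (x + 1) - ln x <= / x.
Proof.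
  intros Hx.
  assert (forall u, 0 < u -> ln u <= u - 1) as L.
  { intros u Hu. destruct (Req_dec (u - 1) 0) as [h|h].
    - replace u with 1 by lra. rewrite ln_1; lra.
    - pose proof (exp_ineq1 (u - 1) h). rewrite <- (ln_exp (u - 1)). apply ln_le; lra. }
  split.
  - pose proof (L (x / (x + 1)) ltac:(apply Rdiv_lt_0_compat; lra)) as h. rewrite ln_div in h by lra.
    replace (x / (x + 1) - 1) with (- / (x + 1)) in h by (field; lra). lra.
  - pose proof (L ((x + 1) / x) ltac:(apply Rdiv_lt_0_compat; lra)) as h. rewrite ln_div in h by lra.
    replace ((x + 1) / x - 1) with (/ x) in h by (field; lra). lra.
Qed.

Definition phase_seq (a : R) (n : nat) : R := a * ln (INR n) - sum_f_R0 (fun k => atan (a / (INR k + /2))) n.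

(** Both a (ln(n+1) - ln n) and atan (a/(n + 3/2)) differ from a/(n + 3/2) by O(1/n^2). *)
Lemma phase_seq_step (a : R) (n : nat) : (1 <= n)%nat ->
  Rabs (phase_seq a (S n) - phase_seq a n) <= (a ^ 2 + 2 * Rabs a) / (INR n * INR n).
Proof.
  intros Hn. assert (1 <= INR n) as h1 by (apply le_INR in Hn; simpl in Hn; lra).
  unfold phase_seq. cbn [sum_f_R0]. rewrite S_INR.
  set (S0 := sum_f_R0 _ n). set (x := INR n) in *.
  set (w := a / (x + 1 + / 2)).
  replace (a * ln (x + 1) - (S0 + atan w) - (a * ln x - S0)) with (a * ((ln (x + 1) - ln x) - / (x + 1 + / 2)) + (w - atan w)).
  2:{ unfold w. field. lra. }
  eapply Rle_trans; [apply Rabs_triang|].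
  assert (Rabs (w - atan w) <= a ^ 2 / (x * x)) as hA.
  { eapply Rle_trans; [apply atan_diff|]. unfold w.
    replace ((a / (x + 1 + / 2)) ^ 2) with (a ^ 2 * / ((x + 1 + / 2) ^ 2)) by (field; lra).
    apply Rmult_le_compat_l; [apply pow2_ge_0|]. apply Rinv_le_contravar; nra. }
  assert (Rabs (a * ((ln (x + 1) - ln x) - / (x + 1 + / 2))) <= 2 * Rabs a / (x * x)) as hB.
  { rewrite Rabs_mult. pose proof (ln_step x ltac:(lra)) as [l1 l2].
    assert (/ (x + 1 + / 2) <= / (x + 1)) by (apply Rinv_le_contravar; lra).
    replace (2 * Rabs a / (x * x)) with (Rabs a * (2 / (x * x))) by (field; lra).
    apply Rmult_le_compat_l; [apply Rabs_pos|]. rewrite Rabs_right by lra.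
    apply Rle_trans with (/ x - / (x + 1 + / 2)); [lra|].
    replace (/ x - / (x + 1 + / 2)) with (3 / 2 * / (x * (x + 1 + / 2))) by (field; lra).
    unfold Rdiv. apply Rmult_le_compat; try lra.
    - left; apply Rinv_0_lt_compat; nra.
    - apply Rinv_le_contravar; nra. }
  replace ((a ^ 2 + 2 * Rabs a) / (x * x)) with (2 * Rabs a / (x * x) + a ^ 2 / (x * x)) by (field; lra). lra.
Qed.

(** The step bound is dominated by a telescoping difference of c/n, so adding a term c/n makes the
    sequence decreasing, and subtracting it instead gives the lower bound. *)
Lemma phase_seq_lim (a : R) : is_lim_seq (phase_seq a) (phGammaHalf a).
Proof.
  set (c := a ^ 2 + 2 * Rabs a).
  assert (0 <= c) as hc by (unfold c; pose proof (pow2_ge_0 a); pose proof (Rabs_pos a); lra).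
  assert (forall n, Rabs (phase_seq a (S (S (S n))) - phase_seq a (S (S n))) <= c / INR (S n) - c / INR (S (S n))) as St.
  { intros n. eapply Rle_trans; [apply phase_seq_step; lia|]. fold c. pose proof (INR_S_pos n) as h1.
    rewrite !(S_INR (S n)). set (x := INR (S n)) in *.
    replace (c / x - c / (x + 1)) with (c * / (x * (x + 1))) by (field; lra).
    unfold Rdiv. apply Rmult_le_compat_l; auto. apply Rinv_le_contravar; nra. }
  assert (ex_finite_lim_seq (fun n => phase_seq a (S (S n)) + c / INR (S n))) as [l Hl].
  { apply ex_finite_lim_seq_decr with (phase_seq a 2 - c / INR 1).
    - intros n. specialize (St n). apply Rabs_le_between in St. lra.
    - assert (forall n, phase_seq a 2 - c / INR 1 <= phase_seq a (S (S n)) - c / INR (S n)) as H.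
      { induction n; [lra|]. specialize (St n). apply Rabs_le_between in St. lra. }
      intros n. specialize (H n). assert (0 <= c / INR (S n)) by (apply Rdiv_le_0_compat; auto; apply INR_S_pos). lra. }
  assert (is_lim_seq (fun n => c / INR (S n)) 0) as H0.
  { apply (is_lim_seq_ext (fun n => c / (1 * INR n + 1))); [|apply lim_inv_lin; lra].
    intros n. rewrite S_INR. f_equal; ring. }
  assert (is_lim_seq (phase_seq a) l) as H.
  { apply (is_lim_seq_incr_n _ 2).
    apply (is_lim_seq_ext (fun n => phase_seq a (S (S n)) + c / INR (S n) - c / INR (S n))).
    - intros n. replace (n + 2)%nat with (S (S n)) by lia. ring.
    - replace (Finite l) with (Finite (l - 0)) by (f_equal; ring). apply is_lim_seq_minus'; auto. }
  change (phGammaHalf a) with (real (Lim_seq (phase_seq a))).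
  rewrite (is_lim_seq_unique _ _ H). auto.
Qed.

(** Each factor 1/2 + k + ia has positive real part, so [atan] gives its argument and no branch has
    to be chosen; the arguments add up. *)
Lemma polar_half (a : R) (m : nat) : exists r, 0 < r /\
  cpoch (RtoC (1/2) + Ci * RtoC a) (S m) = (RtoC r * cexp (RtoC (sum_f_R0 (fun k => atan (a / (INR k + /2))) m) * Ci))%C.
Proof.
  assert (forall x, 0 < x -> exists r, 0 < r /\ (RtoC x + Ci * RtoC a = RtoC r * cexp (RtoC (atan (a / x)) * Ci))%C) as H.
  { intros x Hx. exists (x * sqrt (1 + Rsqr (a / x))).
    assert (0 < sqrt (1 + Rsqr (a / x))) as h by (apply sqrt_lt_R0; pose proof (Rle_0_sqr (a / x)); lra).
    split; [apply Rmult_lt_0_compat; auto|].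
    rewrite cexp_Ci, cos_atan, sin_atan. set (q := sqrt (1 + Rsqr (a / x))) in *. csimp; field; lra. }
  induction m as [|m [r [Hr IH]]].
  - destruct (H (1/2) ltac:(lra)) as [r [Hr E]]. exists r; split; auto. simpl.
    replace (0 + / 2) with (1/2) by field. rewrite <- E. ring.
  - destruct (H (INR (S m) + / 2) ltac:(pose proof (INR_S_pos m); lra)) as [r2 [Hr2 E]].
    exists (r * r2). split; [apply Rmult_lt_0_compat; auto|].
    change (cpoch (RtoC (1/2) + Ci * RtoC a) (S (S m))) with (cpoch (RtoC (1/2) + Ci * RtoC a) (S m) * (RtoC (1/2) + Ci * RtoC a + RtoC (INR (S m))))%C.
    rewrite IH. replace (RtoC (1/2) + Ci * RtoC a + RtoC (INR (S m)))%C with (RtoC (INR (S m) + / 2) + Ci * RtoC a)%C.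
    2:{ rewrite RtoC_plus. replace (/ 2) with (1/2) by field. ring. }
    rewrite E. cbn [sum_f_R0]. rewrite RtoC_plus, Cmult_plus_distr_r, cexp_add, RtoC_mult. ring.
Qed.

Lemma poch_dup (x : C) (n : nat) :
  (RtoC (4 ^ n) * (cpoch x n * cpoch (x + RtoC (1/2)) n) = cpoch (RtoC 2 * x) (2 * n))%C.
Proof.
  induction n; [simpl; ring|].
  replace (2 * S n)%nat with (S (S (2 * n))) by lia. cbn [cpoch pow]. rewrite <- IHn, INR_Sk, INR_2k, RtoC_half, RtoC_mult.
  replace (RtoC 4) with (RtoC 2 * RtoC 2)%C by (rewrite <- RtoC_mult; f_equal; ring). field.
Qed.

(* By duplication the first three factors give a positive multiple of 1 / Gamma(1/2 + ia), so this
   product is positive exactly when phGammaHalf a is an argument of Gamma(1/2 + ia). *)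
Definition phase_product (a : R) : C :=
  (rgamma (quarter_plus a) * rgamma (quarter_plus a + RtoC (1/2)) * cpow_pos 2 (- (Ci * RtoC a)) * cexp (RtoC (phGammaHalf a) * Ci))%C.

(** The approximants [u] are positive reals for n >= 1: after duplication the argument of the
    Pochhammer product is exactly the sum of arctangents that [phase_seq] subtracts. A limit of
    nonnegative reals equals its own modulus. *)
Lemma phase_product_pos (a : R) : phase_product a = RtoC (Cmod (phase_product a)).
Proof.
  pose proof eventually_filter as FF.
  assert (Re (quarter_plus a + RtoC (1/2)) = 3/4) as Hq2 by (rewrite re_plus, Re_quarter_plus, re_RtoC; field).
  (* The duplicated product ends at index 2n + 1, so [phase_seq] brings in ln(2n + 1), while the
     powers of n and of 2 combine to ln(2n). This local [th] is the phase defect between the two and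
     tends to 0. *)
  set (th := fun n => a * (ln (INR (2 * n + 1)) - ln (INR (2 * n)))).
  set (u := fun n => (rgamma_seq (quarter_plus a) n * rgamma_seq (quarter_plus a + RtoC (1/2)) n * cpow_pos 2 (- (Ci * RtoC a)) * cexp (RtoC (phase_seq a (2 * n + 1)) * Ci) * cexp (RtoC (- th n) * Ci))%C).
  assert (climit eventually u (phase_product a)) as L.
  { replace (phase_product a) with (phase_product a * cexp (RtoC 0 * Ci))%C.
    2:{ rewrite Cmult_0_l, cexp_0. ring. }
    apply climit_mult; try apply FF.
    - unfold phase_product. apply climit_mult; try apply FF; [apply climit_mult; try apply FF; [apply climit_mult; try apply FF; apply rgamma_seq_lim; rewrite ?Re_quarter_plus; lra|apply climit_const; apply FF]|].
      apply climit_ccts; [apply FF|apply ccts_cexp|]. apply climit_mult; try apply FF; [|apply climit_const; apply FF].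
      apply climit_RtoC; [apply FF|].
      apply (filterlim_comp _ _ _ (fun n => 2 * n + 1)%nat (phase_seq a) _ eventually); [|apply phase_seq_lim].
      apply eventually_subseq_loc. exists O; intros; lia.
    - apply climit_ccts; [apply FF|apply ccts_cexp|]. apply climit_mult; try apply FF; [|apply climit_const; apply FF].
      apply climit_RtoC; [apply FF|].
      replace 0 with (- 0) by ring. apply (is_lim_seq_opp th 0).
      unfold th. replace 0 with (a * 0) by ring. apply (is_lim_seq_scal_l _ a 0).
      apply (is_lim_seq_le_le_loc (fun _ => 0) _ (fun n => 1 / (1 * INR n + 0))); [|apply is_lim_seq_const|apply lim_inv_lin; lra].
      exists 1%nat. intros n Hn.
      assert (1 <= INR n) as Hn1 by (apply le_INR in Hn; simpl in Hn; lra).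
      rewrite plus_INR, mult_INR. simpl (INR 2). simpl (INR 1).
      pose proof (ln_step ((1 + 1) * INR n) ltac:(lra)) as [h1 h2].
      assert (0 < / ((1 + 1) * INR n + 1)) by (apply Rinv_0_lt_compat; lra).
      assert (/ ((1 + 1) * INR n) <= / (1 * INR n + 0)) by (apply Rinv_le_contravar; lra).
      unfold Rdiv; lra. }
  assert (exists N, forall n, (N <= n)%nat -> exists r, 0 <= r /\ u n = RtoC r) as [N HN].
  { exists 1%nat. intros n Hn.
    assert (1 <= INR n) as Hn1 by (apply le_INR in Hn; simpl in Hn; lra).
    pose proof (poch_dup (quarter_plus a) (S n)) as D.
    replace (RtoC 2 * quarter_plus a)%C with (RtoC (1/2) + Ci * RtoC a)%C in D.
    2:{ unfold quarter_plus. replace (RtoC (1/2)) with (RtoC 2 * RtoC (1/4))%C by (rewrite <- RtoC_mult; f_equal; field). field. }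
    replace (2 * S n)%nat with (S (2 * n + 1)) in D by lia.
    destruct (polar_half a (2 * n + 1)) as [r [Hr E]]. rewrite E in D.
    set (Sg := sum_f_R0 _ (2 * n + 1)) in *.
    assert (0 < INR (fact n)) as hf by apply lt_0_INR, lt_O_fact.
    assert (0 < 4 ^ S n) as h4 by (apply pow_lt; lra).
    exists (r / (4 ^ S n * (INR (fact n) * INR (fact n) * INR n))).
    assert (0 < 4 ^ S n * (INR (fact n) * INR (fact n) * INR n)) as hq by (apply Rmult_lt_0_compat; [auto|apply Rmult_lt_0_compat; [apply Rmult_lt_0_compat; auto|lra]]).
    split; [left; apply Rdiv_lt_0_compat; auto|].
    assert (cpow_pos (INR n) (quarter_plus a) * cpow_pos (INR n) (quarter_plus a + RtoC (1/2)) = RtoC (INR n) * cexp (RtoC (a * ln (INR n)) * Ci))%C as E1.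
    { rewrite <- cpow_pos_add. replace (quarter_plus a + (quarter_plus a + RtoC (1/2)))%C with (RtoC 1 + Ci * RtoC a)%C.
      2:{ unfold quarter_plus. replace (RtoC 1) with (RtoC (1/4) + RtoC (1/4) + RtoC (1/2))%C by (rewrite <- !RtoC_plus; f_equal; field). field. }
      rewrite cpow_pos_add. unfold cpow_pos. rewrite <- RtoC_mult, cexp_RtoC, Rmult_1_l, exp_ln by lra.
      do 2 f_equal. rewrite RtoC_mult. ring. }
    assert (RtoC (INR (fact n)) <> 0%C) as hf0 by (apply RtoC_neq_0; lra).
    assert (RtoC (INR n) <> 0%C) as hn0 by (apply RtoC_neq_0; lra).
    assert (RtoC (4 ^ S n) <> 0%C) as h40 by (apply RtoC_neq_0; lra).
    pose proof (cpow_pos_neq_0 (INR n) (quarter_plus a)) as h1. pose proof (cpow_pos_neq_0 (INR n) (quarter_plus a + RtoC (1/2))) as h2.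
    set (e1 := cexp (RtoC (a * ln (INR n)) * Ci)) in *.
    assert (e1 <> 0%C) as he1 by apply cexp_neq_0.
    assert (cexp (RtoC Sg * Ci) * cpow_pos 2 (- (Ci * RtoC a)) * cexp (RtoC (phase_seq a (2 * n + 1)) * Ci) * cexp (RtoC (- th n) * Ci) = e1)%C as Ep.
    { unfold e1, cpow_pos. rewrite <- !cexp_add. f_equal.
      replace (- (Ci * RtoC a) * RtoC (ln 2))%C with (RtoC (- (a * ln 2)) * Ci)%C by (rewrite RtoC_opp, RtoC_mult; ring).
      rewrite <- !Cmult_plus_distr_r, <- !RtoC_plus. do 2 f_equal.
      unfold phase_seq, th. fold Sg. rewrite (mult_INR 2 n), ln_mult by (simpl; lra). replace (INR 2) with 2 by (simpl; ring). ring. }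
    unfold u, rgamma_seq.
    transitivity ((RtoC (4 ^ S n) * (cpoch (quarter_plus a) (S n) * cpoch (quarter_plus a + RtoC (1/2)) (S n))) * (cpow_pos 2 (- (Ci * RtoC a)) * cexp (RtoC (phase_seq a (2 * n + 1)) * Ci) * cexp (RtoC (- th n) * Ci))
      / (RtoC (4 ^ S n) * (RtoC (INR (fact n)) * RtoC (INR (fact n)) * (cpow_pos (INR n) (quarter_plus a) * cpow_pos (INR n) (quarter_plus a + RtoC (1/2))))))%C.
    { field. repeat split; auto. }
    rewrite D, E1.
    transitivity (RtoC r * (cexp (RtoC Sg * Ci) * cpow_pos 2 (- (Ci * RtoC a)) * cexp (RtoC (phase_seq a (2 * n + 1)) * Ci) * cexp (RtoC (- th n) * Ci))
      / (RtoC (4 ^ S n) * (RtoC (INR (fact n)) * RtoC (INR (fact n)) * (RtoC (INR n) * e1))))%C.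
    { field. repeat split; auto. }
    rewrite Ep, RtoC_div, !RtoC_mult by lra. field. repeat split; auto. }
  assert (climit eventually u (RtoC (Cmod (phase_product a)))) as L2.
  { eapply (climit_ext_loc _ (fun n => RtoC (Cmod (u n)))).
    - exists N; intros n Hn. destruct (HN n Hn) as [r [Hr ->]]. rewrite Cmod_R, Rabs_right; auto. lra.
    - apply climit_RtoC; [apply FF|]. apply climit_Cmod; auto. apply FF. }
  apply (climit_unique eventually u); auto.
Qed.

(** * The integrals of the two Weber solutions *)

Lemma cpoch_conj (s : C) (n : nat) : cpoch (Cconj s) n = Cconj (cpoch s n).
Proof.
  induction n; simpl; [rewrite RtoC_conj; auto|].
  rewrite IHn, Cmult_conj, Cplus_conj, RtoC_conj; auto.
Qed.

Lemma rgamma_conj (s : C) : rgamma (Cconj s) = Cconj (rgamma s).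
Proof.
  unfold rgamma. rewrite <- climseq_conj. apply climseq_ext. intros n.
  rewrite cpoch_conj, cpow_pos_conj. unfold Cdiv. rewrite Cmult_conj, Cinv_conj, Cmult_conj, RtoC_conj; auto.
  apply Cmult_neq_0; [apply RtoC_neq_0, not_0_INR, fact_neq_0|apply cpow_pos_neq_0].
Qed.

Lemma half_conj (b : C) : Cconj (b / RtoC 2) = (Cconj b / RtoC 2)%C.
Proof. rewrite Cdiv_conj, RtoC_conj; auto. apply RtoC_neq_0; lra. Qed.

Lemma U_at_0_conj (b : C) : U_at_0 (Cconj b) = Cconj (U_at_0 b).
Proof.
  unfold U_at_0. rewrite Cdiv_conj, Cmult_conj, RtoC_conj by apply cpow_pos_neq_0.
  rewrite <- rgamma_conj, <- cpow_pos_conj, !Cplus_conj, !RtoC_conj, half_conj. auto.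
Qed.

Lemma dU_at_0_conj (b : C) : dU_at_0 (Cconj b) = Cconj (dU_at_0 b).
Proof.
  unfold dU_at_0. rewrite Copp_conj, Cdiv_conj, Cmult_conj, RtoC_conj by apply cpow_pos_neq_0.
  rewrite <- rgamma_conj, <- cpow_pos_conj, Cplus_conj, Cminus_conj, !RtoC_conj, half_conj. auto.
Qed.

Definition ia (a : R) : C := (Ci * RtoC a)%C.
Definition root8 : C := cexp (RtoC (PI / 4) * Ci).
Definition root8_inv : C := cexp (RtoC (- (PI / 4)) * Ci).

Lemma ia_conj (a : R) : Cconj (ia a) = (- ia a)%C.
Proof. unfold ia. rewrite Cmult_conj, Ci_conj, RtoC_conj. ring. Qed.

Lemma Re_ia (a : R) : Re (ia a) = 0.
Proof. unfold ia, Re; simpl; ring. Qed.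

Lemma root8_root8_inv : (root8 * root8_inv)%C = 1.
Proof. unfold root8, root8_inv. rewrite <- cexp_add, <- Cmult_plus_distr_r, <- RtoC_plus, Rplus_opp_r, Cmult_0_l. apply cexp_0. Qed.

Lemma Ci_root8_inv : (Ci * root8_inv)%C = root8.
Proof.
  unfold root8, root8_inv. transitivity (cexp (RtoC (PI / 2) * Ci) * cexp (RtoC (- (PI / 4)) * Ci))%C.
  { rewrite cexp_PI2. auto. }
  rewrite <- cexp_add, <- Cmult_plus_distr_r, <- RtoC_plus. do 3 f_equal. field.
Qed.

Lemma root8_inv_conj : Cconj root8_inv = root8.
Proof.
  unfold root8, root8_inv. rewrite <- cexp_conj, Cmult_conj, RtoC_conj, Ci_conj, RtoC_opp. f_equal; ring.
Qed.

Lemma root8_conj : Cconj root8 = root8_inv.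
Proof. rewrite <- root8_inv_conj. apply Cconj_conj. Qed.

Lemma Ci_sqr : (Ci * Ci)%C = (- (1))%C.
Proof. csimp; ring. Qed.

Lemma Wj_0 (a : R) (z : C) : Wj 0 a z = pcf (ia a) (U_at_0 (ia a)) (dU_at_0 (ia a)) (z * root8_inv).
Proof.
  unfold Wj. cbn [cpown]. rewrite PCU_pcf. fold root8_inv.
  replace (1 * Ci * RtoC a)%C with (ia a) by (unfold ia; ring).
  replace (1 * z * root8_inv)%C with (z * root8_inv)%C by ring. auto.
Qed.

Lemma Wj_3 (a : R) (z : C) : Wj 3 a z = pcf (- ia a) (Cconj (U_at_0 (ia a))) (Cconj (dU_at_0 (ia a))) (Ci * (z * root8_inv)).
Proof.
  unfold Wj. rewrite PCU_pcf. fold root8_inv.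
  replace (cpown (RtoC (-1)) 3 * Ci * RtoC a)%C with (- ia a)%C.
  2:{ unfold ia. replace (RtoC (-1)) with (- (1))%C by (rewrite <- RtoC_opp; f_equal; ring). cbn [cpown]. ring. }
  replace (cpown (- Ci) 3 * z * root8_inv)%C with (Ci * (z * root8_inv))%C.
  2:{ cbn [cpown]. transitivity (- (Ci * Ci) * Ci * z * root8_inv)%C; [rewrite Ci_sqr|]; ring. }
  rewrite <- ia_conj, U_at_0_conj, dU_at_0_conj. auto.
Qed.

(** Two quarter turns: the parameter goes to -b and back, and the derivative picks up i^2. *)
Lemma pcf_opp (b A B z : C) : pcf b A B (- z) = pcf b A (- B) z.
Proof.
  replace (- z)%C with (Ci * (Ci * z))%C.
  2:{ rewrite Cmult_assoc, Ci_sqr; ring. }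
  replace b with (- - b)%C at 1 by ring. rewrite pcf_rot, pcf_rot. f_equal.
  rewrite Cmult_assoc, Ci_sqr; ring.
Qed.

Definition pcf_seg_int (b A B x : C) : C := cRInt (fun t => pcf b A B (RtoC t * x) * x)%C 0 1.

Lemma ccont_pcf_seg_int (b A B x : C) : ccont (fun t => pcf b A B (RtoC t * x) * x)%C.
Proof.
  apply ccont_mult; [|apply ccont_const]. apply ccont_ccts; [apply ccts_pcf|].
  apply ccont_mult; [apply ccont_RtoC_id|apply ccont_const].
Qed.

Lemma pcf_seg_int_lin (b A B x : C) : pcf_seg_int b A B x = (A * pcf_seg_int b 1 0 x + B * pcf_seg_int b 0 1 x)%C.
Proof.
  unfold pcf_seg_int. rewrite <- (cRInt_scal A), <- (cRInt_scal B) by apply ccont_pcf_seg_int.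
  rewrite <- cRInt_plus by (apply ccont_mult; [apply ccont_const|apply ccont_pcf_seg_int]).
  apply cRInt_ext. intros t. rewrite pcf_lin. ring.
Qed.

Lemma pcf_seg_int_rot (b A B x : C) : pcf_seg_int (- b) A B (Ci * x) = (Ci * pcf_seg_int b A (Ci * B) x)%C.
Proof.
  unfold pcf_seg_int. rewrite <- cRInt_scal by apply ccont_pcf_seg_int. apply cRInt_ext. intros t.
  replace (RtoC t * (Ci * x))%C with (Ci * (RtoC t * x))%C by ring. rewrite pcf_rot. ring.
Qed.

Lemma ray_int_eq (f : C -> C) (z l : C) (th : R) :
  climit (Rbar_locally p_infty) (fun L => cRInt (fun s => f (z + RtoC s * cexp (RtoC th * Ci)) * cexp (RtoC th * Ci))%C 0 L) l ->
  ray_int f z th = l.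
Proof. intros H. apply (climit_infty_eq _ _ H). Qed.

Lemma mehler_time_conj (b : C) (t : R) : mehler_time (Cconj b) t = Cconj (mehler_time b t).
Proof. unfold mehler_time. rewrite Cmult_conj, RtoC_conj, <- cexp_conj, Cmult_conj, Copp_conj, RtoC_conj. auto. Qed.

Lemma ccont_pcf_shift_coeff (b A B x : C) : ccont (fun s => pcf b A B (x + RtoC s)%C).
Proof.
  apply ccont_ccts; [apply ccts_pcf|]. apply ccont_plus; [apply ccont_const|apply ccont_RtoC_id].
Qed.

(** One number K0 serves both solutions, since the kernels for -ia and ia are conjugate. [J_value]
    gives the integrals from 0, and [ray_shift_coeff] moves the starting point to an arbitrary x. *)
Lemma J_exists (a : R) : exists K0, is_improper (mehler_time (- ia a)) K0 /\
  forall x, is_improper (fun s => pcf (- ia a) (Cconj (U_at_0 (ia a))) (Cconj (dU_at_0 (ia a))) (x + RtoC s)%C)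
     (- Cconj (dU_at_0 (ia a)) * K0 - pcf_seg_int (- ia a) (Cconj (U_at_0 (ia a))) (Cconj (dU_at_0 (ia a))) x)%C /\
  is_improper (fun s => pcf (ia a) (U_at_0 (ia a)) (dU_at_0 (ia a)) (x + RtoC s)%C)
     (- dU_at_0 (ia a) * Cconj K0 - pcf_seg_int (ia a) (U_at_0 (ia a)) (dU_at_0 (ia a)) x)%C.
Proof.
  pose proof (Rbar_locally_filter p_infty) as FF.
  assert (Re (- ia a) = 0) as Hb by (rewrite re_opp, Re_ia; ring).
  destruct (mehler_K_ex (- ia a) 0 Hb) as [K0 [HK0 _]].
  assert (is_improper (mehler_time (- ia a)) K0) as H0.
  { eapply climit_ext; [apply FF| |apply HK0]. intros T; apply cRInt_ext; intros t. unfold mehler_K; simpl; ring. }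
  assert (is_improper (mehler_time (ia a)) (Cconj K0)) as H1.
  { eapply (climit_ext _ (fun T => Cconj (cRInt (mehler_time (- ia a)) 0 T))).
    - intros T. rewrite <- cRInt_conj by apply ccont_mehler_time. apply cRInt_ext; intros t.
      rewrite <- mehler_time_conj, Copp_conj, ia_conj. f_equal; ring.
    - apply climit_conj; [apply FF|apply H0]. }
  destruct (U_bounded (ia a) (Re_ia a)) as [K [K' [B1 B2]]].
  destruct (U_bounded (- ia a) Hb) as [L [L' [B3 B4]]].
  rewrite <- ia_conj, U_at_0_conj, dU_at_0_conj, ia_conj in B3, B4.
  pose proof (J_value _ _ _ _ _ _ (Re_ia a) B1 B2 H1) as J1.
  pose proof (J_value _ _ _ _ _ _ Hb B3 B4 H0) as J2.
  exists K0. split; [auto|].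
  intros x. split; [apply (ray_shift_coeff _ _ _ x _ L B3 J2)|apply (ray_shift_coeff _ _ _ x _ K B1 J1)].
Qed.

(** Multiplication by [root8_inv] makes the ray of direction pi/4 horizontal; the factor [root8] is
    the differential along the ray. *)
Lemma ray_int_W0 (a : R) (K0 z : C) :
  (forall x, is_improper (fun s => pcf (ia a) (U_at_0 (ia a)) (dU_at_0 (ia a)) (x + RtoC s)%C)
     (- dU_at_0 (ia a) * Cconj K0 - pcf_seg_int (ia a) (U_at_0 (ia a)) (dU_at_0 (ia a)) x)%C) ->
  ray_int (Wj 0 a) z (PI / 4) = (root8 * (- dU_at_0 (ia a) * Cconj K0 - pcf_seg_int (ia a) (U_at_0 (ia a)) (dU_at_0 (ia a)) (z * root8_inv)))%C.
Proof.
  intros H. pose proof (Rbar_locally_filter p_infty) as FF. apply ray_int_eq. fold root8.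
  eapply (climit_ext _ (fun L => root8 * cRInt (fun s => pcf (ia a) (U_at_0 (ia a)) (dU_at_0 (ia a)) (z * root8_inv + RtoC s)) 0 L)%C).
  - intros L. rewrite <- cRInt_scal by apply ccont_pcf_shift_coeff. apply cRInt_ext; intros s. rewrite Wj_0.
    replace ((z + RtoC s * root8) * root8_inv)%C with (z * root8_inv + RtoC s * (root8 * root8_inv))%C by ring. rewrite root8_root8_inv, Cmult_1_r. ring.
  - apply climit_scal; [apply FF|]. apply H.
Qed.

(** Here the horizontal variable is i times the rotated one: i e^{-i pi/4} = e^{i pi/4} straightens
    the direction -pi/4. *)
Lemma ray_int_W3 (a : R) (K0 z : C) :
  (forall x, is_improper (fun s => pcf (- ia a) (Cconj (U_at_0 (ia a))) (Cconj (dU_at_0 (ia a))) (x + RtoC s)%C)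
     (- Cconj (dU_at_0 (ia a)) * K0 - pcf_seg_int (- ia a) (Cconj (U_at_0 (ia a))) (Cconj (dU_at_0 (ia a))) x)%C) ->
  ray_int (Wj 3 a) z (- (PI / 4)) = (root8_inv * (- Cconj (dU_at_0 (ia a)) * K0 - pcf_seg_int (- ia a) (Cconj (U_at_0 (ia a))) (Cconj (dU_at_0 (ia a))) (Ci * (z * root8_inv))))%C.
Proof.
  intros H. pose proof (Rbar_locally_filter p_infty) as FF. apply ray_int_eq. fold root8_inv.
  eapply (climit_ext _ (fun L => root8_inv * cRInt (fun s => pcf (- ia a) (Cconj (U_at_0 (ia a))) (Cconj (dU_at_0 (ia a))) (Ci * (z * root8_inv) + RtoC s)) 0 L)%C).
  - intros L. rewrite <- cRInt_scal by apply ccont_pcf_shift_coeff. apply cRInt_ext; intros s. rewrite Wj_3.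
    replace (Ci * ((z + RtoC s * root8_inv) * root8_inv))%C with (Ci * (z * root8_inv) + RtoC s * ((Ci * root8_inv) * root8_inv))%C by ring.
    rewrite Ci_root8_inv, root8_root8_inv, Cmult_1_r. ring.
  - apply climit_scal; [apply FF|]. apply H.
Qed.

(** The Gamma arguments 3/4 + ia/2 and 1/4 - ia/2 add up to 1 and the powers of 2 cancel, so the
    reflection formula applies. *)
Lemma AB_conj (a : R) : (U_at_0 (ia a) * Cconj (dU_at_0 (ia a)))%C = (- csin (RtoC PI * quarter_minus a))%C.
Proof.
  rewrite <- dU_at_0_conj, ia_conj. rewrite <- reflection by (rewrite Re_quarter_minus; lra). unfold U_at_0, dU_at_0.
  replace (RtoC (1/4) + - ia a / RtoC 2)%C with (quarter_minus a) by (unfold quarter_minus, ia, Cdiv; ring).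
  replace (RtoC (3/4) + ia a / RtoC 2)%C with (1 - quarter_minus a)%C.
  2:{ unfold quarter_minus, ia. replace (RtoC (3/4)) with (RtoC 1 - RtoC (1/4))%C by (rewrite <- RtoC_minus; f_equal; field). unfold Cdiv; ring. }
  replace (- ia a / RtoC 2 - RtoC (1/4))%C with (- (ia a / RtoC 2 + RtoC (1/4)))%C by (unfold Cdiv; ring).
  assert (cpow_pos 2 (- (ia a / RtoC 2 + RtoC (1/4))) = / cpow_pos 2 (ia a / RtoC 2 + RtoC (1/4)))%C as ->.
  { unfold cpow_pos. rewrite <- cexp_opp. f_equal; ring. }
  replace (RtoC PI) with (RtoC (sqrt PI) * RtoC (sqrt PI))%C.
  2:{ rewrite <- RtoC_mult, sqrt_sqrt; auto. left; apply PI_RGT_0. }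
  pose proof (cpow_pos_neq_0 2 (ia a / RtoC 2 + RtoC (1/4))) as h. field. auto.
Qed.

Lemma quarter_plus_conj_half (a : R) : Cconj (quarter_plus a + RtoC (1/2)) = (1 - quarter_plus a)%C.
Proof.
  unfold quarter_plus. rewrite !Cplus_conj, !RtoC_conj, half_conj, Cmult_conj, Ci_conj, RtoC_conj.
  replace (RtoC 1) with (RtoC (1/4) + RtoC (1/4) + RtoC (1/2))%C by (rewrite <- !RtoC_plus; f_equal; field).
  unfold Cdiv; ring.
Qed.

(** The product A B contains the reciprocal Gamma values at q = 1/4 + ia/2 and q + 1/2, that is, a
    multiple of 1/Gamma(1/2 + ia), whose phase [phase_product_pos] removes. The conjugate of q + 1/2
    is 1 - q, so the modulus is again given by reflection. *)
Lemma AB_phase (a : R) : (U_at_0 (ia a) * dU_at_0 (ia a) * cexp (RtoC (phGammaHalf a) * Ci))%C = (- RtoC (Cmod (csin (RtoC PI * quarter_plus a))))%C.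
Proof.
  assert (RtoC (Cmod (csin (RtoC PI * quarter_plus a))) = RtoC PI * phase_product a)%C as ->.
  { rewrite phase_product_pos, <- RtoC_mult. f_equal.
    rewrite <- reflection by (rewrite Re_quarter_plus; lra). rewrite !Cmod_mult, Cmod_R, Rabs_right by (left; apply PI_RGT_0).
    f_equal. unfold phase_product. rewrite !Cmod_mult, Cmod_cpow_pos, Cmod_cexp.
    rewrite <- quarter_plus_conj_half, rgamma_conj, Cmod_conj.
    replace (Re (- (Ci * RtoC a))) with 0 by (unfold Re; simpl; ring).
    replace (Re (RtoC (phGammaHalf a) * Ci)) with 0 by (unfold Re; simpl; ring).
    rewrite Rmult_0_l, exp_0. ring. }
  unfold phase_product, U_at_0, dU_at_0.
  replace (RtoC (1/4) + ia a / RtoC 2)%C with (quarter_plus a) by (unfold quarter_plus, ia, Cdiv; ring).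
  replace (RtoC (3/4) + ia a / RtoC 2)%C with (quarter_plus a + RtoC (1/2))%C.
  2:{ unfold quarter_plus, ia. replace (RtoC (3/4)) with (RtoC (1/2) + RtoC (1/4))%C by (rewrite <- RtoC_plus; f_equal; field). unfold Cdiv; ring. }
  fold (ia a).
  assert (cpow_pos 2 (- ia a) = / (cpow_pos 2 (ia a / RtoC 2 + RtoC (1/4)) * cpow_pos 2 (ia a / RtoC 2 - RtoC (1/4))))%C as ->.
  { rewrite <- cpow_pos_add. unfold cpow_pos. rewrite <- cexp_opp. f_equal. field. }
  replace (RtoC PI) with (RtoC (sqrt PI) * RtoC (sqrt PI))%C.
  2:{ rewrite <- RtoC_mult, sqrt_sqrt; auto. left; apply PI_RGT_0. }
  pose proof (cpow_pos_neq_0 2 (ia a / RtoC 2 + RtoC (1/4))) as h.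
  pose proof (cpow_pos_neq_0 2 (ia a / RtoC 2 - RtoC (1/4))) as h2. field. auto.
Qed.

(** * The Wronskian constant and the coefficients *)

(** The coefficient of W_0 in [Wc]; that of W_3 is its conjugate. *)
Definition weber_alpha (a : R) : C := (RtoC (sqrt (/2 * kW a) * exp (PI * a / 4)) * cexp (RtoC (rhoW a) * Ci))%C.
(** [weber_P] and [weber_Q] are the coordinates of W(a, .) in the even and odd basis of the rotated
    variable. *)
Definition weber_P (a : R) : C := (weber_alpha a * U_at_0 (ia a) + Cconj (weber_alpha a) * Cconj (U_at_0 (ia a)))%C.
Definition weber_Q (a : R) : C := (weber_alpha a * dU_at_0 (ia a) + Cconj (weber_alpha a) * (Ci * Cconj (dU_at_0 (ia a))))%C.

Lemma Wj_3_basis (a : R) (z : C) : Wj 3 a z = pcf (ia a) (Cconj (U_at_0 (ia a))) (Ci * Cconj (dU_at_0 (ia a))) (z * root8_inv).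
Proof. rewrite Wj_3, pcf_rot. auto. Qed.

Lemma Wc_eq (a : R) (z : C) : Wc a z = (weber_P a * pcf (ia a) 1 0 (z * root8_inv) + weber_Q a * pcf (ia a) 0 1 (z * root8_inv))%C.
Proof.
  unfold Wc. rewrite Wj_0, Wj_3_basis, pcf_lin, (pcf_lin _ (Cconj _)).
  assert (Cconj (weber_alpha a) = RtoC (sqrt (/2 * kW a) * exp (PI * a / 4)) * cexp (RtoC (- rhoW a) * Ci))%C as E.
  { unfold weber_alpha. rewrite Cmult_conj, RtoC_conj, <- cexp_conj, Cmult_conj, RtoC_conj, Ci_conj, RtoC_opp. do 2 f_equal; ring. }
  unfold weber_P, weber_Q. rewrite E. unfold weber_alpha. ring.
Qed.

Lemma Wc_opp (a : R) (z : C) : Wc a (- z) = (weber_P a * pcf (ia a) 1 0 (z * root8_inv) - weber_Q a * pcf (ia a) 0 1 (z * root8_inv))%C.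
Proof.
  rewrite Wc_eq. replace (- z * root8_inv)%C with (- (z * root8_inv))%C by ring. rewrite !pcf_opp.
  rewrite (pcf_lin _ 1 (- 0)), (pcf_lin _ 0 (- (1))). ring.
Qed.

Lemma seg_int_lin (f : C -> C) (b p q z : C) :
  (forall t, f t = p * pcf b 1 0 (t * root8_inv) + q * pcf b 0 1 (t * root8_inv))%C ->
  seg_int f 0 z = (root8 * (p * pcf_seg_int b 1 0 (z * root8_inv) + q * pcf_seg_int b 0 1 (z * root8_inv)))%C.
Proof.
  intros H. rewrite <- pcf_seg_int_lin. unfold seg_int, pcf_seg_int. rewrite <- cRInt_scal by apply ccont_pcf_seg_int.
  apply cRInt_ext. intros t. rewrite H, <- pcf_lin.
  replace ((0 + RtoC t * (z - 0)) * root8_inv)%C with (RtoC t * (z * root8_inv))%C by ring.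
  transitivity (pcf b p q (RtoC t * (z * root8_inv)) * ((root8 * root8_inv) * z))%C; [rewrite root8_root8_inv|]; ring.
Qed.

Lemma kW_pos (a : R) : 0 < kW a.
Proof.
  unfold kW. replace (2 * PI * a) with (PI * a + PI * a) by ring. rewrite exp_plus. set (E := exp (PI * a)).
  assert (0 < E) by apply exp_pos.
  assert (sqrt (E * E) < sqrt (1 + E * E)) by (apply sqrt_lt_1_alt; nra). rewrite sqrt_square in H0; lra.
Qed.

Lemma sqrt2_root8 : root8 = (RtoC (/ sqrt 2) * (1 + Ci))%C.
Proof.
  unfold root8. rewrite cexp_Ci, cos_PI4, sin_PI4. assert (sqrt 2 <> 0) by (apply Rgt_not_eq, sqrt_lt_R0; lra). csimp; field; auto.
Qed.

Lemma exp_half_sqr (a : R) : exp (PI * a) = exp (PI * a / 2) * exp (PI * a / 2).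
Proof. rewrite <- exp_plus. f_equal; field. Qed.

(** The bracket is the Wronskian of W_0 and W_3 in the rotated variable. Its two products are A B^*
    and its conjugate, so [AB_conj] determines it and no phase is involved. *)
Lemma wronskian_const (a : R) :
  (- Ci * RtoC (exp (PI * a / 2)) * (Ci * (U_at_0 (ia a) * Cconj (dU_at_0 (ia a))) - Cconj (U_at_0 (ia a)) * dU_at_0 (ia a)))%C = (- root8)%C.
Proof.
  assert (Cconj (U_at_0 (ia a)) * dU_at_0 (ia a) = Cconj (U_at_0 (ia a) * Cconj (dU_at_0 (ia a))))%C as E by (rewrite Cmult_conj, Cconj_conj; auto).
  rewrite E, AB_conj, <- quarter_plus_opp, csin_quarter_plus, sqrt2_root8.
  replace (PI * - a / 2) with (- (PI * a / 2)) by field. rewrite Ropp_involutive, exp_Ropp.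
  set (x := exp (PI * a / 2)). assert (0 < x) by apply exp_pos.
  assert (sqrt 2 <> 0) by (apply Rgt_not_eq, sqrt_lt_R0; lra). csimp; field; split; auto; lra.
Qed.

(** The source of the square root in [kW]. *)
Lemma Cmod_csin (a : R) : exp (PI * a / 2) * (2 * Cmod (csin (RtoC PI * quarter_plus a))) = sqrt (1 + exp (2 * PI * a)).
Proof.
  rewrite csin_quarter_plus, exp_Ropp. set (x := exp (PI * a / 2)). assert (0 < x) by apply exp_pos.
  replace (exp (2 * PI * a)) with (x * x * (x * x)).
  2:{ unfold x. rewrite <- !exp_plus. f_equal; field. }
  rewrite <- (sqrt_square (x * (2 * Cmod _))).
  2:{ apply Rmult_le_pos; [lra|]. apply Rmult_le_pos; [lra|apply Cmod_ge_0]. }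
  f_equal.
  set (c := ((x + / x) / (2 * sqrt 2), (x - / x) / (2 * sqrt 2)) : C).
  transitivity (4 * x * x * (Cmod c ^ 2)); [ring|]. rewrite Cmod2_alt. unfold c, Re, Im; simpl fst; simpl snd.
  assert (sqrt 2 * sqrt 2 = 2) as h by (apply sqrt_sqrt; lra).
  assert (sqrt 2 <> 0) by (apply Rgt_not_eq, sqrt_lt_R0; lra).
  transitivity (4 * x * x * ((x + / x) ^ 2 + (x - / x) ^ 2) / (4 * (sqrt 2 * sqrt 2))); [field; split; auto; lra|].
  rewrite h. field. lra.
Qed.

(** In the expansion of P Q the terms with alpha^2 and its conjugate have the phase of A B cancelled
    by 2 rho = ph Gamma(1/2 + ia) + pi/4, and the mixed terms are free of rho. All three are real
    multiples of [root8]. *)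
Lemma PQ_const (a : R) : (RtoC 2 * (weber_P a * weber_Q a))%C = (- root8)%C.
Proof.
  set (A := U_at_0 (ia a)). set (B := dU_at_0 (ia a)). set (x := exp (PI * a / 2)). assert (0 < x) as hx by apply exp_pos.
  set (k := kW a). pose proof (kW_pos a) as hk. fold k in hk.
  set (R0 := Cmod (csin (RtoC PI * quarter_plus a))).
  assert (sqrt (/ 2 * k) * exp (PI * a / 4) * (sqrt (/ 2 * k) * exp (PI * a / 4)) = k / 2 * x) as hs.
  { replace (sqrt (/ 2 * k) * exp (PI * a / 4) * (sqrt (/ 2 * k) * exp (PI * a / 4))) with
      (sqrt (/ 2 * k) * sqrt (/ 2 * k) * (exp (PI * a / 4) * exp (PI * a / 4))) by ring.
    rewrite sqrt_sqrt, <- exp_plus by lra. unfold x. replace (PI * a / 4 + PI * a / 4) with (PI * a / 2) by field. field. }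
  set (m := sqrt (/ 2 * k) * exp (PI * a / 4)) in *.
  assert (weber_alpha a = RtoC m * cexp (RtoC (rhoW a) * Ci))%C as Ea by reflexivity.
  assert (weber_alpha a * weber_alpha a = RtoC (k / 2 * x) * (cexp (RtoC (phGammaHalf a) * Ci) * root8))%C as E1.
  { rewrite Ea, <- hs, (RtoC_mult m m). unfold root8. rewrite <- cexp_add, <- Cmult_plus_distr_r, <- RtoC_plus.
    replace (phGammaHalf a + PI / 4) with (rhoW a + rhoW a) by (unfold rhoW; field).
    rewrite RtoC_plus, Cmult_plus_distr_r, cexp_add. ring. }
  assert (weber_alpha a * Cconj (weber_alpha a) = RtoC (k / 2 * x))%C as E2.
  { rewrite Ea, Cmult_conj, RtoC_conj, <- cexp_conj, Cmult_conj, RtoC_conj, Ci_conj.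
    replace (RtoC (rhoW a) * - Ci)%C with (- (RtoC (rhoW a) * Ci))%C by ring. rewrite cexp_opp, <- hs, (RtoC_mult m m).
    pose proof (cexp_neq_0 (RtoC (rhoW a) * Ci)). field. auto. }
  assert (weber_alpha a * weber_alpha a * (A * B) = - (RtoC (k / 2 * x) * RtoC R0 * root8))%C as E3.
  { rewrite E1. transitivity (RtoC (k / 2 * x) * root8 * (A * B * cexp (RtoC (phGammaHalf a) * Ci)))%C; [ring|].
    unfold A, B. rewrite AB_phase. fold R0. ring. }
  assert (Cconj (weber_alpha a) * Cconj (weber_alpha a) * (Ci * (Cconj A * Cconj B)) = - (RtoC (k / 2 * x) * RtoC R0 * root8))%C as E4.
  { transitivity (Ci * Cconj (weber_alpha a * weber_alpha a * (A * B)))%C; [rewrite !Cmult_conj; ring|]. rewrite E3.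
    rewrite Copp_conj, !Cmult_conj, !RtoC_conj, root8_conj, <- Ci_root8_inv. ring. }
  assert (Ci * (A * Cconj B) + Cconj A * B = - (RtoC x * root8))%C as E5.
  { assert (Cconj A * B = Cconj (A * Cconj B))%C as E by (rewrite Cmult_conj, Cconj_conj; auto).
    rewrite E. unfold A, B. rewrite AB_conj, <- quarter_plus_opp, csin_quarter_plus, sqrt2_root8.
    replace (PI * - a / 2) with (- (PI * a / 2)) by field. rewrite Ropp_involutive, exp_Ropp. fold x.
    assert (sqrt 2 <> 0) by (apply Rgt_not_eq, sqrt_lt_R0; lra). csimp; field; split; auto; lra. }
  unfold weber_P, weber_Q. fold A B.
  transitivity (RtoC 2 * (weber_alpha a * weber_alpha a * (A * B) + Cconj (weber_alpha a) * Cconj (weber_alpha a) * (Ci * (Cconj A * Cconj B))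
    + (weber_alpha a * Cconj (weber_alpha a)) * (Ci * (A * Cconj B) + Cconj A * B)))%C; [ring|].
  rewrite E2, E3, E4, E5.
  (* The bracket is sqrt(1 + e^{2 pi a}) + e^{pi a}, so this is the difference of two squares. *)
  assert (k * (x * (2 * R0) + x * x) = 1) as hf.
  { unfold R0, x. rewrite Cmod_csin, <- exp_half_sqr. unfold k, kW.
    replace (2 * PI * a) with (PI * a + PI * a) by ring. rewrite exp_plus. set (E := exp (PI * a)).
    transitivity (sqrt (1 + E * E) * sqrt (1 + E * E) - E * E); [ring|]. rewrite sqrt_sqrt; [ring|].
    assert (0 < E) by apply exp_pos. nra. }
  transitivity (- (RtoC (2 * (k / 2 * x) * (2 * R0 + x)) * root8))%C.
  - rewrite !RtoC_mult, RtoC_plus, !RtoC_mult. ring.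
  - replace (2 * (k / 2 * x) * (2 * R0 + x)) with (k * (x * (2 * R0) + x * x)) by field. rewrite hf. ring.
Qed.

(** The imaginary part of K0 produces the term with Y, and the real part, through the Beta integral,
    the term with Gamma in the numerator. *)
Lemma c00_value (a : R) (K0 : C) : is_improper (mehler_time (- ia a)) K0 ->
  c00 a = (Ci * RtoC (exp (PI * a / 2)) * root8_inv * (- Cconj (dU_at_0 (ia a)) * K0))%C.
Proof.
  intros HK.
  assert (Re (- ia a) = 0) as Hb by (rewrite re_opp, Re_ia; ring).
  pose proof (K0_hyp _ _ Hb HK) as HY.
  assert (K0 = RtoC (cosh_cos_int (1/2) a) + Ci * RtoC (2 * Yfun a))%C as EK.
  { apply C_eq.
    - replace (Re (RtoC (cosh_cos_int (1/2) a) + Ci * RtoC (2 * Yfun a))) with (cosh_cos_int (1/2) a) by (unfold Re; simpl; ring).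
      apply Re_K0. apply HK.
    (* For b = -ia the factor b + 1/2 of [K0_hyp] is (1 - 2ia)/2, so dividing by 1 - 2ia leaves
       K0/2. *)
    - assert (Yfun a = Im K0 / 2) as ->; [|unfold Im; simpl; field].
      unfold Yfun.
      replace (RtoC (5/4) - Ci * RtoC a / RtoC 2)%C with (RtoC (5/4) + - ia a / RtoC 2)%C by (unfold ia, Cdiv; ring).
      rewrite HY.
      assert (1 - RtoC 2 * Ci * RtoC a <> 0)%C as hn.
      { intros F. apply (f_equal Re) in F. unfold Re in F; simpl in F. lra. }
      replace (/ (1 - RtoC 2 * Ci * RtoC a) * ((- ia a + RtoC (1/2)) * K0))%C with (K0 * RtoC (/ 2))%C.
      + unfold Im; simpl; field.
      + rewrite RtoC_half, RtoC_inv by lra. unfold ia. field. auto. }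
  set (r := cosh_cos_int (1/2) a) in *. set (Y := Yfun a) in *.
  pose proof (cosh_cos_int_rgamma a) as HR. fold r in HR.
  pose proof (rgamma_neq_0 (quarter_plus a) ltac:(rewrite Re_quarter_plus; lra)) as hq.
  pose proof PI_RGT_0 as hpi. assert (0 < sqrt PI) as hsp by (apply sqrt_lt_R0; auto).
  assert (0 < sqrt 2) as hs2 by (apply sqrt_lt_R0; lra).
  assert (sqrt PI * sqrt PI = PI) as hpp by (apply sqrt_sqrt; lra).
  assert (RtoC (sqrt PI) * (RtoC r * rgamma (quarter_minus a)) = RtoC (/ (2 * sqrt 2)) / rgamma (quarter_plus a))%C as Hr.
  (* Reflection at s = 1/4: the value is sin(pi/4), read off from [csin_quarter_plus] at parameter
     0. *)
  { assert (RtoC PI * (rgamma (RtoC (1/4)) * rgamma (RtoC (3/4))) = RtoC (/ sqrt 2))%C as h.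
    { pose proof (reflection (RtoC (1/4)) ltac:(rewrite re_RtoC; lra)) as h.
      replace (1 - RtoC (1/4))%C with (RtoC (3/4)) in h by (rewrite <- RtoC_minus; f_equal; field). rewrite h.
      replace (RtoC (1/4)) with (quarter_plus 0) by (unfold quarter_plus, Cdiv; ring). rewrite csin_quarter_plus.
      replace (PI * 0 / 2) with 0 by field. rewrite Ropp_0, exp_0. csimp; field; lra. }
    replace (RtoC (sqrt PI) * (RtoC r * rgamma (quarter_minus a)))%C with
      (RtoC (sqrt PI) * (RtoC r * (rgamma (quarter_minus a) * rgamma (quarter_plus a))) / rgamma (quarter_plus a))%C by (field; auto).
    rewrite HR. f_equal.
    transitivity (RtoC (/ 2) * (RtoC (sqrt PI * sqrt PI) * (rgamma (RtoC (1/4)) * rgamma (RtoC (3/4)))))%C.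
    { rewrite RtoC_mult, RtoC_div by lra. rewrite RtoC_inv by lra. field. }
    rewrite hpp, h, <- RtoC_mult. f_equal. field. lra. }
  rewrite EK, <- dU_at_0_conj, ia_conj. unfold dU_at_0, c00. fold Y.
  replace (RtoC (1/4) + - ia a / RtoC 2)%C with (quarter_minus a) by (unfold quarter_minus, ia, Cdiv; ring).
  fold (quarter_minus a) (quarter_plus a).
  set (X := cpow_pos 2 (quarter_plus a)).
  assert (X <> 0%C) as hX by apply cpow_pos_neq_0.
  replace (cpow_pos 2 (- ia a / RtoC 2 - RtoC (1/4))) with (/ X)%C.
  2:{ unfold X, cpow_pos. rewrite <- cexp_opp. f_equal. unfold quarter_plus, ia, Cdiv. ring. }
  assert (cpow_pos 2 (RtoC (5/4) + Ci * RtoC a / RtoC 2) = RtoC 2 * X)%C as ->.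
  { unfold X. replace (RtoC (5/4) + Ci * RtoC a / RtoC 2)%C with (RtoC 1 + quarter_plus a)%C.
    2:{ unfold quarter_plus. replace (RtoC (5/4)) with (RtoC 1 + RtoC (1/4))%C by (rewrite <- RtoC_plus; f_equal; field). ring. }
    rewrite cpow_pos_add. f_equal. unfold cpow_pos. rewrite <- RtoC_mult, cexp_RtoC, Rmult_1_l, exp_ln by lra. auto. }
  assert (cpow_pos 2 (RtoC (- (5/4)) + Ci * RtoC a / RtoC 2) = RtoC (/ (2 * sqrt 2)) * X)%C as ->.
  { unfold X. replace (RtoC (- (5/4)) + Ci * RtoC a / RtoC 2)%C with (RtoC (- (1 + 1/2)) + quarter_plus a)%C.
    2:{ unfold quarter_plus. replace (RtoC (- (5/4))) with (RtoC (- (1 + 1/2)) + RtoC (1/4))%C by (rewrite <- RtoC_plus; f_equal; field). ring. }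
    rewrite cpow_pos_add. f_equal. unfold cpow_pos. rewrite <- RtoC_mult, cexp_RtoC. f_equal.
    replace (- (1 + 1/2) * ln 2) with (- (ln 2 + / 2 * ln 2)) by field.
    rewrite exp_Ropp, exp_plus, exp_ln by lra. f_equal. f_equal. rewrite <- (Rpower_sqrt 2) by lra. reflexivity. }
  set (x := exp (PI * a / 2)).
  assert (cexp (RtoC (PI * a / 2) + RtoC (PI / 4) * Ci) = RtoC x * root8)%C as ->.
  { rewrite cexp_add, cexp_RtoC. reflexivity. }
  assert (cexp (RtoC (PI * a / 2) + RtoC (3 * PI / 4) * Ci) = RtoC x * (Ci * root8))%C as ->.
  { rewrite cexp_add, cexp_RtoC. fold x. f_equal. unfold root8.
    transitivity (cexp (RtoC (PI / 2) * Ci) * cexp (RtoC (PI / 4) * Ci))%C; [|rewrite cexp_PI2; auto].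
    rewrite <- cexp_add, <- Cmult_plus_distr_r, <- RtoC_plus. do 3 f_equal. field. }
  transitivity (RtoC x * root8 * X * (RtoC (sqrt PI) * (RtoC r * rgamma (quarter_minus a)) + RtoC (sqrt PI) * rgamma (quarter_minus a) * (Ci * RtoC (2 * Y))))%C.
  - rewrite Hr, (RtoC_mult 2 Y). unfold Cdiv. ring.
  - rewrite <- Ci_root8_inv. field. auto.
Qed.

Theorem theorem2p9 (a : R) (z : C) :
  NW a z = (c00 a * Wj 0 a z + c03 a * Wj 3 a z - NhatW a z)%C.
Proof.
  destruct (J_exists a) as [K0 [HK HJ]].
  pose proof (c00_value a K0 HK) as E0.
  assert (c03 a = - (Ci * RtoC (exp (PI * a / 2)) * root8 * (- dU_at_0 (ia a) * Cconj K0)))%C as E3.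
  { unfold c03. rewrite E0, !Cmult_conj, Copp_conj, Cconj_conj, RtoC_conj, Ci_conj, root8_inv_conj. ring. }
  unfold NW, NhatW.
  rewrite (seg_int_lin (fun t => Wc a (- t)%C) (ia a) (weber_P a) (- weber_Q a)%C) by (intros t; rewrite Wc_opp; ring).
  rewrite (seg_int_lin (Wc a) (ia a) (weber_P a) (weber_Q a)) by (intros t; apply Wc_eq).
  rewrite (ray_int_W0 a K0 z (fun x => proj2 (HJ x))), (ray_int_W3 a K0 z (fun x => proj1 (HJ x))).
  rewrite (Wc_opp a z), (Wc_eq a z), E0, E3, (Wj_0 a z), (Wj_3_basis a z).
  rewrite pcf_seg_int_rot, (pcf_seg_int_lin (ia a) (U_at_0 (ia a))), (pcf_seg_int_lin (ia a) (Cconj (U_at_0 (ia a)))).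
  rewrite (pcf_lin (ia a) (U_at_0 (ia a))), (pcf_lin (ia a) (Cconj (U_at_0 (ia a)))).
  pose proof (PQ_const a) as H1. pose proof (wronskian_const a) as H2.
  set (A := U_at_0 (ia a)) in *. set (B := dU_at_0 (ia a)) in *. set (x := RtoC (exp (PI * a / 2))) in *.
  set (ee := pcf (ia a) 1 0 (z * root8_inv)). set (oo := pcf (ia a) 0 1 (z * root8_inv)).
  set (ie := pcf_seg_int (ia a) 1 0 (z * root8_inv)). set (io := pcf_seg_int (ia a) 0 1 (z * root8_inv)).
  (* In N_W the terms with P^2 and Q^2 cancel, leaving the antisymmetric combination of the basis
     and its integrals. On the right the multiples of K0 in the coefficients cancel those in the ray
     integrals, and the same combination remains with the Wronskian of W_0 and W_3 as its factor. *)
  transitivity (RtoC 2 * (weber_P a * weber_Q a) * (root8 * (oo * ie - ee * io)))%C; [ring|].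
  rewrite H1, <- H2, <- Ci_root8_inv. ring.
Qed.
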